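(* There exist constants $c_1,c_2,C_1,C_2>0$ such that the following holds. Let $S\subseteq\{1,\dots,n\}$ with $|S|=s\le n/2$, let $x\in\mathbb{R}^n$ or $\mathbb{C}^n$ be supported on $S$ and satisfy the random sign assumption, let $A$ be the random sensing matrix of the setting with parameters $\Lambda(S,F)$ and $\Gamma(F)$, and let $y=Ax+\epsilon$ with $\|\epsilon\|_2\le\eta$. For every $0<\varepsilon<1$, if $$\Lambda(S,F)\ge c_1\,\Gamma(F)\quad\text{and}\quad m\ge c_2\,\Lambda(S,F)\ln^2\!\left(\tfrac{3n}{\varepsilon}\right),$$ then with probability at least $1-\varepsilon$ every minimizer $x^\sharp$ of (qBP) satisfies $\|x-x^\sharp\|_2\le(C_1+C_2\sqrt s)\eta$.
   Context: Setting: Let $n,m\ge 1$. For $\ell=1,\dots,m$ let $F_\ell$ be a probability distribution on $\mathbb{C}^{p_\ell\times n}$ ($p_\ell\ge1$), $F=(F_\ell)_{\ell=1}^m$, let $B_1,\dots,B_m$ be independent random matrices with $B_\ell\sim F_\ell$, and $A=\frac{1}{\sqrt m}\begin{pmatrix}B_1\\ \vdots\\ B_m\end{pmatrix}$. Isotropy is assumed: $\mathbb{E}(A^*A)=\frac1m\sum_{\ell=1}^m\mathbb{E}(B_\ell^*B_\ell)=\mathrm{Id}_n$. For $S\subseteq\{1,\dots,n\}$, $P_S$ is the restriction $P_Sx=x_S$, $M_S:=MP_S^*$, $B_{\ell,S}=B_\ell P_S^*$. $\|M\|_{p\to q}=\sup_{\|v\|_p\le1}\|Mv\|_q$; $\|M\|_{1\to2}$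 is the maximal $\ell^2$ norm of a column of $M$. $\Lambda(S,F)$ and $\Gamma(F)$ denote positive reals such that almost surely, for all $\ell$, $\|B_{\ell,S}^*B_{\ell,S}\|_{2\to2}\le\Lambda(S,F)$ and $\|B_\ell\|_{1\to2}^2=\max_{i}\|B_\ell e_i\|_2^2\le\Gamma(F)$. Random sign assumption: the vector $(x_i/|x_i|)_{i\in S}$ is a Rademacher sequence (independent uniform $\pm1$ entries) if $x$ is real, or a Steinhaus sequence (independent entries uniform on the complex unit circle) if $x$ is complex, independent of $A$. (qBP): $\min_{z\in\mathbb{C}^n}\|z\|_1$ s.t. $\|y-Az\|_2\le\eta$. *)

(* Defs.v *)
From HB Require Import structures.
From mathcomp Require Import all_boot all_order all_algebra.
From mathcomp Require Import all_classical all_reals all_analysis.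
From mathcomp Require Import complex.
Import ComplexField.Normc.

Set Implicit Arguments.
Unset Strict Implicit.
Unset Printing Implicit Defensive.

Import Order.TTheory GRing.Theory Num.Theory.
Local Open Scope classical_set_scope.
Local Open Scope ring_scope.
Local Open Scope complex_scope.

Section linear_algebra.
Variable R : realType.
Local Notation C := R[i].

Definition l2norm {k : nat} (v : 'cV[C]_k) : R :=
  Num.sqrt (\sum_(i < k) normc (v i 0) ^+ 2).

Definition l1norm {k : nat} (v : 'cV[C]_k) : R :=
  \sum_(i < k) normc (v i 0).

Definition adjmx {p k : nat} (M : 'M[C]_(p, k)) : 'M[C]_(k, p) :=
  (map_mx (@conjc R) M)^T.

Definition opnorm22 {p k : nat} (M : 'M[C]_(p, k)) : R :=
  sup [set l2norm (M *m v) | v in [set v : 'cV[C]_k | l2norm v <= 1]].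

Definition colS {p n : nat} (S : {set 'I_n}) (M : 'M[C]_(p, n))
  : 'M[C]_(p, #|S|) :=
  \matrix_(i < p, j < #|S|) M i (enum_val j).

Definition sensing {m n : nat} (p : 'I_m -> nat)
  (B : forall l : 'I_m, 'M[C]_(p l, n)) : 'M[C]_(\sum_(l < m) p l, n) :=
  ((Num.sqrt (m%:R : R))^-1)%:C *: mxcol B.

Definition qBP_feasible {q n : nat} (A : 'M[C]_(q, n)) (y : 'cV[C]_q)
  (eta : R) (z : 'cV[C]_n) : Prop :=
  l2norm (y - A *m z) <= eta.

Definition qBP_minimizer {q n : nat} (A : 'M[C]_(q, n)) (y : 'cV[C]_q)
  (eta : R) (z : 'cV[C]_n) : Prop :=
  qBP_feasible A y eta z /\
  forall w, qBP_feasible A y eta w -> l1norm z <= l1norm w.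

Definition csign (z : C) : C := z / (normc z)%:C.

Definition cexpi (t : R) : C := Complex (cos t) (sin t).

End linear_algebra.

Definition circ_dom {R : realType} : set R := `[0%R, (2 * pi)%R[.

Section probability_defs.
Context {R : realType} {d : measure_display} {T : measurableType d}.
Variable P : probability T R.
Local Notation C := R[i].

Definition gen_sigma (F : set (T -> R)) : set (set T) :=
  <<s [set E | exists f, F f /\ exists B : set R, measurable B /\ E = f @^-1` B] >>.

Definition sigmaC (X : T -> C) : set (set T) :=
  gen_sigma [set f | f = (fun w => complex.Re (X w)) \/ f = (fun w => complex.Im (X w))].

Definition sigmaM {p k : nat} (X : T -> 'M[C]_(p, k)) : set (set T) :=
  gen_sigma [set f | exists (i : 'I_p) (j : 'I_k),
    f = (fun w => complex.Re (X w i j)) \/ f = (fun w => complex.Im (X w i j))].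

Definition sigmaS {n : nat} (S : {set 'I_n}) (sg : T -> 'I_n -> C) : set (set T) :=
  gen_sigma [set f | exists i, i \in S /\
    (f = (fun w => complex.Re (sg w i)) \/ f = (fun w => complex.Im (sg w i)))].

Definition random_matrix {p k : nat} (X : T -> 'M[C]_(p, k)) : Prop :=
  forall i j, measurable_fun setT (fun w => complex.Re (X w i j)) /\
              measurable_fun setT (fun w => complex.Im (X w i j)).

Definition mutually_independent {I : finType} (D : {set I})
  (G : I -> set (set T)) : Prop :=
  forall E : I -> set T, (forall i, i \in D -> G i (E i)) ->
    P (\bigcap_(i in [set i | i \in D]) E i) = (\prod_(i in D) P (E i))%E.

Definition independent2 (G1 G2 : set (set T)) : Prop :=
  forall E1 E2, G1 E1 -> G2 E2 -> P (E1 `&` E2) = (P E1 * P E2)%E.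

Definition rademacher_seq {n : nat} (S : {set 'I_n}) (sg : T -> 'I_n -> C) : Prop :=
  (forall i, i \in S ->
     measurable_fun setT (fun w => complex.Re (sg w i)) /\
     measurable_fun setT (fun w => complex.Im (sg w i)) /\
     P [set w | sg w i = 1] = (2^-1)%:E /\
     P [set w | sg w i = -1] = (2^-1)%:E) /\
  mutually_independent S (fun i => sigmaC (fun w => sg w i)).

(* (sg_i)_{i in S} is a Steinhaus sequence: independent, uniform on the unit
   circle (the law of sg_i is the image of normalized Lebesgue measure on
   [0, 2 pi) under t |-> e^{i t}) *)
Definition steinhaus_seq {n : nat} (S : {set 'I_n}) (sg : T -> 'I_n -> C) : Prop :=
  (forall i, i \in S ->
     measurable_fun setT (fun w => complex.Re (sg w i)) /\
     measurable_fun setT (fun w => complex.Im (sg w i)) /\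
     forall B : set R, measurable B ->
       P [set w | exists t, (B `&` circ_dom) t /\ sg w i = cexpi t] =
       (lebesgue_measure (B `&` circ_dom) * ((2 * pi)^-1)%:E)%E) /\
  mutually_independent S (fun i => sigmaC (fun w => sg w i)).

End probability_defs.

(* Main.v *)
Require Import Defs.
From HB Require Import structures.
From mathcomp Require Import all_boot all_order all_algebra.
From mathcomp Require Import Rstruct Rstruct_topology.
From mathcomp Require Import all_classical all_reals all_analysis.
From mathcomp Require Import measurable_realfun.
From mathcomp Require Import complex spectral sesquilinear.
From mathcomp Require Import ring lra.
Import ComplexField.Normc.

Set Implicit Arguments.
Unset Strict Implicit.
Unset Printing Implicit Defensive.

Import Order.TTheory GRing.Theory Num.Theory.
Local Open Scope classical_set_scope.
Local Open Scope ring_scope.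

Local Notation "M ^H" := (adjmx M) (at level 8, format "M ^H") : ring_scope.
Local Notation "x %:C" := (real_complex _ x) (format "x %:C") : ring_scope.

(* Write [W = A^* A] and, for [i] outside [S], let [D'] be the coordinate
   projection onto [S] and [i].  [D' W D' - D'] is a centered sum of [m]
   independent terms whose squares are at most [(Lam + Gam) / m] times
   themselves.  A Khintchine-type recursion for its trace moments (resample one
   summand, and compare odd powers through the spectral mean value inequality),
   followed by Markov's inequality at a moment of order ln(3n/eps), gives
   [|| D' W D' - D' || <= delta] with [delta^2] of order [1 / ln(3n/eps)]; so [W]
   is well conditioned on [S], and [W e_i] restricted to [S] has norm at most
   [delta].  Given [A], the value of the dual certificate at [i] is a linear form
   in the random signs, with coefficients of norm at most [2 delta], and a
   conditional Chernoff bound makes it at most 1/2.  Such a certificate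
   implies the error estimate deterministically. *)

(** Why [delta^2] has order [1 / L], with [L = ln(3n/eps)]: a sign form whose coefficients have norm
    [2 delta] exceeds a fixed level with probability about [exp(- const / delta^2)], and this must
    beat a power of [eps / n]. Moments of order [k], comparable to [L], contract as soon as
    [k r / delta^2] is small, where [r = (Lam + Gam) / m]; since [k / delta^2] has order [L^2], this
    is the origin of the squared logarithm. The tail [exp(- 2 L)] pays for two factors [n]: the
    trace of the identity and the union over the columns outside [S]. Two obstacles shape the
    probabilistic part. The norm bounds hold only almost surely, so the summands are cut off to be
    bounded everywhere before any expectation is taken. And the certificate depends on one sample
    point both through [A] and through the signs; the two dependences are separated by reading the
    identity map as two random variables, one for each of two independent sub-sigma-algebras. The
    signs enter only through modulus at most 1, mean 0 and independence, so that both sign models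
    share one argument. *)

Section complex_scalars.
Variable R : realType.
Implicit Types (x y z : R[i]) (a b : R).

Lemma normc_ge0 z : 0 <= normc z.
Proof. by case: z => a b; exact: sqrtr_ge0. Qed.

Lemma normcD_le x y : normc (x + y) <= normc x + normc y.
Proof. exact: le_normcD. Qed.

Lemma normcN' x : normc (- x) = normc x.
Proof. exact: normcN. Qed.

Lemma normc_sqr z : normc z ^+ 2 = complex.Re z ^+ 2 + complex.Im z ^+ 2.
Proof. by case: z => a b /=; rewrite sqr_sqrtr // addr_ge0 ?sqr_ge0. Qed.

Lemma normc_conj z : normc (conjc z) = normc z.
Proof. by case: z => a b /=; rewrite sqrrN. Qed.

Lemma conjcM_normc z : conjc z * z = (normc z ^+ 2)%:C.
Proof.
rewrite normc_sqr; case: z => a b; apply/eqP; rewrite eq_complex /=.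
by apply/andP; split; apply/eqP; ring.
Qed.

Lemma Re_le_normc z : complex.Re z <= normc z.
Proof.
apply: le_trans (ler_norm _) _; rewrite -(@ler_pXn2r _ 2) ?nnegrE ?normc_ge0 //.
by rewrite real_normK ?num_real // normc_sqr lerDl sqr_ge0.
Qed.

Lemma normRe_le_normc z : `|complex.Re z| <= normc z.
Proof.
rewrite -(@ler_pXn2r _ 2) ?nnegrE ?normc_ge0 //.
by rewrite real_normK ?num_real // normc_sqr lerDl sqr_ge0.
Qed.

Lemma normIm_le_normc z : `|complex.Im z| <= normc z.
Proof.
rewrite -(@ler_pXn2r _ 2) ?nnegrE ?normc_ge0 //.
by rewrite real_normK ?num_real // normc_sqr lerDr sqr_ge0.
Qed.

Lemma normc_leD z : normc z <= `|complex.Re z| + `|complex.Im z|.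
Proof.
rewrite -(@ler_pXn2r _ 2) ?nnegrE ?normc_ge0 ?addr_ge0 //.
rewrite normc_sqr sqrrD !real_normK ?num_real //.
by rewrite -addrA lerD2l lerDr mulrn_wge0 // mulr_ge0.
Qed.

Lemma normc_real a : normc a%:C = `|a|.
Proof. by rewrite /= expr0n addr0 sqrtr_sqr. Qed.

Lemma cReD x y : complex.Re (x + y) = complex.Re x + complex.Re y.
Proof. by case: x => a b; case: y. Qed.
Lemma cImD x y : complex.Im (x + y) = complex.Im x + complex.Im y.
Proof. by case: x => a b; case: y. Qed.
Lemma cReN x : complex.Re (- x) = - complex.Re x. Proof. by case: x. Qed.
Lemma cImN x : complex.Im (- x) = - complex.Im x. Proof. by case: x. Qed.
Lemma cReM x y : complex.Re (x * y) =
  complex.Re x * complex.Re y - complex.Im x * complex.Im y.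
Proof. by case: x => a b; case: y. Qed.
Lemma cImM x y : complex.Im (x * y) =
  complex.Re x * complex.Im y + complex.Im x * complex.Re y.
Proof. by case: x => a b; case: y. Qed.

Lemma Re_sum (I : Type) (r : seq I) (Q : pred I) (F : I -> R[i]) :
  complex.Re (\sum_(i <- r | Q i) F i) = \sum_(i <- r | Q i) complex.Re (F i).
Proof. by apply: (big_morph (@complex.Re R) cReD). Qed.
Lemma normc_sum (I : Type) (r : seq I) (Q : pred I) (F : I -> R[i]) :
  normc (\sum_(i <- r | Q i) F i) <= \sum_(i <- r | Q i) normc (F i).
Proof.
elim/big_rec2: _ => [|i a z _ IH]; first by rewrite normc0.
by apply: le_trans (normcD_le _ _) _; rewrite lerD2l.
Qed.

End complex_scalars.

(** * Hermitian inner product, Euclidean norm and operator norm *)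

Section euclidean_norm.
Variable R : realType.
Local Notation C := R[i].

(** Lagrange's identity: twice the defect is the double sum of the squares
    [(f i * g j - f j * g i) ^+ 2]. *)
Lemma real_cauchy_schwarz (I : finType) (f g : I -> R) :
  (\sum_i f i * g i) ^+ 2 <= (\sum_i f i ^+ 2) * (\sum_i g i ^+ 2).
Proof.
have H : 0 <= \sum_i \sum_j (f i * g j - f j * g i) ^+ 2.
  by apply: sumr_ge0 => i _; apply: sumr_ge0 => j _; exact: sqr_ge0.
have E : \sum_i \sum_j (f i * g j - f j * g i) ^+ 2 =
   ((\sum_i f i ^+ 2) * (\sum_i g i ^+ 2)) *+ 2 - ((\sum_i f i * g i) ^+ 2) *+ 2.
  rewrite (_ : (\sum_i f i ^+ 2) * (\sum_i g i ^+ 2) *+ 2 =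
    \sum_i \sum_j (f i ^+ 2 * g j ^+ 2) + \sum_i \sum_j (f j ^+ 2 * g i ^+ 2)); last first.
    rewrite mulr2n big_distrlr /=; congr (_ + _).
    by rewrite exchange_big.
  rewrite expr2 big_distrlr /= -sumrMnl -big_split /= -sumrB.
  apply: eq_bigr => i _; rewrite -sumrMnl -big_split /= -sumrB.
  by apply: eq_bigr => j _; ring.
by move: H; rewrite E subr_ge0 lerMn2r.
Qed.

Definition dotc {k : nat} (u v : 'cV[C]_k) : C := (u^H *m v) 0 0.

Lemma adjmxE p k (M : 'M[C]_(p, k)) i j : M^H i j = conjc (M j i).
Proof. by rewrite !mxE. Qed.

Lemma dotcE k (u v : 'cV[C]_k) : dotc u v = \sum_i conjc (u i 0) * v i 0.
Proof. by rewrite /dotc mxE; apply: eq_bigr => i _; rewrite adjmxE. Qed.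

Lemma adjmxK p k (M : 'M[C]_(p, k)) : M^H^H = M.
Proof. by apply/matrixP => i j; rewrite !adjmxE conjcK. Qed.

Lemma adjmxM p q r (M : 'M[C]_(p, q)) (N : 'M[C]_(q, r)) :
  (M *m N)^H = N^H *m M^H.
Proof. by rewrite /adjmx map_mxM trmx_mul. Qed.

Lemma adjmxD p q (M N : 'M[C]_(p, q)) : (M + N)^H = M^H + N^H.
Proof. by rewrite /adjmx map_mxD linearD. Qed.

Lemma adjmxN p q (M : 'M[C]_(p, q)) : (- M)^H = - M^H.
Proof. by rewrite /adjmx map_mxN linearN. Qed.

Lemma adjmxB p q (M N : 'M[C]_(p, q)) : (M - N)^H = M^H - N^H.
Proof. by rewrite adjmxD adjmxN. Qed.

Lemma adjmx1 p : (1%:M : 'M[C]_p)^H = 1%:M.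
Proof. by rewrite /adjmx map_mx1 trmx1. Qed.

Lemma adjmxZ p q (c : C) (M : 'M[C]_(p, q)) : (c *: M)^H = conjc c *: M^H.
Proof. by rewrite /adjmx map_mxZ linearZ. Qed.

Lemma adjmxX n (M : 'M[C]_n) k : (M ^+ k)^H = M^H ^+ k.
Proof.
elim: k => [|k IH]; first by rewrite !expr0 adjmx1.
by rewrite exprS exprSr -IH; exact: adjmxM.
Qed.

Lemma adjmx_sum p q (I : Type) (r : seq I) (Q : pred I) (F : I -> 'M[C]_(p, q)) :
  (\sum_(i <- r | Q i) F i)^H = \sum_(i <- r | Q i) (F i)^H.
Proof.
apply: (big_morph (@adjmx R p q)); first exact: adjmxD.
by apply/matrixP => i j; rewrite adjmxE !mxE conjc0.
Qed.

Lemma dotcDl k (u v w : 'cV[C]_k) : dotc (u + v) w = dotc u w + dotc v w.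
Proof. by rewrite /dotc adjmxD mulmxDl mxE. Qed.
Lemma dotcDr k (u v w : 'cV[C]_k) : dotc u (v + w) = dotc u v + dotc u w.
Proof. by rewrite /dotc mulmxDr mxE. Qed.
Lemma dotcNr k (u v : 'cV[C]_k) : dotc u (- v) = - dotc u v.
Proof. by rewrite /dotc mulmxN mxE. Qed.
Lemma dotcC k (u v : 'cV[C]_k) : dotc u v = conjc (dotc v u).
Proof. by rewrite /dotc -adjmxE adjmxM adjmxK. Qed.
Lemma dotc_adj p q (M : 'M[C]_(p, q)) u v : dotc (M *m u) v = dotc u (M^H *m v).
Proof. by rewrite /dotc adjmxM mulmxA. Qed.

Lemma l2norm_ge0 k (v : 'cV[C]_k) : 0 <= l2norm v.
Proof. exact: sqrtr_ge0. Qed.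

Lemma sqr_l2norm k (v : 'cV[C]_k) : l2norm v ^+ 2 = \sum_i normc (v i 0) ^+ 2.
Proof. by rewrite sqr_sqrtr // sumr_ge0 // => i _; exact: sqr_ge0. Qed.

Lemma dotc_self k (v : 'cV[C]_k) : dotc v v = (l2norm v ^+ 2)%:C.
Proof.
rewrite dotcE sqr_l2norm raddf_sum /=; apply: eq_bigr => i _.
exact: conjcM_normc.
Qed.

Lemma Re_dotc_self k (v : 'cV[C]_k) : complex.Re (dotc v v) = l2norm v ^+ 2.
Proof. by rewrite dotc_self. Qed.

Lemma normc_dotc k (u v : 'cV[C]_k) : normc (dotc u v) <= l2norm u * l2norm v.
Proof.
rewrite dotcE; apply: le_trans (normc_sum _ _ _) _.
rewrite -(@ler_pXn2r _ 2) ?nnegrE ?mulr_ge0 ?l2norm_ge0 //; last first.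
  by apply: sumr_ge0 => i _; exact: normc_ge0.
rewrite exprMn !sqr_l2norm.
under eq_bigr do rewrite normcM normc_conj.
exact: real_cauchy_schwarz.
Qed.

Lemma l2normD k (u v : 'cV[C]_k) : l2norm (u + v) <= l2norm u + l2norm v.
Proof.
rewrite -(@ler_pXn2r _ 2) ?nnegrE ?addr_ge0 ?l2norm_ge0 //.
rewrite -Re_dotc_self dotcDl !dotcDr !cReD !Re_dotc_self sqrrD.
have -> : complex.Re (dotc v u) = complex.Re (dotc u v).
  by rewrite dotcC; case: (dotc u v).
have := le_trans (Re_le_normc _) (normc_dotc u v).
by move: (complex.Re _) => a; lra.
Qed.

Lemma l2normN k (v : 'cV[C]_k) : l2norm (- v) = l2norm v.
Proof. by congr Num.sqrt; apply: eq_bigr => i _; rewrite mxE normcN'. Qed.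

Lemma l2normZ k (c : C) (v : 'cV[C]_k) : l2norm (c *: v) = normc c * l2norm v.
Proof.
apply/eqP; rewrite -(@eqrXn2 _ 2) ?mulr_ge0 ?l2norm_ge0 ?normc_ge0 //.
rewrite exprMn !sqr_l2norm mulr_sumr; apply/eqP; apply: eq_bigr => i _.
by rewrite mxE normcM exprMn.
Qed.

Lemma l2norm0 k : l2norm (0 : 'cV[C]_k) = 0.
Proof. by rewrite /l2norm big1 ?sqrtr0 // => i _; rewrite mxE normc0 expr0n. Qed.

Lemma normc_le_l2norm k (v : 'cV[C]_k) i : normc (v i 0) <= l2norm v.
Proof.
rewrite -(@ler_pXn2r _ 2) ?nnegrE ?normc_ge0 ?l2norm_ge0 //.
rewrite sqr_l2norm (bigD1 i) //= lerDl sumr_ge0 // => j _; exact: sqr_ge0.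
Qed.

Lemma l2norm_eq0 k (v : 'cV[C]_k) : l2norm v = 0 -> v = 0.
Proof.
move=> v0; apply/colP => i; rewrite mxE; apply: eq0_normc.
by apply/eqP; rewrite eq_le normc_ge0 andbT -v0 normc_le_l2norm.
Qed.

Lemma l2norm_sum k (I : Type) (r : seq I) (Q : pred I) (F : I -> 'cV[C]_k) :
  l2norm (\sum_(i <- r | Q i) F i) <= \sum_(i <- r | Q i) l2norm (F i).
Proof.
elim/big_rec2: _ => [|i a z _ IH]; first by rewrite l2norm0.
by apply: le_trans (l2normD _ _) _; rewrite lerD2l.
Qed.

(** A crude bound whose purpose is to show that the set in [opnorm22] is bounded above, so that its
    [sup] is an upper bound. *)
Lemma l2norm_mulmx_bound p k (M : 'M[C]_(p, k)) (v : 'cV[C]_k) :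
  l2norm (M *m v) <= (\sum_j l2norm (col j M)) * l2norm v.
Proof.
have -> : M *m v = \sum_j v j 0 *: col j M.
  apply/colP => i; rewrite mxE summxE; apply: eq_bigr => j _.
  by rewrite !mxE mulrC.
apply: le_trans (l2norm_sum _ _ _) _; rewrite mulr_suml; apply: ler_sum => j _.
by rewrite l2normZ mulrC ler_wpM2l ?l2norm_ge0 ?normc_le_l2norm.
Qed.

Lemma l2norm_opnorm22 p k (M : 'M[C]_(p, k)) (v : 'cV[C]_k) :
  l2norm (M *m v) <= opnorm22 M * l2norm v.
Proof.
have [v0|v0] := eqVneq (l2norm v) 0.
  by rewrite (l2norm_eq0 v0) mulmx0 !l2norm0 mulr0.
have vp : 0 < l2norm v by rewrite lt_def v0 l2norm_ge0.
rewrite -ler_pdivrMr // mulrC.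
have -> : (l2norm v)^-1 * l2norm (M *m v) = l2norm (M *m ((l2norm v)^-1%:C *: v)).
  by rewrite -scalemxAr l2normZ normc_real ger0_norm // invr_ge0 ltW.
apply: sup_upper_bound; last first.
  exists ((l2norm v)^-1%:C *: v) => //=; rewrite l2normZ normc_real.
  by rewrite ger0_norm ?invr_ge0 ?(ltW vp) // mulVf.
split; first by exists (l2norm (M *m 0)), 0 => //=; rewrite l2norm0 ler01.
exists (\sum_j l2norm (col j M)) => _ /= [w w1 <-].
apply: le_trans (l2norm_mulmx_bound _ _) _.
by rewrite ler_piMr // sumr_ge0 // => j _; exact: l2norm_ge0.
Qed.

End euclidean_norm.

(** * Trace inequalities for Hermitian matrices *)

Lemma mxtraceB (R : comNzRingType) n (x y : 'M[R]_n) : \tr (x - y) = \tr x - \tr y.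
Proof. exact: raddfB. Qed.

(** The signs appear as a factor [-1] (and [1] in [trace_mulDD]) so that both expansions fit the
    four-term shape of [Ec_comb4]. *)
Lemma trace_mulBB (R : comNzRingType) n (x y a b : 'M[R]_n) :
  \tr ((x - y) *m (a - b)) =
  \tr (x *m a) + -1 * \tr (x *m b) + -1 * \tr (y *m a) + \tr (y *m b).
Proof.
rewrite mulmxBl !mulmxBr !mxtraceB.
by rewrite !mulN1r opprB addrA addrAC.
Qed.

Lemma trace_mulDD (R : comNzRingType) n (x y a b : 'M[R]_n) :
  \tr ((x + y) *m (a + b)) =
  \tr (x *m a) + 1 * \tr (x *m b) + 1 * \tr (y *m a) + \tr (y *m b).
Proof. by rewrite mulmxDl !mulmxDr !linearD /= !mul1r addrA. Qed.

Lemma trace_sqrB_mul (R : comNzRingType) n (x y c : 'M[R]_n) :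
  \tr ((x - y) *m (x - y) *m c) = \tr (x *m x *m c) - \tr (x *m y *m c) -
    (\tr (y *m x *m c) - \tr (y *m y *m c)).
Proof. by rewrite mulmxBl !mulmxBr !mulmxBl !mxtraceB. Qed.

Section spectral.
Variable R : realType.
Local Notation C := R[i].
Variable n : nat.
Implicit Types (A B U : 'M[C]_n).

Lemma hermitian_spectral A : A^H = A ->
  exists (U : 'M[C]_n) (a : 'I_n -> R),
    [/\ U *m U^H = 1%:M, U^H *m U = 1%:M &
        forall k, A ^+ k = U^H *m diag_mx (\row_i (a i ^+ k)%:C) *m U].
Proof.
move=> hA.
have adjE p q (M : 'M[C]_(p, q)) : map_mx Num.conj M^T = M^H.
  by apply/matrixP => i j; rewrite adjmxE !mxE.
have hermA : A \is hermsymmx.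
  apply/is_hermitianmxP; rewrite expr0 scale1r; apply: esym.
  by rewrite -[RHS]hA -adjE.
have /hermitian_normalmx /orthomx_spectralP A_eq := hermA.
have Dreal := hermitian_spectral_diag_real hermA.
have /unitarymxP Un := spectral_unitarymx A.
set U := spectralmx A in A_eq Un *.
have UU : U *m U^H = 1%:M by rewrite -adjE.
have UU' : U^H *m U = 1%:M by exact: mulmx1C.
move: (spectral_diag A) A_eq Dreal => D A_eq Dreal.
exists U, (fun i => complex.Re (D 0 i)); split; [exact: UU|exact: UU'|].
have invU : invmx U = U^H by rewrite invmx_unitary ?adjE ?spectral_unitarymx.
rewrite invU in A_eq.
elim=> [|k IH].
  rewrite expr0 (_ : diag_mx _ = 1%:M) ?mulmx1 ?UU' //.
  by rewrite -diag_const_mx; congr diag_mx; apply/rowP => i; rewrite !mxE expr0.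
have -> : A ^+ k.+1 = A ^+ k *m A by exact: exprSr.
rewrite IH [X in _ *m X]A_eq -!mulmxA [U *m (_ *m _)]mulmxA UU mul1mx.
rewrite [diag_mx _ *m (_ *m _)]mulmxA mulmx_diag.
congr (_ *m (diag_mx _ *m _)); apply/rowP => i; rewrite !mxE exprSr rmorphM /=.
congr (_ * _); apply/esym/RRe_real.
by move/mxOverP : Dreal; exact.
Qed.

(** The weights are the squared overlaps of the two eigenbases. They do not depend on [p] and [q],
    so a polynomial inequality in two real variables lifts, under the trace, to two Hermitian
    matrices that need not commute. *)
Lemma trace_pow_hermitian A B : A^H = A -> B^H = B ->
  exists (a b : 'I_n -> R) (w : 'I_n -> 'I_n -> R),
    (forall i j, 0 <= w i j) /\
    forall p q, \tr (A ^+ p *m B ^+ q) =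
                (\sum_i \sum_j w i j * (a i ^+ p * b j ^+ q))%:C.
Proof.
move=> /hermitian_spectral [U [a [_ _ Ak]]] /hermitian_spectral [V [b [_ _ Bk]]].
exists a, b, (fun i j => normc ((U *m V^H) i j) ^+ 2); split => [i j|p q].
  exact: sqr_ge0.
rewrite Ak Bk -!mulmxA mxtrace_mulC.
set Q := U *m V^H; pose D (c : 'I_n -> R) r := diag_mx (\row_i (c i ^+ r)%:C) : 'M[C]_n.
have -> : D a p *m (U *m (V^H *m (D b q *m V))) *m U^H = (D a p *m Q) *m (D b q *m Q^H).
  by rewrite /Q adjmxM adjmxK !mulmxA.
move: Q => Q; rewrite /mxtrace rmorph_sum /=; apply: eq_bigr => i _.
rewrite mxE rmorph_sum /=; apply: eq_bigr => j _.
rewrite !mul_diag_mx ![(_ * _)%:C]rmorphM /= -conjcM_normc !mxE.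
by ring.
Qed.

(* The mean value inequality for [x ^+ (2k+1)], in the double-operator-sum form
   provided by [trace_pow_hermitian]. *)
Lemma odd_pow_mean_value k (x y : R) :
  (x - y) * (x ^+ k.*2.+1 - y ^+ k.*2.+1) <=
  (k.*2.+1)%:R / 2 * ((x - y) ^+ 2 * (x ^+ k.*2 + y ^+ k.*2)).
Proof.
rewrite subrXX mulrA -expr2 mulrCA ler_wpM2l ?sqr_ge0 //.
(* In the geometric sum each term is paired with its mirror image; for [s, t >= 0] the pair is
   bounded because [s^(2k-i) - t^(2k-i)] and [s^i - t^i] have the same sign. *)
have key (i : nat) : (i <= k.*2)%N ->
    x ^+ (k.*2 - i) * y ^+ i + x ^+ i * y ^+ (k.*2 - i) <= x ^+ k.*2 + y ^+ k.*2.
  move=> ik.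
  have xk : x ^+ k.*2 = `|x| ^+ k.*2 by rewrite -normrX ger0_norm // exprn_even_ge0 ?odd_double.
  have yk : y ^+ k.*2 = `|y| ^+ k.*2 by rewrite -normrX ger0_norm // exprn_even_ge0 ?odd_double.
  rewrite xk yk.
  apply: (@le_trans _ _ (`|x| ^+ (k.*2 - i) * `|y| ^+ i + `|x| ^+ i * `|y| ^+ (k.*2 - i))).
    by apply: lerD; apply: le_trans (ler_norm _) _; rewrite normrM !normrX.
  move: `|x| `|y| (normr_ge0 x) (normr_ge0 y) => s t s0 t0.
  rewrite -(subnK ik) exprD [t ^+ (_ + _)]exprD addnK.
  rewrite -subr_ge0.
  have -> : s ^+ (k.*2 - i) * s ^+ i + t ^+ (k.*2 - i) * t ^+ i -
     (s ^+ (k.*2 - i) * t ^+ i + s ^+ i * t ^+ (k.*2 - i)) =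
     (s ^+ (k.*2 - i) - t ^+ (k.*2 - i)) * (s ^+ i - t ^+ i) by ring.
  have [st|ts] := leP s t.
    by apply: mulr_le0; rewrite subr_le0; apply: lerXn2r.
  by apply: mulr_ge0; rewrite subr_ge0; apply: lerXn2r; rewrite // ?nnegrE // ltW.
have E : \sum_(i < k.*2.+1) x ^+ (k.*2.+1.-1 - i) * y ^+ i =
   \sum_(i < k.*2.+1) x ^+ i * y ^+ (k.*2.+1.-1 - i).
  rewrite (reindex_inj rev_ord_inj) /=; apply: eq_bigr => i _.
  by rewrite subSS subKn // -ltnS.
have : \sum_(i < k.*2.+1) (x ^+ (k.*2.+1.-1 - i) * y ^+ i + x ^+ i * y ^+ (k.*2.+1.-1 - i)) <=
  \sum_(i < k.*2.+1) (x ^+ k.*2 + y ^+ k.*2).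
  by apply: ler_sum => i _; apply: key; rewrite -ltnS.
rewrite big_split /= -E sumr_const card_ord -[X in _ <= X]mulr_natl => H.
rewrite (_ : \sum_(i < _) _ = \sum_(i < k.*2.+1) x ^+ (k.*2.+1.-1 - i) * y ^+ i); last first.
  by apply: eq_bigr => i _.
rewrite mulrAC ler_pdivlMr //; apply: le_trans H.
by rewrite mulr_natr mulr2n.
Qed.

(** Powers are abstracted into families obeying the exponent law, so that they stay opaque and the
    expansion is mere bookkeeping of the exponents in the mixed traces [F p q]. *)
Lemma trace_odd_expand (pA pB : nat -> 'M[C]_n) (F : nat -> nat -> R) k :
  (forall p q, pA p *m pA q = pA (p + q)%N) ->
  (forall p q, pB p *m pB q = pB (p + q)%N) ->
  (forall p, \tr (pA p) = (F p 0)%:C) -> (forall p, \tr (pB p) = (F 0 p)%:C) ->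
  (forall p q, \tr (pA p *m pB q) = (F p q)%:C) ->
  \tr ((pA 1 - pB 1) *m (pA k.+1 - pB k.+1)) =
   (F k.+2 0 - F 1 k.+1 - F k.+1 1 + F 0 k.+2)%:C.
Proof.
move=> AA BB FA FB FAB.
have FBA p q : \tr (pB q *m pA p) = (F p q)%:C by rewrite mxtrace_mulC.
rewrite mulmxBl !mulmxBr AA BB !mxtraceB FAB FBA FA FB !add1n.
apply/eqP; rewrite eq_complex /=; apply/andP; split; apply/eqP; ring.
Qed.

Lemma trace_even_expand (pA pB : nat -> 'M[C]_n) (F : nat -> nat -> R) k :
  (forall p q, pA p *m pA q = pA (p + q)%N) ->
  (forall p q, pB p *m pB q = pB (p + q)%N) ->
  (forall p, \tr (pA p) = (F p 0)%:C) -> (forall p, \tr (pB p) = (F 0 p)%:C) ->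
  (forall p q, \tr (pA p *m pB q) = (F p q)%:C) ->
  \tr ((pA 1 - pB 1) *m (pA 1 - pB 1) *m (pA k + pB k)) =
   (F k.+2 0 - F k.+1 1 *+ 2 + F k 2 + (F 2 k - F 1 k.+1 *+ 2 + F 0 k.+2))%:C.
Proof.
move=> AA BB FA FB FAB.
have FBA p q : \tr (pB q *m pA p) = (F p q)%:C by rewrite mxtrace_mulC.
have h1 : \tr (pA 1 *m pA 1 *m pA k) = (F k.+2 0)%:C by rewrite !AA FA.
have h2 : \tr (pA 1 *m pB 1 *m pA k) = (F k.+1 1)%:C.
  by rewrite mxtrace_mulC mulmxA AA FAB addn1.
have h3 : \tr (pB 1 *m pA 1 *m pA k) = (F k.+1 1)%:C.
  by rewrite -mulmxA AA FBA add1n.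
have h4 : \tr (pB 1 *m pB 1 *m pA k) = (F k 2)%:C by rewrite BB FBA.
have g1 : \tr (pA 1 *m pA 1 *m pB k) = (F 2 k)%:C by rewrite AA FAB.
have g2 : \tr (pA 1 *m pB 1 *m pB k) = (F 1 k.+1)%:C.
  by rewrite -mulmxA BB FAB add1n.
have g3 : \tr (pB 1 *m pA 1 *m pB k) = (F 1 k.+1)%:C.
  by rewrite mxtrace_mulC mulmxA BB FBA addn1.
have g4 : \tr (pB 1 *m pB 1 *m pB k) = (F 0 k.+2)%:C by rewrite !BB FB.
rewrite mulmxDr mxtraceD !trace_sqrB_mul.
rewrite h1 h2 h3 h4 g1 g2 g3 g4.
apply/eqP; rewrite eq_complex /=; apply/andP; split; apply/eqP; ring.
Qed.

(** By cyclicity every term of both expansions is the trace of some [A^p B^q], hence a sum with the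
    same nonnegative weights; the scalar inequality then applies term by term. *)
Lemma trace_mean_value k A B : A^H = A -> B^H = B ->
  complex.Re (\tr ((A - B) *m (A ^+ k.*2.+1 - B ^+ k.*2.+1))) <=
  (k.*2.+1)%:R / 2 *
    complex.Re (\tr ((A - B) *m (A - B) *m (A ^+ k.*2 + B ^+ k.*2))).
Proof.
move=> hA hB; have [a [b [w [w0 W]]]] := trace_pow_hermitian hA hB.
pose F (p q : nat) : R := \sum_i \sum_j w i j * (a i ^+ p * b j ^+ q).
have XD M p q : (M : 'M[C]_n) ^+ p *m M ^+ q = M ^+ (p + q) by rewrite exprD.
have FA p : \tr (A ^+ p) = (F p 0)%:C by rewrite -W expr0 mulmx1.
have FB p : \tr (B ^+ p) = (F 0 p)%:C by rewrite -W expr0 mul1mx.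
have := trace_odd_expand k.*2 (XD A) (XD B) FA FB W.
have := trace_even_expand k.*2 (XD A) (XD B) FA FB W.
rewrite !expr1 => -> ->.
rewrite /= /F -!sumrMnl -!(sumrB, big_split) /= mulr_sumr; apply: ler_sum => i _.
rewrite -!sumrMnl -!(sumrB, big_split) /= mulr_sumr; apply: ler_sum => j _.
have := odd_pow_mean_value k (a i) (b j).
move=> /(ler_wpM2l (w0 i j)) H; apply: le_trans (le_trans _ H) _; rewrite le_eqVlt; apply/orP; left; apply/eqP.
  by rewrite !exprS !expr0; ring.
by rewrite !exprS !expr0; ring.
Qed.

(** The trace is a sum of even powers of real eigenvalues, so it dominates each of them; the
    exponent is kept positive so that the root can be taken. *)
Lemma trace_even_pow_opnorm A k (delta : R) : A^H = A -> 0 <= delta ->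
  complex.Re (\tr (A ^+ k.*2.+2)) <= delta ^+ k.*2.+2 ->
  forall v : 'cV[C]_n, l2norm (A *m v) <= delta * l2norm v.
Proof.
move=> hA d0; have [U [a [UU UU' Ak]]] := hermitian_spectral hA.
rewrite Ak mxtrace_mulC mulmxA UU mul1mx mxtrace_diag => H v.
have ad i : `|a i| <= delta.
  rewrite -(@ler_pXn2r _ k.*2.+2) ?nnegrE //; apply: le_trans H.
  rewrite Re_sum (bigD1 i) //= mxE /= -normrX ger0_norm ?exprn_even_ge0 //=; last first.
    by rewrite odd_double.
  rewrite lerDl sumr_ge0 // => j _; rewrite mxE /= exprn_even_ge0 //=.
  by rewrite odd_double.
have iso (u : 'cV[C]_n) (V : 'M[C]_n) : V^H *m V = 1%:M -> l2norm (V *m u) = l2norm u.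
  move=> VV; apply/eqP; rewrite -(@eqrXn2 _ 2) ?l2norm_ge0 //.
  by rewrite -!Re_dotc_self dotc_adj mulmxA VV mul1mx.
rewrite -[A]expr1 Ak -!mulmxA iso ?adjmxK // -(iso v U) //.
move: (U *m v) => u.
rewrite -(@ler_pXn2r _ 2) ?nnegrE ?mulr_ge0 ?l2norm_ge0 // exprMn !sqr_l2norm mulr_sumr.
apply: ler_sum => i _; rewrite mul_diag_mx !mxE expr1 normcM normc_real exprMn.
by rewrite ler_wpM2r ?sqr_ge0 // lerXn2r // nnegrE.
Qed.

End spectral.

(** * Positive semidefinite matrices and the effect of resampling one summand *)

Section positive_semidefinite.
Variable R : realType.
Local Notation C := R[i].
Variable n : nat.
Implicit Types (M N X Z : 'M[C]_n).

Lemma dotcZr k (c : C) (u v : 'cV[C]_k) : dotc u (c *: v) = c * dotc u v.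
Proof. by rewrite /dotc -scalemxAr mxE. Qed.

Lemma dotc_delta k (i : 'I_k) (v : 'cV[C]_k) : dotc (delta_mx i 0) v = v i 0.
Proof.
rewrite dotcE (bigD1 i) //= big1 ?addr0 => [|j ji]; last first.
  by rewrite mxE (negPf ji) conjc0 mul0r.
by rewrite mxE !eqxx conjc1 mul1r.
Qed.

Definition psdmx M := forall v : 'cV[C]_n, 0 <= complex.Re (dotc v (M *m v)).

Lemma psdmxD M N : psdmx M -> psdmx N -> psdmx (M + N).
Proof. by move=> hM hN v; rewrite mulmxDl dotcDr cReD addr_ge0. Qed.

Lemma psdmx_gram p (G : 'M[C]_(p, n)) : psdmx (G^H *m G).
Proof. by move=> v; rewrite -mulmxA -dotc_adj Re_dotc_self sqr_ge0. Qed.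

(** By cyclicity the trace is the sum, over the columns of [Z], of the quadratic form of [M]. *)
Lemma trace_psdmx M Z : psdmx M -> Z^H = Z ->
  0 <= complex.Re (\tr (M *m (Z *m Z))).
Proof.
move=> hM hZ; rewrite mulmxA mxtrace_mulC mulmxA /mxtrace Re_sum.
apply: sumr_ge0 => j _.
have -> : (Z *m M *m Z) j j = dotc (col j Z) (M *m col j Z).
  by rewrite !colE dotc_adj hZ dotc_delta !mulmxA -colE [RHS]mxE.
exact: hM.
Qed.

Lemma trace_psdmx_even_pow M Z k : psdmx M -> Z^H = Z ->
  0 <= complex.Re (\tr (M *m Z ^+ k.*2)).
Proof.
move=> hM hZ; rewrite -addnn exprD; apply: trace_psdmx => //.
by rewrite adjmxX hZ.
Qed.

Lemma trace_even_pow_ge0 Z k : Z^H = Z -> 0 <= complex.Re (\tr (Z ^+ k.*2)).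
Proof.
move=> hZ; have psd1 : psdmx 1%:M by move=> v; rewrite mul1mx Re_dotc_self sqr_ge0.
by have := trace_psdmx_even_pow k psd1 hZ; rewrite mul1mx.
Qed.

(** The mean value inequality produces [(X - X')^2], and [2 r (X + X')] dominates it: the
    self-bounding property of the summands trades a quadratic quantity for a linear one. *)
Lemma trace_pair_bound N X X' k (r : R) : N^H = N -> X^H = X -> X'^H = X' ->
  psdmx (r%:C *: X - X *m X) -> psdmx (r%:C *: X' - X' *m X') ->
  complex.Re (\tr ((X - X') *m ((N + X) ^+ k.*2.+1 - (N + X') ^+ k.*2.+1))) <=
  (k.*2.+1)%:R * r *
    complex.Re (\tr ((X + X') *m ((N + X) ^+ k.*2 + (N + X') ^+ k.*2))).
Proof.
move=> hN hX hX' pX pX'.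
have hA : (N + X)^H = N + X by rewrite adjmxD hN hX.
have hB : (N + X')^H = N + X' by rewrite adjmxD hN hX'.
have := trace_mean_value k hA hB.
have -> : N + X - (N + X') = X - X' by rewrite opprD addrACA subrr add0r.
move/le_trans; apply; rewrite -!mulrA ler_wpM2l ?ler0n //.
rewrite mulrC ler_pdivrMr // mulrC mulrA.
(* [2 r (X + X') - (X - X')^2] is twice the sum of the two self-bounding defects plus
   [(X + X')^2]. *)
pose Q := (r%:C *: X - X *m X) + (r%:C *: X - X *m X) +
          ((r%:C *: X' - X' *m X') + (r%:C *: X' - X' *m X')) + (X + X')^H *m (X + X').
have pQ : psdmx Q by exact: (psdmxD (psdmxD (psdmxD pX pX) (psdmxD pX' pX')) (psdmx_gram _)).
have EQ : Q = (2 * r)%:C *: (X + X') - (X - X') *m (X - X').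
  rewrite /Q adjmxD hX hX' !mulmxBl !mulmxDl !mulmxBr !mulmxDr scalerDr.
  rewrite (_ : (2 * r)%:C = r%:C + r%:C); last by rewrite -rmorphD -mulr2n mulr_natl.
  rewrite !scalerDl.
  move: (r%:C *: X) (r%:C *: X') (X *m X) (X *m X') (X' *m X) (X' *m X') => a b c d e f.
  apply/matrixP => i j; rewrite !mxE.
  move: (a i j) (b i j) (c i j) (d i j) (e i j) (f i j) => {}a {}b {}c {}d {}e {}f.
  apply/eqP; rewrite eq_complex; apply/andP; split; apply/eqP;
    rewrite ?(cReD, cReN, cImD, cImN); ring.
have := addr_ge0 (trace_psdmx_even_pow k pQ hA) (trace_psdmx_even_pow k pQ hB).
rewrite -cReD -linearD /= -mulmxDr EQ mulmxBl -scalemxAl linearB linearZ /= cReD cReN cReM /=.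
by rewrite mul0r subr0 subr_ge0.
Qed.

(** The quadratic form of [(G^H G)^2] at [v] is [|G^H (G v)|^2], and [G^H] inherits the norm bound
    of [G]: write [|G^H u|^2] as the inner product of [u] with [G (G^H u)] and divide by
    [|G^H u|]. *)
Lemma gram_sqr_le p (G : 'M[C]_(p, n)) (r : R) : 0 <= r ->
  (forall v, l2norm (G *m v) ^+ 2 <= r * l2norm v ^+ 2) ->
  psdmx (r%:C *: (G^H *m G) - (G^H *m G) *m (G^H *m G)).
Proof.
move=> r0 hG v.
have hG' (u : 'cV[C]_n) : l2norm (G *m u) <= Num.sqrt r * l2norm u.
  rewrite -(@ler_pXn2r _ 2) ?nnegrE ?mulr_ge0 ?sqrtr_ge0 ?l2norm_ge0 //.
  by rewrite exprMn (sqr_sqrtr r0); exact: hG.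
have hGH (u : 'cV[C]_p) : l2norm (G^H *m u) <= Num.sqrt r * l2norm u.
  set x := l2norm (G^H *m u).
  have [->|x0] := eqVneq x 0; first by rewrite mulr_ge0 ?sqrtr_ge0 ?l2norm_ge0.
  have xp : 0 < x by rewrite lt_def x0 l2norm_ge0.
  rewrite -(ler_pM2l xp) -expr2 -Re_dotc_self dotc_adj adjmxK.
  apply: le_trans (Re_le_normc _) _; apply: le_trans (normc_dotc _ _) _.
  rewrite (_ : x * (_ * _) = l2norm u * (Num.sqrt r * x)); last by ring.
  by apply: ler_wpM2l; rewrite ?l2norm_ge0 // hG'.
rewrite mulmxBl dotcDr dotcNr cReD cReN -scalemxAl dotcZr -!mulmxA.
have E (u : 'cV[C]_n) : dotc v (G^H *m (G *m u)) = dotc (G *m v) (G *m u).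
  by rewrite dotc_adj.
have E' (u : 'cV[C]_p) : dotc u (G *m (G^H *m u)) = dotc (G^H *m u) (G^H *m u).
  by rewrite dotc_adj adjmxK.
rewrite !E E'.
rewrite cReM /= mul0r subr0 !Re_dotc_self subr_ge0.
rewrite -{1}(sqr_sqrtr r0) -exprMn; apply: lerXn2r; last exact: hGH.
  by rewrite nnegrE l2norm_ge0.
by rewrite nnegrE mulr_ge0 ?sqrtr_ge0 ?l2norm_ge0.
Qed.

End positive_semidefinite.

(** * Perturbations of the identity *)

Section near_identity.
Variable R : realType.
Local Notation C := R[i].
Variable n : nat.

Lemma unitmx_near1 (Y : 'M[C]_n) (delta : R) : delta < 1 ->
  (forall v : 'cV[C]_n, l2norm (Y *m v) <= delta * l2norm v) -> 1%:M + Y \in unitmx.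
Proof.
move=> d1 hY; rewrite unitmxE unitfE -det_tr; apply/det0P => -[v v0].
move=> /(congr1 trmx); rewrite trmx_mul trmxK trmx0 mulmxDl mul1mx => /eqP.
rewrite addr_eq0 => /eqP E.
have := hY v^T; rewrite -l2normN -E => H.
have : l2norm v^T = 0.
  apply/eqP; rewrite eq_le l2norm_ge0 andbT.
  have : (1 - delta) * l2norm v^T <= 0 by rewrite mulrBl mul1r subr_le0.
  by rewrite pmulr_rle0 // subr_gt0.
by move=> /l2norm_eq0 /(congr1 trmx); rewrite trmxK trmx0 => /eqP; rewrite (negPf v0).
Qed.

Lemma l2norm_near1 (Y : 'M[C]_n) (u : 'cV[C]_n) :
  (forall v : 'cV[C]_n, l2norm (Y *m v) <= 2^-1 * l2norm v) ->
  l2norm u <= 2 * l2norm ((1%:M + Y) *m u).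
Proof.
move=> hY; have := hY u.
have : l2norm u <= l2norm ((1%:M + Y) *m u) + l2norm (Y *m u).
  have {1}-> : u = (1%:M + Y) *m u + - (Y *m u) by rewrite mulmxDl mul1mx addrK.
  by rewrite -[l2norm (Y *m u)]l2normN l2normD.
lra.
Qed.

End near_identity.

(** * Recovery from an inexact dual certificate *)

Section recovery.
Variable R : realType.
Local Notation C := R[i].
Variable n : nat.
Implicit Types (S T : {set 'I_n}) (v w : 'cV[C]_n).

(** Coordinate projections stay square of size [n], so that compressions to different supports live
    in one matrix ring. *)
Definition maskmx S : 'M[C]_n := diag_mx (\row_i ((i \in S)%:R)).

Lemma maskmxE S p (M : 'M[C]_(n, p)) i j :
  (maskmx S *m M) i j = if i \in S then M i j else 0.
Proof. by rewrite mul_diag_mx !mxE; case: ifP => _; rewrite ?mul1r ?mul0r. Qed.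

Lemma mulmx_maskE S p (M : 'M[C]_(p, n)) i j :
  (M *m maskmx S) i j = if j \in S then M i j else 0.
Proof. by rewrite mul_mx_diag !mxE; case: ifP => _; rewrite ?mulr1 ?mulr0. Qed.

Lemma adjmx_mask S : (maskmx S)^H = maskmx S.
Proof.
apply/matrixP => i j; rewrite adjmxE !mxE eq_sym; case: eqP => [->|_].
  by rewrite !mulr1n conjc_nat.
by rewrite !mulr0n conjc0.
Qed.

Lemma maskmx_sub S T : S \subset T -> maskmx S *m maskmx T = maskmx S.
Proof.
move=> /fintype.subsetP ST; apply/matrixP => i j; rewrite mulmx_maskE.
case: ifP => // jT; rewrite !mxE; case: eqP => [->|_]; last by rewrite mulr0n.
by case: (boolP (j \in S)) => [/ST|_]; rewrite ?jT // mulr1n.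
Qed.

Lemma maskmx_subr S T : S \subset T -> maskmx T *m maskmx S = maskmx S.
Proof. by move=> ST; rewrite -(adjmx_mask T) -[in LHS](adjmx_mask S) -adjmxM maskmx_sub // adjmx_mask. Qed.

Lemma l2norm_mask S v : l2norm (maskmx S *m v) <= l2norm v.
Proof.
rewrite -(@ler_pXn2r _ 2) ?nnegrE ?l2norm_ge0 // !sqr_l2norm.
apply: ler_sum => i _; rewrite maskmxE; case: ifP => // _.
by rewrite normc0 expr0n sqr_ge0.
Qed.

(** An inequality only, because [csign 0 = 0] by the convention on division by zero. *)
Lemma normc_csign (z : C) : normc (csign z) <= 1.
Proof.
rewrite /csign normcM normcV normc_real ger0_norm ?normc_ge0 //.
have [->|z0] := eqVneq (normc z) 0; first by rewrite mul0r ler01.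
by rewrite divff.
Qed.

Lemma conjc_csign (z : C) : conjc (csign z) * z = (normc z)%:C.
Proof.
have [z0|z0] := eqVneq (normc z) 0.
  by rewrite (eq0_normc z0) mulr0 normc0.
have -> : csign z = ((normc z)^-1)%:C * z.
  by rewrite /csign mulrC (fmorphV (real_complex R)).
rewrite rmorphM [X in X * _ * _](_ : _ = ((normc z)^-1)%:C); last exact: conjc_real.
rewrite -mulrA conjcM_normc.
by rewrite -(rmorphM (real_complex R)) expr2 /= mulKf.
Qed.

Lemma l2norm_le_l1 v : l2norm v <= \sum_i normc (v i 0).
Proof.
have -> : v = \sum_i v i 0 *: delta_mx i 0.
  apply/colP => i; rewrite summxE (bigD1 i) //= big1 => [|j ji].
    by rewrite !mxE !eqxx mulr1 addr0.
  by rewrite !mxE eq_sym (negPf ji) mulr0.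
apply: le_trans (l2norm_sum _ _ _) _; apply: ler_sum => i _.
rewrite l2normZ summxE (bigD1 i) //= big1 => [|j ji]; last first.
  by rewrite !mxE eq_sym (negPf ji) mulr0.
rewrite !mxE !eqxx mulr1 addr0 ler_piMr ?normc_ge0 //.
by rewrite -(@ler_pXn2r _ 2) ?nnegrE ?l2norm_ge0 // -Re_dotc_self dotc_delta mxE !eqxx expr1n.
Qed.

(** [K] is the Gram matrix of the columns in [S] extended by the identity off [S], so it is inverted
    in size [n]. With [g = K^-1 sigma], the vector [W g = A^H (A g)] equals [sigma] on [S], and the
    hypothesis on [invmx K] bounds its entries off [S] by 1/2. The factor [sqrt s] of the error
    comes from the norm of [A g]. *)
Lemma recovery_from_certificate q (A : 'M[C]_(q, n)) S (x z : 'cV[C]_n)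
    (e : 'cV[C]_q) (eta : R) (W := A^H *m A) (D := maskmx S)
    (K := 1%:M + (D *m W *m D - D)) (sigma := \col_i csign (x i 0)) :
  (forall i, i \notin S -> x i 0 = 0) ->
  (forall v, l2norm ((D *m W *m D - D) *m v) <= 2^-1 * l2norm v) ->
  (forall i, i \notin S -> l2norm (col i (D *m W)) <= 2^-1) ->
  (forall i, i \notin S ->
     normc (dotc (invmx K *m col i (D *m W)) sigma) <= 2^-1) ->
  l2norm e <= eta -> qBP_minimizer A (A *m x + e) eta z ->
  l2norm (x - z) <= (8 + 16 * Num.sqrt (#|S|%:R)) * eta.
Proof.
move=> x0 hY hc hs he [zf zmin].
have eta0 : 0 <= eta by exact: le_trans (l2norm_ge0 _) he.
have hD : D^H = D by exact: adjmx_mask.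
have hW : W^H = W by rewrite /W adjmxM adjmxK.
have hAW (u : 'cV[C]_n) : A^H *m (A *m u) = W *m u by rewrite mulmxA.
have DD u : D *m (D *m u) = D *m u by rewrite mulmxA maskmx_sub.
have DE p (M : 'M[C]_(n, p)) i j : (D *m M) i j = if i \in S then M i j else 0.
  exact: maskmxE.
clearbody W D.
have hYt : (D *m W *m D - D)^H = D *m W *m D - D.
  by rewrite adjmxB !adjmxM hD hW mulmxA.
have Ku : K \in unitmx.
  by apply: unitmx_near1 hY; rewrite invf_lt1 // ltr1n.
have hKi : (invmx K)^H = invmx K.
  have KH : K^H = K by rewrite /K adjmxD adjmx1 hYt.
  have : (invmx K)^H *m K = 1%:M by rewrite -{2}KH -adjmxM mulmxV // adjmx1.
  by move/(congr1 (mulmx^~ (invmx K))); rewrite mulmxK // mul1mx.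
have KE u : K *m u = u + (D *m (W *m (D *m u)) - D *m u).
  by rewrite /K mulmxDl mul1mx mulmxBl !mulmxA.
have nK u : l2norm u <= 2 * l2norm (K *m u) by exact: l2norm_near1.
have YE u : (D *m W *m D - D) *m u = D *m (W *m (D *m u)) - D *m u.
  by rewrite mulmxBl !mulmxA.
have {}hY u : l2norm (D *m (W *m (D *m u)) - D *m u) <= 2^-1 * l2norm u.
  by rewrite -YE.
clear YE hYt; clearbody K.
have sigS : D *m sigma = sigma.
  apply/colP => i; rewrite DE; case: ifP => // /negbT /x0 xi.
  by rewrite mxE xi /csign mul0r.
pose g := invmx K *m sigma.
have Kg : K *m g = sigma by rewrite /g mulmxA mulmxV // mul1mx.
have gE : invmx K *m sigma = g by [].
clearbody g.
(* [K] acts as the identity off [S] and [sigma] is supported on [S]; hence so is [g]. *)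
have Dg : D *m g = g.
  have : D *m (K *m g) = D *m (W *m (D *m g)).
    by rewrite KE mulmxDr mulmxBr !DD addrC subrK.
  rewrite Kg sigS => sE.
  move: Kg; rewrite KE -sE => /eqP.
  by rewrite addrCA -subr_eq0 addrAC subrr add0r subr_eq0 => /eqP.
have DWg : D *m (W *m g) = sigma.
  by rewrite -Kg KE Dg addrC subrK.
have subE (a b : 'cV[C]_n) i : (a - b) i 0 = a i 0 - b i 0 by rewrite !mxE.
set s := Num.sqrt _.
have s0 : 0 <= s by exact: sqrtr_ge0.
have nsig : l2norm sigma <= s.
  rewrite -(@ler_pXn2r _ 2) ?nnegrE ?l2norm_ge0 // sqr_l2norm sqr_sqrtr ?ler0n //.
  rewrite -sumr_const [X in _ <= X]big_mkcond /=; apply: ler_sum => i _.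
  rewrite mxE; case: ifP => [_|/negbT /x0 ->].
    by rewrite expr_le1 ?normc_ge0 ?normc_csign.
  by rewrite /csign mul0r normc0 expr0n.
have ng : l2norm g <= 2 * s.
  by apply: le_trans (nK g) _; rewrite Kg ler_wpM2l.
(* [|A g|^2] is the inner product of [g] and [sigma], at most [2 s^2]; [3/2] is a rational upper
   bound for [sqrt 2]. *)
have nAg : l2norm (A *m g) <= 3 / 2 * s.
  rewrite -(@ler_pXn2r _ 2) ?nnegrE ?l2norm_ge0 ?mulr_ge0 //.
  rewrite -Re_dotc_self dotc_adj hAW -{1}Dg dotc_adj hD DWg.
  apply: le_trans (Re_le_normc _) _; apply: le_trans (normc_dotc _ _) _.
  apply: (@le_trans _ _ (2 * s * s)); first by apply: ler_pM; rewrite ?l2norm_ge0.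
  by clear -s0; nra.
pose v := z - x.
have xz : l2norm (x - z) = l2norm v by rewrite -l2normN opprB.
have nAv : l2norm (A *m v) <= 2 * eta.
  have -> : A *m v = e + - (A *m x + e - A *m z).
    rewrite mulmxBr; move: (A *m x) (A *m z) => a b.
    by rewrite opprB [a + e]addrC opprD addrCA [e + (_ + _)]addrA subrr add0r.
  apply: le_trans (l2normD _ _) _; rewrite l2normN mulr_natl mulr2n.
  exact: lerD.
pose nu := \sum_(i | i \notin S) normc (v i 0).
have nu0 : 0 <= nu by apply: sumr_ge0 => i _; exact: normc_ge0.
(* Compare [z] with the feasible point [x]: on [S] one has
   [|z_i| >= |x_i| + Re (conj sigma_i * v_i)], and off [S] the entries of [z] are those of [v]. *)
have nu1 : nu <= normc (dotc sigma v).
  have xf : qBP_feasible A (A *m x + e) eta x by rewrite /qBP_feasible addrAC subrr add0r.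
  have := zmin x xf; rewrite /l1norm (bigID (mem S)) /= [X in _ <= X](bigID (mem S)) /=.
  rewrite [X in _ <= _ + X]big1 ?addr0; last by move=> i /x0 ->; rewrite normc0.
  have -> : \sum_(i | i \notin S) normc (z i 0) = nu.
    by apply: eq_bigr => i iS; rewrite subE (x0 i iS) subr0.
  have : \sum_(i in S) (normc (x i 0) + complex.Re (conjc (sigma i 0) * v i 0)) <=
         \sum_(i in S) normc (z i 0).
    apply: ler_sum => i _.
    have -> : normc (x i 0) = complex.Re (conjc (sigma i 0) * x i 0).
      by rewrite mxE conjc_csign.
    rewrite -cReD -mulrDr (_ : x i 0 + v i 0 = z i 0); last by rewrite subE addrC subrK.
    apply: le_trans (Re_le_normc _) _; rewrite normcM normc_conj.
    by rewrite ler_piMl ?normc_ge0 // mxE normc_csign.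
  rewrite big_split /= -Re_sum.
  have -> : \sum_(i in S) conjc (sigma i 0) * v i 0 = dotc sigma v.
    rewrite dotcE [RHS](bigID (mem S)) /= [X in _ = _ + X]big1 ?addr0 // => i /x0 xi.
    by rewrite mxE xi /csign mul0r conjc0 mul0r.
  have := Re_le_normc (- dotc sigma v); rewrite normcN' cReN.
  by clear; lra.
(* The pairing of [sigma] with [v] is that of [A g] with [A v], at most [3 s eta], minus an
   off-support part of at most [nu / 2], which is absorbed on the left. *)
have nu2 : nu <= 6 * s * eta.
  have E : dotc sigma v = dotc (W *m g) v - \sum_(i | i \notin S) conjc ((W *m g) i 0) * v i 0.
    rewrite !dotcE [X in _ = X - _](bigID (mem S)) /= addrK [LHS](bigID (mem S)) /=.
    rewrite [X in _ + X]big1 ?addr0; last first.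
      by move=> i /x0 xi; rewrite mxE xi /csign mul0r conjc0 mul0r.
    by apply: eq_bigr => i iS; rewrite -DWg DE iS.
  have B1 : normc (dotc (W *m g) v) <= 3 / 2 * s * (2 * eta).
    rewrite -hAW dotc_adj adjmxK; apply: le_trans (normc_dotc _ _) _.
    by apply: ler_pM; rewrite ?l2norm_ge0.
  have B2 : normc (\sum_(i | i \notin S) conjc ((W *m g) i 0) * v i 0) <= 2^-1 * nu.
    apply: le_trans (normc_sum _ _ _) _; rewrite mulr_sumr; apply: ler_sum => i iS.
    rewrite normcM normc_conj; apply: ler_wpM2r; first exact: normc_ge0.
    have -> : (W *m g) i 0 = dotc (invmx K *m col i (D *m W)) sigma.
      by rewrite dotc_adj hKi gE colE dotc_adj dotc_delta adjmxM hD hW -mulmxA Dg.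
    exact: hs.
  move: nu1; rewrite E => nu1.
  have := le_trans nu1 (normcD_le _ _); rewrite normcN'.
  by clear -B1 B2; lra.
have vDv : l2norm (v - D *m v) <= nu.
  apply: le_trans (l2norm_le_l1 _) _; rewrite (bigID (mem S)) /= big1 ?add0r.
    by apply: ler_sum => i iS; rewrite subE DE (negPf iS) subr0.
  by move=> i iS; rewrite subE DE iS subrr normc0.
(* Duality: for [q = D A^H A v], [|q|^2] is the inner product of [A q] and [A v], while
   [|A q|^2 <= 3/2 |q|^2] since [q] is supported on [S]; [5/4] bounds [sqrt (3/2)]. *)
have nq : l2norm (D *m (A^H *m (A *m v))) <= 5 / 2 * eta.
  set b := A *m v in nAv *; set qv := D *m _.
  have Dq : D *m qv = qv by rewrite /qv DD.
  have H1 : l2norm qv ^+ 2 <= l2norm (A *m qv) * l2norm b.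
    rewrite -Re_dotc_self (_ : dotc qv qv = dotc (A *m qv) b); last first.
      by rewrite {2}/qv -{1}hD -dotc_adj Dq dotc_adj.
    exact: le_trans (Re_le_normc _) (normc_dotc _ _).
  have H2 : l2norm (A *m qv) ^+ 2 <= 3 / 2 * l2norm qv ^+ 2.
    rewrite -Re_dotc_self dotc_adj hAW -{1}Dq dotc_adj hD.
    have -> : D *m (W *m qv) = qv + (D *m (W *m (D *m qv)) - D *m qv).
      by rewrite Dq addrC subrK.
    rewrite dotcDr cReD Re_dotc_self.
    have := le_trans (Re_le_normc _) (normc_dotc qv (D *m (W *m (D *m qv)) - D *m qv)).
    have := ler_wpM2l (l2norm_ge0 qv) (hY qv).
    move: (complex.Re _) (l2norm (D *m (W *m (D *m qv)) - D *m qv)) => a a'.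
    by clear; rewrite expr2; lra.
  have H3 : l2norm (A *m qv) <= 5 / 4 * l2norm qv.
    rewrite -(@ler_pXn2r _ 2) ?nnegrE ?l2norm_ge0 ?mulr_ge0 ?l2norm_ge0 //.
    apply: le_trans H2 _; rewrite exprMn; apply: ler_wpM2r; first exact: sqr_ge0.
    by clear; lra.
  have [->|q0] := eqVneq (l2norm qv) 0; first by rewrite mulr_ge0 // divr_ge0.
  have qp : 0 < l2norm qv by rewrite lt_def q0 l2norm_ge0.
  rewrite -(ler_pM2l qp) -expr2; apply: le_trans H1 _.
  apply: (@le_trans _ _ (5 / 4 * l2norm qv * (2 * eta))); last by clear; lra.
  by apply: ler_pM; rewrite ?l2norm_ge0.
clearbody v.
have nDW : l2norm (D *m W *m (v - D *m v)) <= 2^-1 * nu.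
  have -> : D *m W *m (v - D *m v) = \sum_(i | i \notin S) v i 0 *: col i (D *m W).
    apply/colP => j; rewrite mxE summxE (bigID (mem S)) /= big1 ?add0r.
      apply: eq_bigr => i iS; rewrite subE [(D *m v) _ _]DE (negPf iS) subr0.
      by rewrite [RHS]mxE [col _ _ _ _]mxE mulrC.
    by move=> i iS; rewrite subE [(D *m v) _ _]DE iS subrr mulr0.
  apply: le_trans (l2norm_sum _ _ _) _; rewrite mulr_sumr; apply: ler_sum => i iS.
  by rewrite l2normZ mulrC ler_wpM2r ?normc_ge0 ?hc.
(* Solve for the part on [S]: [K (D v) = D W v - D W (v - D v)], and [K^-1] costs a factor 2. *)
have nDv : l2norm (D *m v) <= 5 * eta + nu.
  have := nK (D *m v).
  have -> : K *m (D *m v) = D *m (A^H *m (A *m v)) + - (D *m W *m (v - D *m v)).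
    by rewrite KE !DD [LHS]addrC subrK hAW mulmxBr opprB -!mulmxA [RHS]addrC subrK.
  move=> H; have := le_trans H (ler_wpM2l _ (l2normD _ _)); rewrite l2normN.
  move/(_ (ler0n _ 2)); move: nq nDW.
  move: (l2norm (D *m (_ *m _))) (l2norm (D *m W *m _)) (l2norm (D *m v)); clear => *; lra.
rewrite xz (_ : v = D *m v + (v - D *m v)); last by rewrite addrC subrK.
apply: le_trans (l2normD _ _) _.
apply: (@le_trans _ _ (5 * eta + 6 * s * eta + 6 * s * eta)).
  by clear -nDv vDv nu2; lra.
by have := mulr_ge0 s0 eta0; clear -eta0; lra.
Qed.

End recovery.

(** * Gram matrices compressed to the support and one further index *)

Section masked_gram.
Variable R : realType.
Local Notation C := R[i].
Variable n : nat.

(** The masked product is [B_S v_S] plus [v_i] times column [i]. The two pieces have squared norms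
    at most [Lam |v_S|^2] and [Gam |v_i|^2], and Cauchy-Schwarz merges them with constant
    [Lam + Gam]. *)
Lemma masked_gram_bound p (B : 'M[C]_(p, n)) (S : {set 'I_n}) (i : 'I_n) (Lam Gam : R) :
  0 <= Lam -> 0 <= Gam -> i \notin S ->
  opnorm22 ((colS S B)^H *m colS S B) <= Lam -> l2norm (col i B) ^+ 2 <= Gam ->
  forall v : 'cV[C]_n,
    l2norm (B *m (maskmx R (i |: S) *m v)) ^+ 2 <= (Lam + Gam) * l2norm v ^+ 2.
Proof.
move=> L0 G0 iS hL hG v.
pose vS : 'cV[C]_#|S| := \col_j v (enum_val j) 0.
have E : B *m (maskmx R (i |: S) *m v) = colS S B *m vS + v i 0 *: col i B.
  apply/colP => j.
  have -> : (colS S B *m vS + v i 0 *: col i B) j 0 =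
      \sum_(k < #|S|) B j (enum_val k) * v (enum_val k) 0 + v i 0 * B j i.
    by rewrite !mxE; congr (_ + _); apply: eq_bigr => k _; rewrite !mxE.
  have -> : (B *m (maskmx R (i |: S) *m v)) j 0 =
      \sum_k B j k * (if k \in i |: S then v k 0 else 0).
    by rewrite mxE; apply: eq_bigr => k _; rewrite maskmxE.
  rewrite (bigD1 i) //= setU11 addrC [B j i * _]mulrC; congr (_ + _).
  rewrite (eq_bigr (fun k => if k \in S then B j k * v k 0 else 0)); last first.
    move=> k ki; rewrite !inE (negPf ki) /=; case: ifP => //; by rewrite mulr0.
  rewrite -big_mkcondr /= (eq_bigl (mem S)); last first.
    by move=> k /=; case: (eqVneq k i) => [->|]; rewrite ?(negPf iS).
  by rewrite (big_enum_val (fun k => B j k * v k 0)).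
have nS : l2norm (colS S B *m vS) ^+ 2 <= Lam * l2norm vS ^+ 2.
  rewrite -Re_dotc_self dotc_adj mulmxA.
  apply: le_trans (Re_le_normc _) _; apply: le_trans (normc_dotc _ _) _.
  rewrite expr2 mulrCA; apply: ler_wpM2l; first exact: l2norm_ge0.
  apply: le_trans (l2norm_opnorm22 _ _) _; apply: ler_wpM2r => //.
  exact: l2norm_ge0.
have nv : l2norm vS ^+ 2 + normc (v i 0) ^+ 2 <= l2norm v ^+ 2.
  rewrite !sqr_l2norm [X in _ <= X](bigD1 i) //= [X in X <= _]addrC lerD2l.
  under eq_bigr do rewrite mxE.
  rewrite -(big_enum_val (fun k => normc (v k 0) ^+ 2)) /=.
  rewrite [X in _ <= X](bigID (mem S)) /=.
  rewrite (eq_bigl (fun k => (k != i) && (k \in S))) ?lerDl ?sumr_ge0 //.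
    by move=> k _; exact: sqr_ge0.
  by move=> k; case: (eqVneq k i) => [->|]; rewrite ?(negPf iS).
rewrite E; have := l2normD (colS S B *m vS) (v i 0 *: col i B); rewrite l2normZ.
have : (normc (v i 0) * l2norm (col i B)) ^+ 2 <= Gam * normc (v i 0) ^+ 2.
  by rewrite exprMn mulrC ler_wpM2r ?sqr_ge0.
move: nS nv (l2norm_ge0 (colS S B *m vS)) (l2norm_ge0 (col i B)) (normc_ge0 (v i 0))
  (l2norm_ge0 (colS S B *m vS + v i 0 *: col i B)) (l2norm_ge0 vS).
move: (l2norm (_ + _)) (l2norm (colS S B *m vS)) (l2norm vS) (normc (v i 0)) (l2norm (col i B)) (l2norm v).
move=> t a s b g w; clear -L0 G0 => ha hw a0 g0 b0 t0 s0 hb ht.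
have hc0 : 0 <= b * g by exact: mulr_ge0.
move: (b * g) hb hc0 ht => c hb hc0 ht.
have h1 : t ^+ 2 <= (a + c) ^+ 2 by apply: lerXn2r; rewrite ?nnegrE ?addr_ge0.
(* AM-GM: [(a c)^2 <= x y] gives [2 a c <= x + y], with [x = Gam s^2], [y = Lam b^2] *)
have h2 : 2 * (a * c) <= Gam * s ^+ 2 + Lam * b ^+ 2.
  have h : (a * c) ^+ 2 <= (Gam * s ^+ 2) * (Lam * b ^+ 2).
    rewrite exprMn (_ : Gam * s ^+ 2 * _ = (Lam * s ^+ 2) * (Gam * b ^+ 2)); last by ring.
    by apply: ler_pM => //; exact: sqr_ge0.
  have x0 : 0 <= Gam * s ^+ 2 by rewrite mulr_ge0 ?sqr_ge0.
  have y0 : 0 <= Lam * b ^+ 2 by rewrite mulr_ge0 ?sqr_ge0.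
  move: (Gam * s ^+ 2) (Lam * b ^+ 2) x0 y0 h => x y x0 y0 h.
  rewrite -(@ler_pXn2r _ 2) ?nnegrE ?addr_ge0 ?mulr_ge0 //.
  apply: (@le_trans _ _ (4 * (x * y))).
    by rewrite exprMn -natrX; apply: ler_wpM2l.
  by rewrite -subr_ge0 (_ : _ - _ = (x - y) ^+ 2) ?sqr_ge0 //; ring.
have h3 : (Lam + Gam) * (s ^+ 2 + b ^+ 2) <= (Lam + Gam) * w ^+ 2.
  by apply: ler_wpM2l => //; exact: addr_ge0.
apply: le_trans h1 _; apply: le_trans _ h3; rewrite sqrrD; clear -ha hb h2; lra.
Qed.

(** Both conclusions read off one block: [D (D' W D' - D') D = D W D - D], and
    [D (D' W D' - D') e_i = D W e_i] because [D e_i = 0]. *)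
Lemma mask_transfer (W : 'M[C]_n) (S : {set 'I_n}) (i : 'I_n) (delta : R)
    (D := maskmx R S) (D' := maskmx R (i |: S)) : i \notin S ->
  (forall v : 'cV[C]_n, l2norm ((D' *m W *m D' - D') *m v) <= delta * l2norm v) ->
  (forall v : 'cV[C]_n, l2norm ((D *m W *m D - D) *m v) <= delta * l2norm v) /\
  l2norm (col i (D *m W)) <= delta.
Proof.
move=> iS h.
have d0 : 0 <= delta.
  have := h (delta_mx i 0); have -> : l2norm (delta_mx i 0 : 'cV[C]_n) = 1.
    by apply/eqP; rewrite -(@eqrXn2 _ 2) ?l2norm_ge0 // -Re_dotc_self dotc_delta mxE !eqxx expr1n.
  by rewrite mulr1; apply: le_trans; exact: l2norm_ge0.
have DD' : D *m D' = D by apply: maskmx_sub; exact: finset.subsetUr.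
have D'D : D' *m D = D by apply: maskmx_subr; exact: finset.subsetUr.
have DD : D *m D = D by apply: maskmx_sub.
have nD (u : 'cV[C]_n) : l2norm (D *m u) <= l2norm u by exact: l2norm_mask.
have nD' (u : 'cV[C]_n) : l2norm (D' *m u) <= l2norm u by exact: l2norm_mask.
have De : D *m delta_mx i 0 = 0 :> 'cV[C]_n.
  apply/colP => j; rewrite maskmxE !mxE; case: ifP => // jS.
  by rewrite (_ : (j == i) = false) //; apply: contraNF iS => /eqP <-.
have D'e : D' *m delta_mx i 0 = delta_mx i 0 :> 'cV[C]_n.
  apply/colP => j; rewrite maskmxE !mxE !inE.
  by case: (eqVneq j i) => //= _; case: ifP.
have h1 := h (delta_mx i 0); clearbody D D'.
split=> [v|].
  have -> : (D *m W *m D - D) *m v = D *m ((D' *m W *m D' - D') *m (D *m v)).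
    rewrite !mulmxBl mulmxBr -!mulmxA ![D *m (D' *m _)]mulmxA DD'.
    by rewrite ![D' *m (D *m _)]mulmxA D'D ![D *m (D *m _)]mulmxA DD.
  apply: le_trans (nD _) _; apply: le_trans (h _) _.
  by apply: ler_wpM2l => //; exact: nD.
have -> : col i (D *m W) = D *m ((D' *m W *m D' - D') *m delta_mx i 0).
  rewrite !mulmxBl mulmxBr -!mulmxA ![D *m (D' *m _)]mulmxA DD' D'e De subr0.
  by rewrite colE mulmxA.
apply: le_trans (nD _) _; apply: le_trans h1 _.
apply: ler_piMr => //.
by rewrite -(@ler_pXn2r _ 2) ?nnegrE ?l2norm_ge0 // -Re_dotc_self dotc_delta mxE !eqxx expr1n.
Qed.

End masked_gram.

(** * Measurability, expectation and independence *)

Section complex_functions.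
Variables (R : realType) (U : Type).
Local Notation C := R[i].

(** Boundedness and measurability for each sigma-algebra in play are such classes. Products, traces,
    determinants and adjugates are polynomial in the entries, so their closure is proved once for
    all of them. *)
Record ring_closed_class (Q : (U -> C) -> Prop) : Prop := RingClosedClass {
  rcc_cst : forall c, Q (fun=> c);
  rcc_add : forall f g, Q f -> Q g -> Q (fun u => f u + g u);
  rcc_mul : forall f g, Q f -> Q g -> Q (fun u => f u * g u) }.

Variable Q : (U -> C) -> Prop.
Hypothesis HQ : ring_closed_class Q.

Definition mxclass p k (X : U -> 'M[C]_(p, k)) := forall i j, Q (fun u => X u i j).

Lemma rcc_opp f : Q f -> Q (fun u => - f u).
Proof.
move=> Qf; rewrite (_ : (fun u => _) = (fun u => -1 * f u)).
  by apply: rcc_mul => //; exact: rcc_cst.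
by apply: funext => u; rewrite mulN1r.
Qed.

Lemma rcc_sum (I : Type) (r : seq I) (P : pred I) (F : I -> U -> C) :
  (forall i, P i -> Q (F i)) -> Q (fun u => \sum_(i <- r | P i) F i u).
Proof.
move=> QF; elim: r => [|i r IH].
  by rewrite (_ : (fun u => _) = fun=> 0); [exact: rcc_cst|apply: funext => u; rewrite big_nil].
rewrite (_ : (fun u => _) = fun u => (if P i then F i u else 0) + \sum_(i <- r | P i) F i u).
  by apply: rcc_add => //; case: (boolP (P i)) => [/QF//|_]; exact: rcc_cst.
by apply: funext => u; rewrite big_cons; case: ifP; rewrite ?add0r.
Qed.

Lemma rcc_prod (I : Type) (r : seq I) (P : pred I) (F : I -> U -> C) :
  (forall i, P i -> Q (F i)) -> Q (fun u => \prod_(i <- r | P i) F i u).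
Proof.
move=> QF; elim: r => [|i r IH].
  by rewrite (_ : (fun u => _) = fun=> 1); [exact: rcc_cst|apply: funext => u; rewrite big_nil].
rewrite (_ : (fun u => _) = fun u => (if P i then F i u else 1) * \prod_(i <- r | P i) F i u).
  by apply: rcc_mul => //; case: (boolP (P i)) => [/QF//|_]; exact: rcc_cst.
by apply: funext => u; rewrite big_cons; case: ifP; rewrite ?mul1r.
Qed.

Lemma mxclass_cst p k (M : 'M[C]_(p, k)) : mxclass (fun=> M).
Proof. by move=> i j; exact: rcc_cst. Qed.

Lemma mxclassD p k (X Y : U -> 'M[C]_(p, k)) :
  mxclass X -> mxclass Y -> mxclass (fun u => X u + Y u).
Proof.
move=> hX hY i j; rewrite (_ : (fun u => _) = fun u => X u i j + Y u i j).
  exact: rcc_add.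
by apply: funext => u; rewrite mxE.
Qed.

Lemma mxclassN p k (X : U -> 'M[C]_(p, k)) : mxclass X -> mxclass (fun u => - X u).
Proof.
move=> hX i j; rewrite (_ : (fun u => _) = fun u => - X u i j).
  exact: rcc_opp.
by apply: funext => u; rewrite mxE.
Qed.

Lemma mxclassB p k (X Y : U -> 'M[C]_(p, k)) :
  mxclass X -> mxclass Y -> mxclass (fun u => X u - Y u).
Proof. by move=> hX hY; apply: mxclassD => //; exact: mxclassN. Qed.

Lemma mxclass_sum p k (I : Type) (r : seq I) (P : pred I) (F : I -> U -> 'M[C]_(p, k)) :
  (forall i, P i -> mxclass (F i)) -> mxclass (fun u => \sum_(i <- r | P i) F i u).
Proof.
move=> hF i j; rewrite (_ : (fun u => _) = fun u => \sum_(l <- r | P l) F l u i j).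
  by apply: rcc_sum => l Pl; exact: hF.
by apply: funext => u; rewrite summxE.
Qed.

Lemma mxclassM p k q (X : U -> 'M[C]_(p, k)) (Y : U -> 'M[C]_(k, q)) :
  mxclass X -> mxclass Y -> mxclass (fun u => X u *m Y u).
Proof.
move=> hX hY i j; rewrite (_ : (fun u => _) = fun u => \sum_l X u i l * Y u l j).
  by apply: rcc_sum => l _; exact: rcc_mul.
by apply: funext => u; rewrite mxE.
Qed.

Lemma mxclassZ p k (f : U -> C) (X : U -> 'M[C]_(p, k)) :
  Q f -> mxclass X -> mxclass (fun u => f u *: X u).
Proof.
move=> hf hX i j; rewrite (_ : (fun u => _) = fun u => f u * X u i j).
  exact: rcc_mul.
by apply: funext => u; rewrite mxE.
Qed.

Lemma mxclassX n (X : U -> 'M[C]_n) k : mxclass X -> mxclass (fun u => X u ^+ k).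
Proof.
move=> hX; elim: k => [|k IH]; first by under eq_fun do rewrite expr0; exact: mxclass_cst.
rewrite (_ : (fun u => _) = fun u => X u *m X u ^+ k); last first.
  by apply: funext => u; rewrite exprS.
exact: mxclassM.
Qed.

Lemma mxclass_trace n (X : U -> 'M[C]_n) : mxclass X -> Q (fun u => \tr (X u)).
Proof. by move=> hX; apply: rcc_sum => i _; exact: hX. Qed.

Lemma mxclass_det n (X : U -> 'M[C]_n) : mxclass X -> Q (fun u => \det (X u)).
Proof.
move=> hX; apply: rcc_sum => s _; apply: rcc_mul => //; first exact: rcc_cst.
by apply: rcc_prod => i _; exact: hX.
Qed.

Lemma mxclass_adjugate n (X : U -> 'M[C]_n) : mxclass X -> mxclass (fun u => \adj (X u)).
Proof.
move=> hX i j; rewrite (_ : (fun u => _) = fun u => cofactor (X u) j i); last first.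
  by apply: funext => u; rewrite mxE.
apply: rcc_mul => //; first exact: rcc_cst.
apply: mxclass_det => k l.
rewrite (_ : (fun u => _) = fun u => X u (lift j k) (lift i l)); first exact: hX.
by apply: funext => u; rewrite !mxE.
Qed.

End complex_functions.

Section bounded_class.
Variables (R : realType) (U : Type).
Local Notation C := R[i].

Definition cbdd (f : U -> C) : Prop := exists K : R, forall u, normc (f u) <= K.

Lemma cbdd_class : ring_closed_class cbdd.
Proof.
split=> [c|f g [K hK] [L hL]|f g [K hK] [L hL]]; first by exists (normc c).
  by exists (K + L) => u; apply: le_trans (normcD_le _ _) _; exact: lerD.
exists (K * L) => u; rewrite normcM; apply: ler_pM => //; exact: normc_ge0.
Qed.

End bounded_class.

Section measurable_class.
Variables (R : realType) (d : measure_display) (U : measurableType d).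
Local Notation C := R[i].

Definition cmeas (f : U -> C) : Prop :=
  measurable_fun setT (fun u => complex.Re (f u)) /\
  measurable_fun setT (fun u => complex.Im (f u)).

Lemma cmeas_class : ring_closed_class cmeas.
Proof.
split=> [c|f g [f1 f2] [g1 g2]|f g [f1 f2] [g1 g2]].
- by split; exact: measurable_cst.
- split.
    by under eq_fun do rewrite cReD; exact: measurable_funD.
  by under eq_fun do rewrite cImD; exact: measurable_funD.
- split.
    under eq_fun do rewrite cReM.
    by apply: measurable_funB; exact: measurable_funM.
  under eq_fun do rewrite cImM.
  by apply: measurable_funD; exact: measurable_funM.
Qed.

Lemma cmeas_conj f : cmeas f -> cmeas (fun u => conjc (f u)).
Proof.
move=> [f1 f2]; split.
  by rewrite (_ : (fun u => _) = fun u => complex.Re (f u)) //; apply: funext => u; case: (f u).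
rewrite (_ : (fun u => _) = fun u => - complex.Im (f u)); last by apply: funext => u; case: (f u).
exact: measurable_funN.
Qed.

Lemma cmeas_inv f : cmeas f -> cmeas (fun u => (f u)^-1).
Proof.
move=> [f1 f2].
pose n2 u := complex.Re (f u) ^+ 2 + complex.Im (f u) ^+ 2.
have mn : measurable_fun setT (fun u => (n2 u)^-1).
  (* The inverse of the nonnegative [n2] is a real power, a measurable function; this includes the
     zeros of [f], where the inverse is 0. *)
  rewrite (_ : (fun u => _) = fun u => n2 u `^ (-1)); last first.
    by apply: funext => u; rewrite powR_inv1 // addr_ge0 ?sqr_ge0.
  apply: (measurableT_comp (@measurable_powR R (-1)) (_ : measurable_fun setT n2)).
  by apply: measurable_funD; exact: measurable_funX.
split.
  rewrite (_ : (fun u => _) = fun u => complex.Re (f u) * (n2 u)^-1); last first.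
    by apply: funext => u; rewrite /n2; case: (f u).
  exact: measurable_funM.
rewrite (_ : (fun u => _) = fun u => - (complex.Im (f u) * (n2 u)^-1)); last first.
  by apply: funext => u; rewrite /n2; case: (f u).
by apply: measurable_funN; exact: measurable_funM.
Qed.

End measurable_class.

Lemma cmeas_comp (R : realType) d1 d2 (U : measurableType d1) (V : measurableType d2)
  (f : V -> R[i]) (g : U -> V) : cmeas f -> measurable_fun setT g -> cmeas (fun u => f (g u)).
Proof. by move=> [f1 f2] mg; split; [exact: (measurableT_comp f1 mg)|exact: (measurableT_comp f2 mg)]. Qed.

Section expectation.
Context {R : realType} {d : measure_display} {T : measurableType d}.
Variable P : probability T R.
Local Notation C := R[i].
Implicit Types f g : T -> R.

(** Real-valued, so that [ring] and [lra] apply; on the bounded measurable functions [bmeas] the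
    integral is finite and [fine] loses nothing, see [EFin_Ex]. *)
Definition Ex f : R := fine (\int[P]_w (f w)%:E)%E.

Definition bmeas f : Prop := measurable_fun setT f /\ exists K : R, forall w, `|f w| <= K.

Lemma bmeas_integrable f : bmeas f -> P.-integrable setT (EFin \o f).
Proof.
move=> [mf [K hK]]; apply: measurable_bounded_integrable => //.
  by apply: (le_lt_trans (probability_le1 P measurableT)); rewrite ltry.
exists K; split; first exact: num_real.
by move=> M KM w _; apply: le_trans (hK w) (ltW KM).
Qed.

Lemma EFin_Ex f : bmeas f -> (Ex f)%:E = (\int[P]_w (f w)%:E)%E.
Proof. by move=> bf; rewrite fineK //; apply: integrable_fin_num => //; exact: bmeas_integrable. Qed.

Lemma bmeas_cst (c : R) : bmeas (fun=> c).
Proof. by split; [exact: measurable_cst|exists `|c|]. Qed.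

Lemma bmeasD f g : bmeas f -> bmeas g -> bmeas (fun w => f w + g w).
Proof.
move=> [mf [K hK]] [mg [L hL]]; split; first exact: measurable_funD.
by exists (K + L) => w; apply: le_trans (ler_normD _ _) _; exact: lerD.
Qed.

Lemma bmeasZ (c : R) f : bmeas f -> bmeas (fun w => c * f w).
Proof.
move=> [mf [K hK]]; split; first by apply: measurable_funM => //; exact: measurable_cst.
by exists (`|c| * K) => w; rewrite normrM ler_wpM2l.
Qed.

Lemma bmeasB f g : bmeas f -> bmeas g -> bmeas (fun w => f w - g w).
Proof.
move=> bf bg; rewrite (_ : (fun w => _) = fun w => f w + (-1) * g w); last first.
  by apply: funext => w; rewrite mulN1r.
by apply: bmeasD => //; exact: bmeasZ.
Qed.

Lemma Ex_cst (c : R) : Ex (fun=> c) = c.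
Proof. by rewrite /Ex integral_cst //= probability_setT mule1. Qed.

Lemma ExD f g : bmeas f -> bmeas g -> Ex (fun w => f w + g w) = Ex f + Ex g.
Proof.
move=> bf bg; apply/EFin_inj; rewrite EFinD !EFin_Ex //; last exact: bmeasD.
under eq_integral do rewrite EFinD.
by rewrite integralD //; exact: bmeas_integrable.
Qed.

Lemma ExZ (c : R) f : bmeas f -> Ex (fun w => c * f w) = c * Ex f.
Proof.
move=> bf; apply/EFin_inj; rewrite EFinM !EFin_Ex //; last exact: bmeasZ.
under eq_integral do rewrite EFinM.
by rewrite integralZl //; exact: bmeas_integrable.
Qed.

Lemma ExB f g : bmeas f -> bmeas g -> Ex (fun w => f w - g w) = Ex f - Ex g.
Proof.
move=> bf bg; rewrite (_ : (fun w => f w - g w) = fun w => f w + (-1) * g w).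
  by rewrite ExD ?ExZ ?mulN1r //; exact: bmeasZ.
by apply: funext => w; rewrite mulN1r.
Qed.

Lemma Ex_ae_ge0 f : bmeas f -> {ae P, forall w, 0 <= f w} -> 0 <= Ex f.
Proof.
move=> [mf bf] f0.
have E : (\int[P]_w (f w)%:E = \int[P]_w (Num.max (f w) 0)%:E)%E.
  apply: ae_eq_integral => //.
  - exact/measurable_EFinP.
  - by apply/measurable_EFinP; apply: measurable_maxr => //; exact: measurable_cst.
  - by apply: filterS f0 => w h _; rewrite max_l.
rewrite /Ex E; apply: fine_ge0; apply: integral_ge0 => w _.
by rewrite lee_fin le_max lexx orbT.
Qed.

Lemma Ex_ae_le f g : bmeas f -> bmeas g -> {ae P, forall w, f w <= g w} -> Ex f <= Ex g.
Proof.
move=> bf bg fg; rewrite -subr_ge0 -ExB //; apply: Ex_ae_ge0; first exact: bmeasB.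
by apply: filterS fg => w; rewrite subr_ge0.
Qed.

Lemma Ex_le f g : bmeas f -> bmeas g -> (forall w, f w <= g w) -> Ex f <= Ex g.
Proof. by move=> bf bg fg; apply: Ex_ae_le => //; exact: aeW. Qed.

Lemma Ex_ae_eq f g : bmeas f -> bmeas g -> {ae P, forall w, f w = g w} -> Ex f = Ex g.
Proof.
move=> bf bg fg; apply/eqP; rewrite eq_le; apply/andP; split; apply: Ex_ae_le => //;
  by apply: filterS fg => w ->.
Qed.

Definition cbm (F : T -> C) : Prop := cmeas F /\ cbdd F.

Lemma cbm_class : ring_closed_class cbm.
Proof.
have [m1 m2 m3] := @cmeas_class R d T; have [b1 b2 b3] := @cbdd_class R T.
split=> [c|f g [? ?] [? ?]|f g [? ?] [? ?]]; split; auto.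
Qed.

Lemma bmeas_Re F : cbm F -> bmeas (fun w => complex.Re (F w)).
Proof.
move=> [[m1 _] [K hK]]; split => //; exists K => w.
exact: le_trans (normRe_le_normc _) (hK w).
Qed.

Lemma bmeas_Im F : cbm F -> bmeas (fun w => complex.Im (F w)).
Proof.
move=> [[_ m1] [K hK]]; split => //; exists K => w.
exact: le_trans (normIm_le_normc _) (hK w).
Qed.

Definition Ec (F : T -> C) : C :=
  Complex (Ex (fun w => complex.Re (F w))) (Ex (fun w => complex.Im (F w))).

Lemma Re_Ec F : complex.Re (Ec F) = Ex (fun w => complex.Re (F w)). Proof. by []. Qed.

Lemma EcD F G : cbm F -> cbm G -> Ec (fun w => F w + G w) = Ec F + Ec G.
Proof.
move=> bF bG; apply/eqP; rewrite eq_complex cReD cImD /=; apply/andP; split; apply/eqP.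
  by under eq_fun do rewrite cReD; rewrite ExD //; exact: bmeas_Re.
by under eq_fun do rewrite cImD; rewrite ExD //; exact: bmeas_Im.
Qed.

Lemma EcZ c F : cbm F -> Ec (fun w => c * F w) = c * Ec F.
Proof.
move=> bF; apply/eqP; rewrite eq_complex cReM cImM /=; apply/andP; split; apply/eqP.
  under eq_fun do rewrite cReM.
  by rewrite ExB ?ExZ //; try apply: bmeasZ; try exact: bmeas_Re; exact: bmeas_Im.
under eq_fun do rewrite cImM.
by rewrite ExD ?ExZ //; try apply: bmeasZ; try exact: bmeas_Re; exact: bmeas_Im.
Qed.

Lemma Ec_cst c : Ec (fun=> c) = c.
Proof. by rewrite /Ec !Ex_cst; case: c. Qed.

Lemma EcB F G : cbm F -> cbm G -> Ec (fun w => F w - G w) = Ec F - Ec G.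
Proof.
move=> bF bG; rewrite (_ : (fun w => F w - G w) = fun w => F w + (-1) * G w).
  rewrite EcD ?EcZ ?mulN1r //.
  by apply: (rcc_mul cbm_class) => //; exact: (rcc_cst cbm_class).
by apply: funext => w; rewrite mulN1r.
Qed.

Lemma Ec_sum (I : Type) (r : seq I) (Q : pred I) (F : I -> T -> C) :
  (forall i, Q i -> cbm (F i)) ->
  Ec (fun w => \sum_(i <- r | Q i) F i w) = \sum_(i <- r | Q i) Ec (F i).
Proof.
move=> bF; elim: r => [|i r IH].
  by rewrite big_nil; under eq_fun do rewrite big_nil; rewrite Ec_cst.
rewrite big_cons; under eq_fun do rewrite big_cons.
case: ifP => // Qi; rewrite EcD ?IH //; first exact: bF.
by apply: (rcc_sum cbm_class).
Qed.

Definition Emx p k (X : T -> 'M[C]_(p, k)) : 'M[C]_(p, k) :=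
  \matrix_(i, j) Ec (fun w => X w i j).

Lemma Ec_trace_mulr n (X : T -> 'M[C]_n) (M : 'M[C]_n) :
  mxclass cbm X -> Ec (fun w => \tr (X w *m M)) = \tr (Emx X *m M).
Proof.
move=> bX; rewrite Ec_sum => [|i _]; last first.
  exact: (mxclassM cbm_class bX (mxclass_cst cbm_class M) i i).
apply: eq_bigr => i _; rewrite mxE.
under eq_fun do rewrite mxE.
rewrite Ec_sum => [|j _]; last first.
  by apply: (rcc_mul cbm_class) => //; exact: (rcc_cst cbm_class).
apply: eq_bigr => j _; rewrite mxE mulrC -EcZ //.
by congr Ec; apply: funext => w; rewrite mulrC.
Qed.

Lemma Ec_trace_mull n (X : T -> 'M[C]_n) (M : 'M[C]_n) :
  mxclass cbm X -> Ec (fun w => \tr (M *m X w)) = \tr (M *m Emx X).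
Proof.
move=> bX; rewrite [RHS]mxtrace_mulC -Ec_trace_mulr //.
by congr Ec; apply: funext => w; rewrite mxtrace_mulC.
Qed.

End expectation.

(** * Decoupling two independent sigma-algebras *)

Section decoupling.
Context {R : realType} {d : measure_display} {T : measurableType d}.
Variable P : probability T R.

(** Independence makes the law of the pair agree with the product law on rectangles, hence
    everywhere; Tonelli then integrates one variable at a time. *)
Lemma decouple_maps d1 d2 (T1 : measurableType d1) (T2 : measurableType d2)
    (f : {mfun T >-> T1}) (g : {mfun T >-> T2}) (H : T1 * T2 -> \bar R) :
  (forall A B, measurable A -> measurable B ->
     P ((f @^-1` A) `&` (g @^-1` B)) = (P (f @^-1` A) * P (g @^-1` B))%E) ->
  measurable_fun setT H -> (forall z, (0 <= H z)%E) ->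
  (\int[P]_w H (f w, g w) = \int[P]_w \int[P]_w' H (f w, g w'))%E /\
  measurable_fun setT (fun w => \int[P]_w' H (f w, g w'))%E.
Proof.
move=> ind mH H0.
pose m1 := distribution P f; pose m2 := distribution P g.
have mfg : measurable_fun setT (fun w => (f w, g w)).
  exact: measurable_fun_pair (measurable_funPT f) (measurable_funPT g).
pose fg : {mfun T >-> (T1 * T2)%type} := HB.pack (fun w => (f w, g w))
  (isMeasurableFun.Build _ _ _ _ _ mfg).
have E X : measurable X -> (m1 \x m2)%E X = distribution P fg X.
  by apply: product_measure_unique => A B mA mB; rewrite -ind.
have inner w : (\int[P]_w' H (f w, g w'))%E = fubini_F m2 H (f w).
  rewrite /fubini_F ge0_integral_distribution //.
  exact: measurableT_comp.
split; last first.
  under eq_fun do rewrite inner.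
  apply: (measurableT_comp _ (measurable_funPT f)).
  exact: measurable_fun_fubini_tonelli_F.
under [in RHS]eq_integral do rewrite inner.
transitivity (\int[distribution P fg]_z H z)%E.
  by rewrite ge0_integral_distribution.
transitivity (\int[(m1 \x m2)%E]_z H z)%E.
  by apply: eq_measure_integral => A mA _; apply/esym; exact: E.
rewrite fubini_tonelli1 //.
rewrite ge0_integral_distribution //; last 2 first.
- exact: measurable_fun_fubini_tonelli_F.
- by move=> x; apply: integral_ge0.
Qed.

(** Both maps are the identity of [T], with values in [T] carrying a smaller sigma-algebra. A
    diagonal [H w w] can thus be decoupled without naming the random objects through which [w]
    acts. *)
Lemma decouple (G1 G2 : set (set T)) (H : T -> T -> \bar R) :
  G1 `<=` measurable -> G2 `<=` measurable -> independent2 P <<s G1>> <<s G2>> ->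
  measurable_fun [set: g_sigma_algebraType G1 * g_sigma_algebraType G2]
    (fun z => H z.1 z.2) ->
  (forall w w', (0 <= H w w')%E) ->
  (\int[P]_w H w w = \int[P]_w \int[P]_w' H w w')%E /\
  measurable_fun setT (fun w => \int[P]_w' H w w')%E.
Proof.
move=> G1m G2m ind mH H0.
have mid (G : set (set T)) : G `<=` measurable ->
    measurable_fun [set: T] (idfun : T -> g_sigma_algebraType G).
  move=> Gm _ Y mY; rewrite setTI preimage_id.
  exact: (smallest_sub (@sigma_algebra_measurable _ T) Gm).
pose f : {mfun T >-> g_sigma_algebraType G1} := HB.pack (idfun : T -> g_sigma_algebraType G1)
  (isMeasurableFun.Build _ _ _ _ _ (mid _ G1m)).
pose g : {mfun T >-> g_sigma_algebraType G2} := HB.pack (idfun : T -> g_sigma_algebraType G2)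
  (isMeasurableFun.Build _ _ _ _ _ (mid _ G2m)).
apply: (@decouple_maps _ _ _ _ f g (fun z => H z.1 z.2)) => //.
Qed.

End decoupling.

Section block_independence.
Context {R : realType} {d : measure_display} {T : measurableType d}.
Variable P : probability T R.

(** Finite intersections of events from the sigma-algebras indexed by [U] form a pi-system
    generating the block; the product rule holds on it and extends by uniqueness of measures. *)
Lemma block_independent (I : finType) (D : {set I}) (g : I -> set (set T))
    (U : {set I}) (j : I) :
  (forall i, i \in D -> g i `<=` measurable) ->
  mutually_independent P D (fun i => <<s g i>>) -> U \subset D -> j \in D -> j \notin U ->
  independent2 P <<s [set E | exists i, i \in U /\ <<s g i>> E] >> <<s g j>>.
Proof.
move=> gm ind UD jD jU E1 E2 hE1 hE2.
have UDi i : i \in U -> i \in D by move/fintype.subsetP : UD; apply.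
have sgm i : i \in D -> <<s g i>> `<=` measurable.
  by move=> iD; apply: (smallest_sub (@sigma_algebra_measurable _ T)); exact: gm.
have mE2 : measurable E2 by exact: sgm hE2.
pose Pi : set (set T) := [set A | exists E : I -> set T,
  (forall i, i \in U -> <<s g i>> (E i)) /\ A = \bigcap_(i in [set i | i \in U]) E i].
have sT i : <<s g i>> setT by exact: (@measurableT _ (g_sigma_algebraType (g i))).
have mcap (E : I -> set T) (V : {set I}) : (forall i, i \in V -> measurable (E i)) ->
    measurable (\bigcap_(i in [set i | i \in V]) E i).
  by move=> mE; apply: fin_bigcap_measurable => //; exact: finite_finset.
have Pim : Pi `<=` measurable.
  by move=> _ [E [hE ->]]; apply: mcap => i iU; apply: (sgm i) (hE i iU); exact: UDi.
have PiT : Pi setT.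
  by exists (fun=> setT); split => //; rewrite bigcapT.
have PiI : setI_closed Pi.
  move=> _ _ [E [hE ->]] [E' [hE' ->]]; exists (fun i => E i `&` E' i); split; last first.
    by rewrite bigcapI.
  move=> i iU; apply: (@measurableI _ (g_sigma_algebraType (g i))); [exact: hE|exact: hE'].
have rule (E : I -> set T) : (forall i, i \in U -> <<s g i>> (E i)) ->
    P (\bigcap_(i in [set i | i \in U]) E i `&` E2) =
    (P (\bigcap_(i in [set i | i \in U]) E i) * P E2)%E.
  move=> hE.
  (* Slots outside [U] are filled with the whole space. Independence is applied with and without
     [E2] in slot [j], and the two products differ by the factor [P E2]. *)
  pose E' i := if i \in U then E i else if i == j then E2 else setT.
  pose E'' i := if i \in U then E i else setT.
  have h' i : i \in D -> <<s g i>> (E' i).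
    by rewrite /E' => iD; case: ifP => [/hE//|_]; case: eqP => [->|].
  have h'' i : i \in D -> <<s g i>> (E'' i).
    by rewrite /E'' => iD; case: ifP => [/hE//|_].
  have := ind _ h'; have := ind _ h''.
  have -> : \bigcap_(i in [set i | i \in D]) E'' i = \bigcap_(i in [set i | i \in U]) E i.
    apply/seteqP; split=> w hw i /=.
      by move=> iU; have := hw i (UDi _ iU); rewrite /E'' iU.
    by rewrite /E''; case: ifP => // iU _; exact: hw.
  have -> : \bigcap_(i in [set i | i \in D]) E' i =
      \bigcap_(i in [set i | i \in U]) E i `&` E2.
    apply/seteqP; split=> w.
      move=> hw; split => [i /= iU|]; first by have := hw i (UDi _ iU); rewrite /E' iU.
      by have := hw j jD; rewrite /E' (negPf jU) eqxx.
    move=> [hw h2] i /= iD; rewrite /E'; case: ifP => [iU|_]; first exact: hw.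
    by case: eqP.
  move=> -> ->; rewrite (bigD1 j) //= [X in _ = (X * _)%E](bigD1 j) //=.
  have -> : E' j = E2 by rewrite /E' (negPf jU) eqxx.
  have -> : E'' j = setT by rewrite /E'' (negPf jU).
  rewrite probability_setT mul1e muleC; congr (_ * _)%E.
  apply: eq_bigr => i /andP[_ ij]; rewrite /E' /E''; case: ifP => // _.
  by rewrite (negPf ij).
have p0 : 0 <= fine (P E2) by exact: fine_ge0.
have Pf : (fine (P E2))%:E = P E2 by rewrite fineK // fin_num_measure.
have ms A : mscale (NngNum p0) P A = (P E2 * P A)%E by rewrite -[X in _ = (X * _)%E]Pf.
(* As functions of [A], [P (A & E2)] and [P E2 * P A] are finite measures that agree on the
   pi-system. *)
have key : forall A, <<s Pi>> A -> mrestr P mE2 A = mscale (NngNum p0) P A.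
  apply: (@g_sigma_algebra_measure_unique _ _ _ Pi Pim (fun=> setT)) => //.
  - by rewrite bigcup_const.
  - move=> _ [E [hE ->]]; apply: (etrans _ (esym (ms _))).
    by rewrite muleC -rule.
  - move=> k; rewrite /= /mrestr setTI; apply: (le_lt_trans (probability_le1 P mE2)).
    by rewrite ltry.
have sub : <<s [set E | exists i, i \in U /\ <<s g i>> E] >> `<=` <<s Pi>>.
  apply: sub_sigma_algebra2 => E [i [iU hE]].
  exists (fun k => if k == i then E else setT); split => [k kU|].
    by case: eqP => [->|].
  apply/seteqP; split=> w hw; first by move=> k /= kU; case: eqP.
  by have := hw i iU; rewrite eqxx.
by have := etrans (key _ (sub _ hE1)) (ms _); rewrite muleC.
Qed.

End block_independence.

(** * The resampling inequality in expectation *)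

Section exchangeable_pair.
Context {R : realType} {d : measure_display} {T : measurableType d}.
Variable P : probability T R.
Local Notation C := R[i].
Variable n : nat.

Let cbmx (X : T -> 'M[C]_n) := mxclass (@cbm R d T) X.

Lemma cbm_trace_mul (A B : T -> 'M[C]_n) : cbmx A -> cbmx B ->
  cbm (fun w => \tr (A w *m B w)).
Proof. by move=> hA hB; apply: (mxclass_trace (@cbm_class R d T)); exact: (mxclassM (@cbm_class R d T)). Qed.

Lemma cbm_comb4 (s : C) (F1 F2 F3 F4 : T -> C) : cbm F1 -> cbm F2 -> cbm F3 -> cbm F4 ->
  cbm (fun w => F1 w + s * F2 w + s * F3 w + F4 w).
Proof.
have Q := @cbm_class R d T; move=> h1 h2 h3 h4.
have hs (F : T -> C) : cbm F -> cbm (fun w => s * F w).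
  by move=> hF; exact: (rcc_mul Q (rcc_cst Q s) hF).
exact: (rcc_add Q (rcc_add Q (rcc_add Q h1 (hs _ h2)) (hs _ h3)) h4).
Qed.

Lemma Ec_comb4 (s : C) (F1 F2 F3 F4 : T -> C) : cbm F1 -> cbm F2 -> cbm F3 -> cbm F4 ->
  Ec P (fun w => F1 w + s * F2 w + s * F3 w + F4 w) =
  Ec P F1 + s * Ec P F2 + s * Ec P F3 + Ec P F4.
Proof.
have Q := @cbm_class R d T; move=> h1 h2 h3 h4.
have hs (F : T -> C) : cbm F -> cbm (fun w => s * F w).
  by move=> hF; exact: (rcc_mul Q (rcc_cst Q s) hF).
rewrite (EcD P (rcc_add Q (rcc_add Q h1 (hs _ h2)) (hs _ h3)) h4).
rewrite (EcD P (rcc_add Q h1 (hs _ h2)) (hs _ h3)) (EcD P h1 (hs _ h2)).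
by rewrite (EcZ _ _ h2) (EcZ _ _ h3).
Qed.

(* Averaging [trace_pair_bound] over two independent copies of [X]: the product
   average only involves [E X], [E f] and [E g], so no product space is needed. *)
Lemma trace_decorrelation (X : T -> 'M[C]_n) (N : 'M[C]_n) (r : R) (k : nat) :
  cbmx X -> (forall w, (X w)^H = X w) -> N^H = N ->
  {ae P, forall w, psdmx (r%:C *: X w - X w *m X w)} ->
  Ex P (fun w => complex.Re (\tr ((X w - Emx P X) *m (N + X w) ^+ k.*2.+1))) <=
  (k.*2.+1)%:R * r *
  Ex P (fun w => complex.Re (\tr ((X w + Emx P X) *m (N + X w) ^+ k.*2))).
Proof.
move=> cX hX hN psdX.
pose f w := (N + X w) ^+ k.*2.+1; pose g w := (N + X w) ^+ k.*2.
have Q := @cbm_class R d T.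
have cNX : cbmx (fun w => N + X w) by apply: (mxclassD Q) => //; exact: (mxclass_cst Q).
have cf : cbmx f by exact: (mxclassX Q).
have cg : cbmx g by exact: (mxclassX Q).
have cc (M : 'M[C]_n) : cbmx (fun=> M) by exact: (mxclass_cst Q).
have ct A B : cbmx A -> cbmx B -> cbm (fun w => \tr (A w *m B w)) by exact: cbm_trace_mul.
pose a := (k.*2.+1)%:R * r.
have pair w w' : psdmx (r%:C *: X w - X w *m X w) -> psdmx (r%:C *: X w' - X w' *m X w') ->
    complex.Re (\tr (X w *m f w) + -1 * \tr (X w *m f w') + -1 * \tr (X w' *m f w) + \tr (X w' *m f w')) <=
    a * complex.Re (\tr (X w *m g w) + 1 * \tr (X w *m g w') + 1 * \tr (X w' *m g w) + \tr (X w' *m g w')).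
  move=> p1 p2; have := trace_pair_bound k hN (hX w) (hX w') p1 p2.
  rewrite -[(N + X w) ^+ k.*2.+1]/(f w) -[(N + X w') ^+ k.*2.+1]/(f w').
  rewrite -[(N + X w) ^+ k.*2]/(g w) -[(N + X w') ^+ k.*2]/(g w') -/a.
  have -> : \tr ((X w - X w') *m (f w - f w')) =
      \tr (X w *m f w) + -1 * \tr (X w *m f w') + -1 * \tr (X w' *m f w) + \tr (X w' *m f w').
    exact: trace_mulBB.
  have -> : \tr ((X w + X w') *m (g w + g w')) =
      \tr (X w *m g w) + 1 * \tr (X w *m g w') + 1 * \tr (X w' *m g w) + \tr (X w' *m g w').
    exact: trace_mulDD.
  by [].
change (Ex P (fun w => complex.Re (\tr ((X w - Emx P X) *m f w))) <=
  a * Ex P (fun w => complex.Re (\tr ((X w + Emx P X) *m g w)))).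
clearbody f g a; move=> {cNX hX hN}.
have E1 (M : 'M[C]_n) : Ec P (fun w => \tr (X w *m M)) = \tr (Emx P X *m M) by exact: Ec_trace_mulr.
have E2 (M : 'M[C]_n) h : cbmx h -> Ec P (fun w => \tr (M *m h w)) = \tr (M *m Emx P h).
  by exact: Ec_trace_mull.
move: (Emx P X) E1 => EX E1.
pose Ef := Emx P f; pose Eg := Emx P g.
pose U := Ec P (fun w => \tr (X w *m f w)); pose V := Ec P (fun w => \tr (X w *m g w)).
have K (c : C) : cbm (fun _ : T => c) by exact: (rcc_cst Q).
have step1 : {ae P, forall w, complex.Re (\tr (X w *m f w) + -1 * \tr (X w *m Ef) + -1 * \tr (EX *m f w) + U) <=
    a * complex.Re (\tr (X w *m g w) + 1 * \tr (X w *m Eg) + 1 * \tr (EX *m g w) + V)}.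
  apply: filterS (psdX) => w pw.
  have h2 := ct _ _ (cc (X w)) cf; have h3 := ct _ _ cX (cc (f w)); have h4 := ct _ _ cX cf.
  have g2 := ct _ _ (cc (X w)) cg; have g3 := ct _ _ cX (cc (g w)); have g4 := ct _ _ cX cg.
  have bF := bmeas_Re (cbm_comb4 (-1) (K (\tr (X w *m f w))) h2 h3 h4).
  have bG := bmeasZ a (bmeas_Re (cbm_comb4 1 (K (\tr (X w *m g w))) g2 g3 g4)).
  have : {ae P, forall w', complex.Re (\tr (X w *m f w) + -1 * \tr (X w *m f w') + -1 * \tr (X w' *m f w) + \tr (X w' *m f w')) <=
    a * complex.Re (\tr (X w *m g w) + 1 * \tr (X w *m g w') + 1 * \tr (X w' *m g w) + \tr (X w' *m g w'))}.
    by apply: filterS psdX => w' pw'; exact: pair.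
  move/(Ex_ae_le bF bG); rewrite ExZ; last first.
    exact: (bmeas_Re (cbm_comb4 1 (K (\tr (X w *m g w))) g2 g3 g4)).
  rewrite -!Re_Ec (Ec_comb4 (-1) (K (\tr (X w *m f w))) h2 h3 h4).
  rewrite (Ec_comb4 1 (K (\tr (X w *m g w))) g2 g3 g4).
  by rewrite !Ec_cst !E1 !E2.
have step2 : complex.Re (U + -1 * \tr (EX *m Ef) + -1 * \tr (EX *m Ef) + U) <=
    a * complex.Re (V + 1 * \tr (EX *m Eg) + 1 * \tr (EX *m Eg) + V).
  have h1 := ct _ _ cX cf; have h2 := ct _ _ cX (cc Ef); have h3 := ct _ _ (cc EX) cf.
  have g1 := ct _ _ cX cg; have g2 := ct _ _ cX (cc Eg); have g3 := ct _ _ (cc EX) cg.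
  have bF := cbm_comb4 (-1) h1 h2 h3 (K U); have bG := cbm_comb4 1 g1 g2 g3 (K V).
  have := Ex_ae_le (bmeas_Re bF) (bmeasZ a (bmeas_Re bG)) step1.
  rewrite ExZ; last exact: bmeas_Re bG.
  rewrite -!Re_Ec (Ec_comb4 (-1) h1 h2 h3 (K U)) (Ec_comb4 1 g1 g2 g3 (K V)).
  by rewrite !Ec_cst !E1 !E2.
have L1 : Ex P (fun w => complex.Re (\tr ((X w - EX) *m f w))) = complex.Re (U - \tr (EX *m Ef)).
  rewrite -Re_Ec; congr complex.Re.
  under [in LHS]eq_fun do rewrite mulmxBl linearB /=.
  by rewrite (EcB P (ct _ _ cX cf) (ct _ _ (cc EX) cf)) E2.
have L2 : Ex P (fun w => complex.Re (\tr ((X w + EX) *m g w))) = complex.Re (V + \tr (EX *m Eg)).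
  rewrite -Re_Ec; congr complex.Re.
  under [in LHS]eq_fun do rewrite mulmxDl linearD /=.
  by rewrite (EcD P (ct _ _ cX cg) (ct _ _ (cc EX) cg)) E2.
rewrite L1 L2; move: step2; clearbody U V Ef Eg; rewrite !mulN1r !mul1r !(cReD, cReN).
move: (complex.Re (\tr (EX *m Ef))) (complex.Re (\tr (EX *m Eg))) => z t.
move: (complex.Re U) (complex.Re V) => x y h.
have : 2 * (x - z) <= 2 * (a * (y + t)) by rewrite mulrCA; move: h; rewrite !mulrDr; lra.
by rewrite ler_pM2l.
Qed.

(** Expand the nonnegative trace of [(1 - Y)^2 Y^(2k)]. This removes the odd moment from the moment
    recursion. *)
Lemma even_trace_dominates (Y : 'M[C]_n) k : Y^H = Y ->
  2 * complex.Re (\tr (Y ^+ k.*2.+1)) <=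
  complex.Re (\tr (Y ^+ k.*2.+2)) + complex.Re (\tr (Y ^+ k.*2)).
Proof.
move=> hY; have := trace_psdmx_even_pow k (psdmx_gram (1%:M - Y)) hY.
have e0 : (1%:M - Y)^H *m (1%:M - Y) = 1%:M - Y - Y + Y *m Y.
  by rewrite adjmxB adjmx1 hY mulmxBl !mulmxBr !mul1mx mulmx1 opprB addrA addrAC.
have e1 : Y *m Y ^+ k.*2 = Y ^+ k.*2.+1 by rewrite exprS.
have e2 : Y *m Y *m Y ^+ k.*2 = Y ^+ k.*2.+2 by rewrite -mulmxA e1 [RHS]exprS.
rewrite e0 mulmxDl !mulmxBl mul1mx e1 e2 linearD !linearB /= !cReD !cReN.
by move: (complex.Re _) (complex.Re _) (complex.Re _) => a b c; lra.
Qed.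

Lemma psdmx_le1_trace (D Y : 'M[C]_n) k : psdmx (1%:M - D) -> Y^H = Y ->
  complex.Re (\tr (D *m Y ^+ k.*2)) <= complex.Re (\tr (Y ^+ k.*2)).
Proof.
move=> hD hY; have := trace_psdmx_even_pow k hD hY.
by rewrite mulmxBl mul1mx linearB /= cReD cReN subr_ge0.
Qed.

End exchangeable_pair.

(** * Moments of sums of independent matrices *)

Section moments.
Context {R : realType} {d : measure_display} {T : measurableType d}.
Variable P : probability T R.
Local Notation C := R[i].

Lemma Ex_sum (I : Type) (r : seq I) (Q : pred I) (F : I -> T -> R) :
  (forall i, Q i -> bmeas (F i)) ->
  bmeas (fun w => \sum_(i <- r | Q i) F i w) /\
  Ex P (fun w => \sum_(i <- r | Q i) F i w) = \sum_(i <- r | Q i) Ex P (F i).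
Proof.
move=> bF; elim: r => [|i r [IH1 IH2]].
  rewrite big_nil; under eq_fun do rewrite big_nil.
  by rewrite Ex_cst; split => //; exact: bmeas_cst.
rewrite big_cons; under eq_fun do rewrite big_cons.
case: ifP => // Qi; have bi := bF i Qi.
by split; [exact: bmeasD|rewrite ExD // IH2].
Qed.

Lemma measurable_section (G1 G2 : set (set T)) (h : T -> T -> R) (w : T) :
  G2 `<=` measurable ->
  measurable_fun [set: g_sigma_algebraType G1 * g_sigma_algebraType G2]
    (fun z => h z.1 z.2) ->
  measurable_fun [set: T] (h w).
Proof.
move=> G2m mh _ Y mY; rewrite setTI.
have m2 : measurable_fun [set: g_sigma_algebraType G2] (h w).
  exact: (measurableT_comp mh (measurable_fun_pair (measurable_cst (w : g_sigma_algebraType G1)) (@measurable_id _ _ setT))).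
have := m2 measurableT _ mY; rewrite setTI.
exact: (smallest_sub (@sigma_algebra_measurable _ T) G2m).
Qed.

Lemma decouple_ge0 (G1 G2 : set (set T)) (h : T -> T -> R) (K : R) :
  G1 `<=` measurable -> G2 `<=` measurable -> independent2 P <<s G1>> <<s G2>> ->
  measurable_fun [set: g_sigma_algebraType G1 * g_sigma_algebraType G2]
    (fun z => h z.1 z.2) ->
  (forall w w', `|h w w'| <= K) ->
  bmeas (fun w => h w w) ->
  (forall w, 0 <= Ex P (h w)) -> 0 <= Ex P (fun w => h w w).
Proof.
move=> G1m G2m ind mh hK bd h0.
have bh w : bmeas (h w) by split; [exact: measurable_section mh|exists K].
(* Decoupling is available for nonnegative integrands, hence the shift by the uniform bound [K]. *)
have nn w w' : 0 <= h w w' + K.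
  by have := hK w w'; rewrite ler_norml => /andP[+ _]; rewrite -subr_ge0 opprK.
have [E mE] : (\int[P]_w (h w w + K)%:E = \int[P]_w \int[P]_w' (h w w' + K)%:E)%E /\
    measurable_fun setT (fun w => \int[P]_w' (h w w' + K)%:E)%E.
  apply: (decouple (P := P) (H := fun w w' => (h w w' + K)%:E) G1m G2m ind).
    by apply/measurable_EFinP; apply: measurable_funD => //; exact: measurable_cst.
  by move=> w w'; rewrite lee_fin.
have : (K%:E <= \int[P]_w (h w w + K)%:E)%E.
  rewrite E; apply: (@le_trans _ _ (\int[P]_w K%:E)%E).
    by rewrite integral_cst //= probability_setT mule1.
  (* [K] bounds an absolute value at some sample point, and [T] is nonempty since it has probability
     1. *)
  have K0 : 0 <= K.
    have [w _] : exists w : T, True.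
      apply: contrapT => nw; have : P setT = 0%E.
        by rewrite (_ : setT = set0) ?measure0 //; apply/seteqP; split=> // w _; apply: nw; exists w.
      by rewrite probability_setT => /eqP; rewrite onee_eq0.
    exact: le_trans (normr_ge0 _) (hK w w).
  apply: ge0_le_integral => //.
  move=> w _; rewrite -EFin_Ex; last by apply: bmeasD => //; exact: bmeas_cst.
  by rewrite lee_fin ExD ?Ex_cst ?lerDr //; exact: bmeas_cst.
rewrite -EFin_Ex; last by apply: bmeasD => //; exact: bmeas_cst.
by rewrite lee_fin ExD ?Ex_cst ?lerDr //; exact: bmeas_cst.
Qed.

Variables (n : nat) (I : finType) (g : I -> set (set T)).
Hypothesis gm : forall l, g l `<=` measurable.
Hypothesis ind : mutually_independent P [set: I] (fun l => <<s g l>>).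
Variable X : I -> T -> 'M[C]_n.
Hypothesis mX : forall l, mxclass (@cmeas R _ (g_sigma_algebraType (g l))) (X l).
Hypothesis bX : forall l, mxclass (@cbdd R T) (X l).
Hypothesis hX : forall l w, (X l w)^H = X l w.
Variable r : R.
Hypothesis psdX : forall l, {ae P, forall w, psdmx (r%:C *: X l w - X l w *m X l w)}.
Variable D : 'M[C]_n.
Hypothesis hD : D^H = D.
Hypothesis ED : \sum_l Emx P (X l) = D.

Let Y w := \sum_l X l w - D.

Lemma cmeas_sub (G : set (set T)) (F : T -> C) : G `<=` measurable ->
  @cmeas R _ (g_sigma_algebraType G) F -> @cmeas R _ T F.
Proof.
move=> Gm [m1 m2]; split=> _ A mA; rewrite setTI.
  have := m1 measurableT _ mA; rewrite setTI.
  exact: (smallest_sub (@sigma_algebra_measurable _ T) Gm).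
have := m2 measurableT _ mA; rewrite setTI.
exact: (smallest_sub (@sigma_algebra_measurable _ T) Gm).
Qed.

Let cX l : mxclass (@cbm R d T) (X l).
Proof. by move=> i j; split; [exact: cmeas_sub (@gm l) (mX l i j)|exact: bX]. Qed.

Let cY : mxclass (@cbm R d T) Y.
Proof.
apply: (mxclassB (@cbm_class R d T)); last exact: (mxclass_cst (@cbm_class R d T)).
by apply: (mxclass_sum (@cbm_class R d T)).
Qed.

Let hY w : (Y w)^H = Y w.
Proof. by rewrite /Y adjmxB hD adjmx_sum; congr (_ - _); apply: eq_bigr => l _; rewrite hX. Qed.

Let ct (A B : T -> 'M[C]_n) : mxclass (@cbm R d T) A -> mxclass (@cbm R d T) B ->
  bmeas (fun w => complex.Re (\tr (A w *m B w))).
Proof. by move=> hA hB; apply: bmeas_Re; exact: cbm_trace_mul. Qed.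

(** The sum [N] of the other summands is independent of [X l]: freeze it, apply the inequality for
    constant [N], and integrate. Below, [h] is the difference of the two sides, as a function of the
    point for [N] and the point for [X l]. *)
Lemma trace_decorrelation_sum l k :
  Ex P (fun w => complex.Re (\tr ((X l w - Emx P (X l)) *m Y w ^+ k.*2.+1))) <=
  (k.*2.+1)%:R * r *
  Ex P (fun w => complex.Re (\tr ((X l w + Emx P (X l)) *m Y w ^+ k.*2))).
Proof.
pose U : {set I} := finset (fun i => i != l).
pose G1 : set (set T) := [set E | exists i, i \in U /\ <<s g i>> E].
have sgm i : <<s g i>> `<=` measurable.
  exact: (smallest_sub (@sigma_algebra_measurable _ T) (@gm i)).
have G1m : G1 `<=` measurable by move=> E [i [_ hE]]; exact: sgm hE.
have ind12 : independent2 P <<s G1>> <<s g l>>.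
  by apply: (block_independent (D := [set: I])); rewrite ?finset.subsetT ?inE ?eqxx.
pose N w := \sum_(i | i != l) X i w - D.
have YN w : Y w = N w + X l w.
  by rewrite /Y /N (bigD1 l) //= [X l w + _]addrC addrAC.
have hN w : (N w)^H = N w.
  by rewrite /N adjmxB hD adjmx_sum; congr (_ - _); apply: eq_bigr => i _; rewrite hX.
pose T1 := g_sigma_algebraType G1; pose T2 := g_sigma_algebraType (g l).
have mN : mxclass (@cmeas R _ T1) N.
  apply: (mxclassB (@cmeas_class R _ T1)); last exact: (mxclass_cst (@cmeas_class R _ T1)).
  apply: (mxclass_sum (@cmeas_class R _ T1)) => i il a b.
  have [m1 m2] := mX i a b; split=> _ A mA; rewrite setTI.
    have := m1 measurableT _ mA; rewrite setTI => h.
    by apply: sub_sigma_algebra; exists i; rewrite !inE.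
  have := m2 measurableT _ mA; rewrite setTI => h.
  by apply: sub_sigma_algebra; exists i; rewrite !inE.
have bN : mxclass (@cbdd R T) N.
  apply: (mxclassB (@cbdd_class R T)); last exact: (mxclass_cst (@cbdd_class R T)).
  by apply: (mxclass_sum (@cbdd_class R T)).
pose a := (k.*2.+1)%:R * r; set EX := Emx P (X l).
pose h w w' := a * complex.Re (\tr ((X l w' + EX) *m (N w + X l w') ^+ k.*2)) -
               complex.Re (\tr ((X l w' - EX) *m (N w + X l w') ^+ k.*2.+1)).
pose V := (T1 * T2)%type.
(* One closure argument serves both measurability on the product and boundedness. *)
have generic (Q : (V -> C) -> Prop) : ring_closed_class Q ->
    mxclass Q (fun z => X l z.2) -> mxclass Q (fun z => N z.1) ->
    Q (fun z => \tr ((X l z.2 + EX) *m (N z.1 + X l z.2) ^+ k.*2)) /\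
    Q (fun z => \tr ((X l z.2 - EX) *m (N z.1 + X l z.2) ^+ k.*2.+1)).
  move=> cQ QX QN.
  split; apply: (mxclass_trace cQ); apply: (mxclassM cQ); try apply: (mxclassX cQ);
    try exact: (mxclassD cQ); [apply: (mxclassD cQ)|apply: (mxclassB cQ)] => //;
    exact: (mxclass_cst cQ).
have [m1 m2] : @cmeas R _ V (fun z => \tr ((X l z.2 + EX) *m (N z.1 + X l z.2) ^+ k.*2)) /\
    @cmeas R _ V (fun z => \tr ((X l z.2 - EX) *m (N z.1 + X l z.2) ^+ k.*2.+1)).
  apply: (generic (@cmeas R _ V)); first exact: (@cmeas_class R _ (T1 * T2)%type).
    by move=> i j; exact: (cmeas_comp (mX l i j) (@measurable_snd _ _ T1 T2)).
  by move=> i j; exact: (cmeas_comp (mN i j) (@measurable_fst _ _ T1 T2)).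
have [[K1 b1] [K2 b2]] := generic _ (@cbdd_class R V)
  (fun i j => let: ex_intro K hK := bX l i j in ex_intro _ K (fun z => hK z.2))
  (fun i j => let: ex_intro K hK := bN i j in ex_intro _ K (fun z => hK z.1)).
have mh : measurable_fun [set: V] (fun z => h z.1 z.2).
  apply: measurable_funB; last by case: m2.
  by apply: measurable_funM; [exact: measurable_cst|case: m1].
have hK w w' : `|h w w'| <= `|a| * K1 + K2.
  rewrite /h; apply: le_trans (ler_normB _ _) _; apply: lerD.
    rewrite normrM; apply: ler_wpM2l => //.
    exact: le_trans (normRe_le_normc _) (b1 (w, w')).
  exact: le_trans (normRe_le_normc _) (b2 (w, w')).
have cc (M : 'M[C]_n) : mxclass (@cbm R d T) (fun=> M) by exact: (mxclass_cst (@cbm_class R d T)).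
have cXp := mxclassD (@cbm_class R d T) (cX l) (cc EX).
have cXm := mxclassB (@cbm_class R d T) (cX l) (cc EX).
have cYk j : mxclass (@cbm R d T) (fun w => Y w ^+ j) by exact: (mxclassX (@cbm_class R d T)).
have : 0 <= Ex P (fun w => h w w).
  apply: (decouple_ge0 G1m (@gm l) ind12 mh hK).
    rewrite /h; under eq_fun do rewrite -YN.
    by apply: bmeasB; [apply: bmeasZ; exact: ct|exact: ct].
  move=> w; rewrite /h.
  have cNX j : mxclass (@cbm R d T) (fun w' => (N w + X l w') ^+ j).
    by apply: (mxclassX (@cbm_class R d T)); exact: (mxclassD (@cbm_class R d T)).
  rewrite ExB; [|by apply: bmeasZ; exact: ct|exact: ct].
  rewrite ExZ; last exact: ct.
  by rewrite subr_ge0; apply: trace_decorrelation.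
rewrite /h; under eq_fun do rewrite -YN.
rewrite ExB; [|by apply: bmeasZ; exact: ct|exact: ct].
rewrite ExZ; last exact: ct.
by rewrite subr_ge0.
Qed.

Hypothesis psdD : psdmx (1%:M - D).
Hypothesis r0 : 0 <= r.

Let M k := Ex P (fun w => complex.Re (\tr (Y w ^+ k))).

(** Write one factor of [Y^(2k+2)] as the sum of the [X l - E X l]. After decorrelation the sum of
    the [X l + E X l] is [Y + 2 D], and [D <= 1] removes [D] from the even trace. *)
Lemma trace_moment_step k :
  M k.*2.+2 <= (k.*2.+1)%:R * r * (M k.*2.+1 + 2 * M k.*2).
Proof.
have cc (A : 'M[C]_n) : mxclass (@cbm R d T) (fun=> A) by exact: (mxclass_cst (@cbm_class R d T)).
have cXp l := mxclassD (@cbm_class R d T) (cX l) (cc (Emx P (X l))).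
have cXm l := mxclassB (@cbm_class R d T) (cX l) (cc (Emx P (X l))).
have cYk j : mxclass (@cbm R d T) (fun w => Y w ^+ j) by exact: (mxclassX (@cbm_class R d T)).
have e1 : M k.*2.+2 = \sum_l Ex P (fun w => complex.Re (\tr ((X l w - Emx P (X l)) *m Y w ^+ k.*2.+1))).
  have [_ <-] := @Ex_sum I (index_enum I) xpredT (fun l w => complex.Re (\tr ((X l w - Emx P (X l)) *m Y w ^+ k.*2.+1)))
    (fun l _ => ct (cXm l) (cYk _)).
  congr (Ex P _); apply: funext => w; rewrite -Re_sum; congr complex.Re.
  rewrite -linear_sum /= -mulmx_suml; congr (\tr _).
  by rewrite sumrB ED exprS.
have e2 : \sum_l Ex P (fun w => complex.Re (\tr ((X l w + Emx P (X l)) *m Y w ^+ k.*2))) =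
    Ex P (fun w => complex.Re (\tr (Y w ^+ k.*2.+1)) + 2 * complex.Re (\tr (D *m Y w ^+ k.*2))).
  have [_ <-] := @Ex_sum I (index_enum I) xpredT (fun l w => complex.Re (\tr ((X l w + Emx P (X l)) *m Y w ^+ k.*2)))
    (fun l _ => ct (cXp l) (cYk _)).
  congr (Ex P _); apply: funext => w; rewrite -Re_sum -linear_sum /= -mulmx_suml big_split /= ED.
  have -> : \sum_l X l w + D = Y w + (D + D) by rewrite /Y addrA subrK.
  have -> : (Y w + (D + D)) *m Y w ^+ k.*2 = Y w ^+ k.*2.+1 + (D *m Y w ^+ k.*2 + D *m Y w ^+ k.*2).
    by rewrite mulmxDl [(D + D) *m _]mulmxDl exprS.
  move: (Y w ^+ k.*2.+1) (D *m Y w ^+ k.*2) => A B.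
  by rewrite !mxtraceD !cReD mulr_natl mulr2n.
have tY j : bmeas (fun w => complex.Re (\tr (Y w ^+ j))).
  by apply: bmeas_Re; exact: (mxclass_trace (@cbm_class R d T)).
rewrite e1; apply: (@le_trans _ _ ((k.*2.+1)%:R * r *
   \sum_l Ex P (fun w => complex.Re (\tr ((X l w + Emx P (X l)) *m Y w ^+ k.*2))))).
  by rewrite mulr_sumr; apply: ler_sum => l _; exact: trace_decorrelation_sum.
apply: ler_wpM2l; first by rewrite mulr_ge0.
rewrite e2 ExD ?ExZ //; try exact: ct; last by apply: bmeasZ; exact: ct.
rewrite lerD2l ler_pM2l //; apply: Ex_le; [exact: ct|exact: tY|move=> w].
exact: psdmx_le1_trace.
Qed.

(** Let [x], [z] be the moments of order [2j], [2j+2] and [b = (2j+1) r]. Bounding the odd moment by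
    [(z + x) / 2] gives [z <= b z / 2 + 5/2 b x]. As [b <= 2 k r <= 1], the first term is absorbed
    and [z <= 5 b x <= 10 k r x]. *)
Lemma trace_moment_bound k : (k.*2)%:R * r <= 1 ->
  M k.*2 <= (10 * k%:R * r) ^+ k * n%:R.
Proof.
move=> kr.
have tY j : bmeas (fun w => complex.Re (\tr (Y w ^+ j))).
  by apply: bmeas_Re; apply: (mxclass_trace (@cbm_class R d T)); exact: (mxclassX (@cbm_class R d T)).
have M0 j : 0 <= M j.*2.
  apply: Ex_ae_ge0 => //; apply: aeW => w.
  exact: trace_even_pow_ge0.
have odd j : 2 * M j.*2.+1 <= M j.*2.+2 + M j.*2.
  rewrite -ExZ // -ExD //; apply: Ex_le; [exact: bmeasZ|exact: bmeasD|move=> w].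
  exact: even_trace_dominates.
suff : forall j, (j <= k)%N -> M j.*2 <= (10 * k%:R * r) ^+ j * n%:R by exact.
elim=> [_|j IH jk].
  rewrite expr0 mul1r /M; under eq_fun do rewrite expr0 mxtrace1.
  rewrite Ex_cst (_ : complex.Re _ = n%:R) //.
  by rewrite -[in LHS](rmorph_nat (real_complex R)).
apply: (@le_trans _ _ (10 * k%:R * r * M j.*2)); last first.
  rewrite exprS -[X in _ <= X]mulrA; apply: ler_wpM2l; last exact: IH (ltnW jk).
  by rewrite !mulr_ge0.
have := trace_moment_step j; have := odd j; rewrite doubleS; have := M0 j.
have b0 : 0 <= (j.*2.+1)%:R * r by rewrite mulr_ge0.
have b1 : (j.*2.+1)%:R * r <= (k.*2)%:R * r.
  by apply: ler_wpM2r => //; rewrite ler_nat; apply: ltnW; rewrite -doubleS leq_double.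
have b2 : (k.*2)%:R * r = 2 * (k%:R * r) by rewrite -mul2n natrM mulrA.
rewrite -[10 * _ * _]mulrA.
move: (k%:R * r) ((k.*2)%:R * r) ((j.*2.+1)%:R * r) (M j.*2) (M j.*2.+1) (M j.*2.+2) b0 b1 b2 kr.
move=> s t b x y z b0 b1 b2 kr x0 hy hz.
have h1 : b * y <= b * ((z + x) / 2).
  by apply: ler_wpM2l => //; rewrite ler_pdivlMr // mulrC.
have h2 : b * z <= 1 * z \/ z < 0.
  case: (leP 0 z) => z0; [left|by right].
  by apply: ler_wpM2r => //; apply: le_trans b1 _.
have h3 : b * x <= 2 * s * x by apply: ler_wpM2r => //; rewrite -b2.
have h4 : 0 <= s * x by apply: mulr_ge0 => //; lra.
case: h2 => h2; last by apply: le_trans (ltW h2) _; rewrite -mulrA mulr_ge0.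
have {}hz : z <= b * y + 2 * (b * x) by move: hz; rewrite mulrDr (mulrCA b 2).
have {}h1 : b * y <= (b * z + b * x) / 2 by move: h1; rewrite mulrA mulrDr.
have {}h3 : b * x <= 2 * (s * x) by rewrite mulrA.
rewrite -mulrA; move: (b * y) (b * z) (b * x) (s * x) hz h1 h2 h3 h4 => p q u v; lra.
Qed.

End moments.

Lemma measurable_prod_set {R : realType} {d : measure_display} {T : measurableType d}
    (I : finType) (V : {set I}) (f : I -> T -> R) :
  (forall i, i \in V -> measurable_fun setT (f i)) ->
  measurable_fun setT (fun w => \prod_(i in V) f i w).
Proof.
move=> mf; under eq_fun do rewrite -big_enum /=.
by apply: measurable_prod => i; rewrite mem_enum; exact: mf.
Qed.

(** * Linear forms in random signs *)

Section concentration_of_signs.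
Context {R : realType} {d : measure_display} {T : measurableType d}.
Variable P : probability T R.
Local Notation C := R[i].

(** The linear term vanishes on centered variables and leaves a Gaussian bound. For [x <= 1/2],
    [exp x <= 1 / (1 - x) <= 1 + x + 2 x^2]; for larger [x], already [x <= 2 x^2]. *)
Lemma expR_le_linear_gaussian (x : R) : expR x <= x + expR (2 * x ^+ 2).
Proof.
have [x2|x2] := leP x 2^-1.
  have h1 : expR x * (1 - x) <= 1.
    have := expR_ge1Dx (- x); rewrite expRN => h.
    by move: h; rewrite -(ler_pM2l (expR_gt0 x)) mulfV // gt_eqF // expR_gt0.
  apply: (@le_trans _ _ (x + (1 + 2 * x ^+ 2))); last by rewrite lerD2l expR_ge1Dx.
  have x1 : 0 < 1 - x by lra.
  rewrite -(ler_pM2r x1); apply: le_trans h1 _.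
  have : 0 <= x ^+ 2 * (1 - 2 * x) by rewrite mulr_ge0 ?sqr_ge0 //; lra.
  by move=> h; rewrite -subr_ge0 (_ : _ - _ = x ^+ 2 * (1 - 2 * x)) //; ring.
apply: (@le_trans _ _ (expR (2 * x ^+ 2))); last by rewrite lerDr; lra.
by rewrite ler_expR expr2 mulrA ler_peMl; lra.
Qed.

Lemma bmeas_expR (f : T -> R) : bmeas f -> bmeas (fun w => expR (f w)).
Proof.
move=> [mf [K hK]]; split; first exact: (measurableT_comp (@measurable_expR R) mf).
exists (expR K) => w; rewrite ger0_norm ?expR_ge0 // ler_expR.
exact: le_trans (ler_norm _) (hK w).
Qed.

Lemma Ex_expR_centered (f : T -> R) (a t : R) :
  measurable_fun setT f -> (forall w, `|f w| <= a) -> Ex P f = 0 ->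
  Ex P (fun w => expR (t * f w)) <= expR (2 * t ^+ 2 * a ^+ 2).
Proof.
move=> mf fa f0.
have bf : bmeas f by split => //; exists a.
have btf := bmeasZ t bf.
apply: (@le_trans _ _ (Ex P (fun w => t * f w + expR (2 * t ^+ 2 * a ^+ 2)))).
  apply: Ex_le; [exact: bmeas_expR|by apply: bmeasD => //; exact: bmeas_cst|move=> w].
  apply: le_trans (expR_le_linear_gaussian _) _; rewrite lerD2l ler_expR exprMn mulrA.
  apply: ler_wpM2l; first by rewrite mulr_ge0 ?sqr_ge0.
  by rewrite -(real_normK (num_real (f w))); apply: lerXn2r; rewrite ?nnegrE // (le_trans _ (fa w)).
by rewrite ExD ?ExZ ?Ex_cst ?f0 ?mulr0 ?add0r //; exact: bmeas_cst.
Qed.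

Lemma measurable_diag (G1 G2 : set (set T)) (h : T -> T -> R) :
  G1 `<=` measurable -> G2 `<=` measurable ->
  measurable_fun [set: g_sigma_algebraType G1 * g_sigma_algebraType G2]
    (fun z => h z.1 z.2) ->
  measurable_fun [set: T] (fun w => h w w).
Proof.
move=> G1m G2m mh.
have mid (G : set (set T)) : G `<=` measurable ->
    measurable_fun [set: T] (idfun : T -> g_sigma_algebraType G).
  move=> Gm _ Y mY; rewrite setTI preimage_id.
  exact: (smallest_sub (@sigma_algebra_measurable _ T) Gm).
exact: (measurableT_comp mh (measurable_fun_pair (mid _ G1m) (mid _ G2m))).
Qed.

Lemma Ex_mul_independent (G1 G2 : set (set T)) (F f : T -> R) :
  G1 `<=` measurable -> G2 `<=` measurable -> independent2 P <<s G1>> <<s G2>> ->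
  measurable_fun [set: g_sigma_algebraType G1] F ->
  measurable_fun [set: g_sigma_algebraType G2] f ->
  (forall w, 0 <= F w) -> (forall w, 0 <= f w) -> bmeas F -> bmeas f ->
  bmeas (fun w => F w * f w) /\ Ex P (fun w => F w * f w) = Ex P F * Ex P f.
Proof.
move=> G1m G2m ind mF mf F0 f0 bF bf.
have mh : measurable_fun [set: g_sigma_algebraType G1 * g_sigma_algebraType G2]
    (fun z => F z.1 * f z.2).
  apply: measurable_funM.
    exact: (measurableT_comp mF (@measurable_fst _ _ (g_sigma_algebraType G1) (g_sigma_algebraType G2))).
  exact: (measurableT_comp mf (@measurable_snd _ _ (g_sigma_algebraType G1) (g_sigma_algebraType G2))).
have bFf : bmeas (fun w => F w * f w).
  split; first exact: (@measurable_diag G1 G2 (fun w w' => F w * f w')).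
  have [_ [K hK]] := bF; have [_ [L hL]] := bf; exists (K * L) => w.
  by rewrite normrM; apply: ler_pM.
split=> //.
have [E _] : (\int[P]_w (F w * f w)%:E = \int[P]_w \int[P]_w' (F w * f w')%:E)%E /\
    measurable_fun setT (fun w => \int[P]_w' (F w * f w')%:E)%E.
  apply: (decouple (P := P) (H := fun w w' => (F w * f w')%:E) G1m G2m ind).
    exact/measurable_EFinP.
  by move=> w w'; rewrite lee_fin mulr_ge0.
apply/EFin_inj; rewrite EFin_Ex // E.
have inner w : (\int[P]_w' (F w * f w')%:E = (Ex P f * F w)%:E)%E.
  by rewrite -EFin_Ex; [rewrite ExZ // mulrC|exact: bmeasZ].
under eq_integral do rewrite inner.
by rewrite -EFin_Ex; [rewrite ExZ // mulrC|exact: bmeasZ].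
Qed.

Lemma Ex_prod_le (I : finType) (D : {set I}) (g : I -> set (set T))
    (f : I -> T -> R) (b : I -> R) :
  (forall i, i \in D -> g i `<=` measurable) ->
  mutually_independent P D (fun i => <<s g i>>) ->
  (forall i, i \in D -> measurable_fun [set: g_sigma_algebraType (g i)] (f i)) ->
  (forall i, i \in D -> bmeas (f i)) ->
  (forall i, i \in D -> forall w, 0 <= f i w) ->
  (forall i, i \in D -> Ex P (f i) <= b i) ->
  forall U : {set I}, U \subset D ->
  bmeas (fun w => \prod_(i in U) f i w) /\
  Ex P (fun w => \prod_(i in U) f i w) <= \prod_(i in U) b i.
Proof.
move=> gm ind mf bf f0 fb U; move: {2}#|U| (leqnn #|U|) => N.
have b0 i : i \in D -> 0 <= b i.
  move=> iD; apply: le_trans (fb i iD); apply: Ex_ae_ge0; first exact: bf.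
  by apply: aeW => w; exact: f0.
elim: N U => [|N IH] U cU UD.
  have -> : U = finset.set0 by apply/eqP; rewrite -cards_eq0 -leqn0.
  rewrite big_set0; under eq_fun do rewrite big_set0.
  by rewrite Ex_cst; split => //; exact: bmeas_cst.
have [->|[j jU]] := set_0Vmem U.
  rewrite big_set0; under eq_fun do rewrite big_set0.
  by rewrite Ex_cst; split => //; exact: bmeas_cst.
have jD : j \in D by move/fintype.subsetP : UD; apply.
pose V := finset.setD U (finset.set1 j).
have VD : V \subset D by apply: (fintype.subset_trans _ UD); exact: finset.subsetDl.
have VDi i : i \in V -> i \in D by move/fintype.subsetP : VD; apply.
have jV : j \notin V by rewrite !inE eqxx.
have cV : (#|V| <= N)%N by move: cU; rewrite (cardsD1 j U) jU add1n ltnS.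
have [bV IV] := IH V cV VD.
rewrite (big_setD1 j) //=; under eq_fun do rewrite (big_setD1 j) //= mulrC.
have ind2 := block_independent gm ind VD jD jV.
have G1m : [set E | exists i, i \in V /\ <<s g i>> E] `<=` measurable.
  move=> E [i [iV hE]].
  have sgm : <<s g i>> `<=` measurable.
    by apply: (smallest_sub (@sigma_algebra_measurable _ T)); exact: gm (VDi i iV).
  exact: sgm hE.
have mV : measurable_fun [set: g_sigma_algebraType [set E | exists i, i \in V /\ <<s g i>> E]]
    (fun w => \prod_(i in V) f i w).
  have mfi i : i \in V -> measurable_fun [set: g_sigma_algebraType [set E | exists i, i \in V /\ <<s g i>> E]] (f i).
    move=> iV _ A mA; rewrite setTI; have := mf i (VDi i iV) measurableT _ mA; rewrite setTI => h.
    by apply: sub_sigma_algebra; exists i.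
  exact: measurable_prod_set.
have [bFf ->] := Ex_mul_independent G1m (gm j jD) ind2 mV (mf j jD)
  (fun w => prodr_ge0 _ (fun i iV => f0 i (VDi i iV) w)) (f0 j jD) bV (bf j jD).
split=> //; rewrite [X in _ <= X]mulrC; apply: ler_pM => //.
- apply: Ex_ae_ge0 => //; apply: aeW => w.
  by apply: prodr_ge0 => i iV; exact: f0 (VDi i iV) w.
- by apply: Ex_ae_ge0; [exact: bf|apply: aeW => w; exact: f0].
- exact: fb.
Qed.

(* Chernoff bound conditionally on the first sigma-algebra: [w] in [h w w'] is frozen. *)
Lemma conditional_chernoff (G1 G2 : set (set T)) (good Ev : set T) (h : T -> T -> R) (b : R) :
  G1 `<=` measurable -> G2 `<=` measurable -> independent2 P <<s G1>> <<s G2>> ->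
  <<s G1>> good -> measurable Ev ->
  measurable_fun [set: g_sigma_algebraType G1 * g_sigma_algebraType G2]
    (fun z => h z.1 z.2) ->
  (forall w w', 0 <= h w w') -> 0 <= b ->
  (forall w, good w -> (\int[P]_w' (h w w')%:E <= b%:E)%E) ->
  (forall w, Ev w -> good w /\ 1 <= h w w) ->
  (P Ev <= b%:E)%E.
Proof.
move=> G1m G2m ind mgood mEv mh h0 b0 hb hEv.
pose k w w' : R := \1_good w * h w w'.
have k0 w w' : 0 <= k w w' by rewrite mulr_ge0.
have mk : measurable_fun [set: g_sigma_algebraType G1 * g_sigma_algebraType G2]
    (fun z => k z.1 z.2).
  apply: measurable_funM => //.
  have mi : measurable_fun [set: g_sigma_algebraType G1] (\1_good : _ -> R).
    exact: measurable_indic.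
  exact: (measurableT_comp mi (@measurable_fst _ _ (g_sigma_algebraType G1) (g_sigma_algebraType G2))).
have [E mE] : (\int[P]_w (k w w)%:E = \int[P]_w \int[P]_w' (k w w')%:E)%E /\
    measurable_fun setT (fun w => \int[P]_w' (k w w')%:E)%E.
  apply: (decouple (P := P) (H := fun w w' => (k w w')%:E) G1m G2m ind).
    exact/measurable_EFinP.
  by move=> w w'; rewrite lee_fin.
apply: (@le_trans _ _ (\int[P]_w (k w w)%:E)%E).
  rewrite -(setIT Ev) -integral_indic //.
  apply: ge0_le_integral => //.
  - by apply/measurable_EFinP; exact: measurable_indic.
  - by apply/measurable_EFinP; exact: (@measurable_diag G1 G2 k).
  - move=> w _; rewrite lee_fin indicE; case: (boolP (w \in Ev)) => [|_]; last exact: k0.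
    by rewrite inE => /hEv[gw h1]; rewrite /k indicE mem_set // mul1r.
rewrite E; apply: (@le_trans _ _ (\int[P]_w b%:E)%E).
  apply: ge0_le_integral => //.
  - by move=> w _; apply: integral_ge0 => w' _; rewrite lee_fin.
  - move=> w _; case: (pselect (good w)) => gw.
      by under eq_integral do rewrite /k indicE mem_set // mul1r; exact: hb.
    under eq_integral do rewrite /k indicE memNset // mul0r.
    by rewrite integral0 lee_fin.
by rewrite integral_cst //= probability_setT mule1.
Qed.

End concentration_of_signs.

Import numFieldNormedType.Exports.

(** * Rademacher and Steinhaus variables have mean zero *)

Section centered_signs.
Context {R : realType} {d : measure_display} {T : measurableType d}.
Variable P : probability T R.
Local Notation C := R[i].

(** The generators of [gen_sigma], kept apart because [g_sigma_algebraType] is indexed by a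
    generating family; [<<s sgen F>>] unfolds to [gen_sigma F]. *)
Definition sgen (F : set (T -> R)) : set (set T) :=
  [set E | exists f, F f /\ exists B : set R, measurable B /\ E = f @^-1` B].

Lemma measurable_sgen (F : set (T -> R)) f : F f ->
  measurable_fun [set: g_sigma_algebraType (sgen F)] f.
Proof.
move=> Ff _ Y mY; rewrite setTI; apply: sub_sigma_algebra.
by exists f; split => //; exists Y.
Qed.

Lemma sgen_measurable (F : set (T -> R)) :
  (forall f, F f -> measurable_fun [set: T] f) -> sgen F `<=` measurable.
Proof.
move=> mF _ [f [Ff [Y [mY ->]]]].
by rewrite -[X in measurable X]setTI; apply: mF.
Qed.

Lemma cexpi_surj (c : C) : normc c = 1 -> exists2 t, circ_dom t & c = cexpi t.
Proof.
case: c => a b h.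
have ab : a ^+ 2 + b ^+ 2 = 1.
  by have := congr1 (fun x => x ^+ 2) h; rewrite normc_sqr expr1n.
have a1 : -1 <= a <= 1.
  by rewrite -ler_norml -(@ler_pXn2r _ 2) ?nnegrE // real_normK ?num_real // expr1n -ab lerDl sqr_ge0.
have sE : sin (acos a) = `|b|.
  by rewrite sin_acos // -ab addrAC subrr add0r sqrtr_sqr.
have cE : cos (acos a) = a by rewrite acosK // in_itv.
have p0 := pi_gt0 R.
have [b0|b0] := leP 0 b.
  exists (acos a); last by rewrite /cexpi cE sE ger0_norm.
  rewrite /circ_dom /= in_itv /= acos_ge0 //=.
  by apply: (le_lt_trans (acos_lepi a1)); lra.
(* In the lower half circle the angle is [2 pi - acos a]; excluding [a = 1] makes [acos a] positive
   and keeps the angle in the half-open interval. *)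
have a1' : -1 <= a < 1.
  case/andP: a1 => -> a1 /=; rewrite lt_neqAle a1 andbT; apply/eqP => aE.
  have : 0 < b ^+ 2 by rewrite exprn_even_gt0 //= lt_eqF.
  by move: ab; rewrite aE expr1n => /(congr1 (fun x => x - 1)); rewrite addrAC subrr add0r => ->; rewrite ltxx.
exists (- acos a + pi *+ 2); last first.
  by rewrite /cexpi cosD2pi sinD2pi cosN sinN cE sE ltr0_norm // opprK.
rewrite /circ_dom /= in_itv /= -mulr_natl.
have := acos_gt0 a1'; have := acos_lepi a1.
by move=> h1 h2; apply/andP; split; lra.
Qed.

Lemma two_pi_gt0 : (0 : R) < 2 * pi.
Proof. by rewrite mulr_gt0 // pi_gt0. Qed.

Lemma uniform_prob_circ (A : set R) : measurable A ->
  uniform_prob two_pi_gt0 A = (lebesgue_measure (A `&` circ_dom) * ((2 * pi)^-1)%:E)%E.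
Proof.
move=> mA; have p0 := two_pi_gt0.
rewrite -[in LHS](setIT A) -integral_indic //.
rewrite integral_uniform //; last by apply/measurable_EFinP; exact: measurable_indic.
rewrite subr0 muleC; congr (_ * _)%E.
rewrite -integral_itv_bndo_bndc; last first.
  by apply: measurable_funTS; apply/measurable_EFinP; exact: measurable_indic.
by rewrite integral_indic.
Qed.

(** The mean of [Z] is the average of [F] over a period, [(G (2 pi) - G 0) / (2 pi)]. It is applied
    with [F] equal to [cos] and [sin]. *)
Lemma uniform_law_centered (F G : R -> R) (Z : T -> R) :
  measurable_fun setT Z -> (forall w, `|Z w| <= 1) ->
  measurable_fun setT F -> continuous F -> (forall t, `|F t| <= 1) ->
  (forall t : R, is_derive t 1 G (F t)) -> G (2 * pi) = G 0 ->
  (forall A : set R, measurable A -> P (Z @^-1` A) = uniform_prob two_pi_gt0 (F @^-1` A)) ->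
  Ex P Z = 0.
Proof.
move=> mZ Z1 mF cF F1 dG G0 law; have p0 := two_pi_gt0.
pose Zm : {mfun T >-> R} := HB.pack Z (isMeasurableFun.Build _ _ _ _ _ mZ).
have mF' : measurable_fun [set: measurableTypeR R] F by exact: mF.
pose Fm : {mfun measurableTypeR R >-> R} := HB.pack F (isMeasurableFun.Build _ _ _ _ _ mF').
(* [|1 + y|] is nonnegative everywhere, as the transfer of integrals requires, and equals [1 + y] on
   the range of [Z] and [F]. *)
have mH : measurable_fun [set: R] (fun y : R => `|1 + y|%:E).
  apply/measurable_EFinP; apply: measurableT_comp => //.
  by apply: measurable_funD => //; exact: measurable_cst.
have H0 (y : R) : (0 <= `|1 + y|%:E)%E by rewrite lee_fin.
have E1 : (\int[P]_w `|1 + Z w|%:E = \int[uniform_prob two_pi_gt0]_t `|1 + F t|%:E)%E.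
  transitivity (\int[distribution P Zm]_y `|1 + y|%:E)%E.
    by rewrite ge0_integral_distribution.
  transitivity (\int[distribution (uniform_prob two_pi_gt0) Fm]_y `|1 + y|%:E)%E.
    by apply: eq_measure_integral => A mA _; exact: law.
  by rewrite ge0_integral_distribution.
have pos (y : R) : `|y| <= 1 -> `|1 + y| = 1 + y.
  by rewrite ler_norml => /andP[h _]; rewrite ger0_norm //; lra.
have E2 : (\int[uniform_prob two_pi_gt0]_t `|1 + F t|%:E = 1)%E.
  rewrite integral_uniform //; last exact: (measurableT_comp mH mF).
  under eq_integral do rewrite pos //.
  rewrite (@continuous_FTC2 _ (fun t => 1 + F t) (fun t => t + G t)) //.
  - rewrite G0 subr0 -EFinB opprD addrACA subrr addr0 subr0 -EFinM mulVf //.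
    by rewrite gt_eqF.
  - by apply: continuous_subspaceT => t; apply: cvgD; [exact: cvg_cst|exact: cF].
  - have dd t : derivable (fun t => t + G t) t 1.
      by apply: derivableD => //; have [] := dG t.
    have cc : continuous (fun t => t + G t).
      by move=> t; apply/differentiable_continuous/derivable1_diffP.
    split=> [t _||]; first exact: dd.
      exact: cvg_at_right_filter (cc _).
    exact: cvg_at_left_filter (cc _).
  - move=> t _; rewrite derive1E.
    have dG1 : is_derive t 1 (fun t : R => t + G t) (1 + F t) by exact: is_deriveD.
    exact: derive_val.
have bZ : bmeas Z by split => //; exists 1.
have : Ex P (fun w => 1 + Z w) = 1.
  rewrite /Ex; under eq_integral do rewrite -pos //.
  by rewrite E1 E2.
rewrite ExD ?Ex_cst //; last exact: bmeas_cst.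
by move=> h; lra.
Qed.

Lemma measurable_preimage (f : T -> R) (A : set R) :
  measurable_fun setT f -> measurable A -> measurable (f @^-1` A).
Proof. by move=> mf mA; rewrite -[X in measurable X]setTI; exact: mf. Qed.

Lemma measurable_fiber (X : T -> C) (c : C) : cmeas X -> measurable [set w | X w = c].
Proof.
move=> [m1 m2].
rewrite (_ : [set w | X w = c] = ((fun w => complex.Re (X w)) @^-1` [set complex.Re c]) `&`
  ((fun w => complex.Im (X w)) @^-1` [set complex.Im c])).
  by apply: measurableI; apply: measurable_preimage => //; exact: measurable_set1.
apply/seteqP; split=> w /=; first by move=> ->.
by case: (X w) c => a b [a' b'] /= [-> ->].
Qed.

Lemma rademacher_centered n (S : {set 'I_n}) (sg : T -> 'I_n -> C) i :
  (forall w, normc (sg w i) <= 1) -> rademacher_seq P S sg -> i \in S ->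
  cmeas (fun w => sg w i) /\ Ec P (fun w => sg w i) = 0.
Proof.
move=> sg1 [H _] iS; have [m1 [m2 [h1 hN1]]] := H i iS.
have cm : cmeas (fun w => sg w i) by [].
split=> //.
have cb : cbm (fun w => sg w i) by split=> //; exists 1.
pose A := [set w | sg w i = 1]; pose B := [set w | sg w i = -1].
have mA : measurable A by exact: measurable_fiber.
have mB : measurable B by exact: measurable_fiber.
have dAB : A `&` B = set0.
  apply/seteqP; split=> // w [hA hB].
  have /eqP : (1 : C) = -1 by rewrite -[LHS]hA -[RHS]hB.
  by rewrite -subr_eq0 opprK -(natrD _ 1 1) pnatr_eq0.
have pA : P A = (2^-1)%:E by [].
have pB : P B = (2^-1)%:E by [].
have bi (E : set T) : measurable E -> bmeas (\1_E : T -> R).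
  move=> mE; split; first exact: measurable_indic.
  by exists 1 => w; rewrite indicE; case: (_ \in _); rewrite ?normr1 ?normr0.
have Ei (E : set T) : measurable E -> Ex P (\1_E : T -> R) = fine (P E).
  by move=> mE; rewrite /Ex integral_indic // setIT.
have pAB : P (A `|` B) = 1%E.
  have -> : P (A `|` B) = (P A + P B)%E by rewrite measureU.
  rewrite pA pB -EFinD; congr EFin.
  by rewrite -mulr2n -[2^-1]mulr1 -mulrnAl -mulr_natl mulfV // mulr1.
have ae : {ae P, forall w, (A `|` B) w}.
  exists (~` (A `|` B)); split; [|by rewrite probability_setC ?pAB ?subee //; exact: measurableU|by []].
  by apply: measurableC; exact: measurableU.
have re : Ex P (fun w => complex.Re (sg w i)) = Ex P (fun w => \1_A w - \1_B w).
  apply: Ex_ae_eq; [exact: bmeas_Re|by apply: bmeasB; exact: bi|].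
  apply: filterS ae => w [Aw|Bw].
    rewrite !indicE mem_set // memNset ?subr0 ?Aw // => Bw.
    by have : (A `&` B) w by []; rewrite dAB.
  rewrite !indicE [w \in B]mem_set // memNset ?sub0r ?Bw // => Aw.
  by have : (A `&` B) w by []; rewrite dAB.
have im : Ex P (fun w => complex.Im (sg w i)) = Ex P (fun w => 0).
  apply: Ex_ae_eq; [exact: bmeas_Im|exact: bmeas_cst|].
  by apply: filterS ae => w [->|->] //=; rewrite oppr0.
rewrite /Ec re im Ex_cst ExB; try exact: bi.
by rewrite !Ei // pA pB subrr.
Qed.

(** The hypothesis gives the probability of arcs. On the event [Q] of modulus one every value is
    some [cexpi t], so there the real and imaginary parts follow the laws of [cos t] and [sin t];
    testing with the full line shows that [Q] has probability 1. *)
Lemma steinhaus_centered n (S : {set 'I_n}) (sg : T -> 'I_n -> C) i :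
  (forall w, normc (sg w i) <= 1) -> steinhaus_seq P S sg -> i \in S ->
  cmeas (fun w => sg w i) /\ Ec P (fun w => sg w i) = 0.
Proof.
move=> sg1 [H _] iS; have [m1 [m2 law]] := H i iS.
have cm : cmeas (fun w => sg w i) by [].
split=> //; have p0 := two_pi_gt0.
pose Q := [set w | normc (sg w i) = 1].
have QE : Q = (fun w => complex.Re (sg w i) ^+ 2 + complex.Im (sg w i) ^+ 2) @^-1` [set 1].
  apply/seteqP; split=> w /=; first by rewrite -normc_sqr => ->; rewrite expr1n.
  rewrite -normc_sqr => h; apply/eqP.
  by rewrite -(@eqrXn2 _ 2) ?normc_ge0 // h expr1n.
have mQ : measurable Q.
  rewrite QE; apply: measurable_preimage; last exact: measurable_set1.
  by apply: measurable_funD; exact: measurable_funX.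
have normQ t : normc (cexpi t : C) = 1 by rewrite /= cos2Dsin2 sqrtr1.
have arc (F : R -> R) (proj : C -> R) : (forall t, proj (cexpi t) = F t) ->
    measurable_fun setT F -> measurable_fun setT (fun w => proj (sg w i)) ->
    forall A : set R, measurable A ->
    P ((fun w => proj (sg w i)) @^-1` A) = uniform_prob two_pi_gt0 (F @^-1` A).
  move=> projE mF mproj.
  have key (A : set R) : measurable A ->
      P (((fun w => proj (sg w i)) @^-1` A) `&` Q) = uniform_prob two_pi_gt0 (F @^-1` A).
    move=> mA.
    have mFA : measurable (F @^-1` A) by rewrite -[X in measurable X]setTI; exact: mF.
    rewrite uniform_prob_circ // -law //; congr (P _); apply/seteqP; split=> w /=.
      move=> [Aw /cexpi_surj[t tc sE]]; exists t => //; split=> //.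
      by rewrite /preimage /= -projE -sE.
    move=> [t [[At tc] sE]]; rewrite /Q /= sE normQ projE.
    by split.
  have PQ : P Q = 1%E.
    have := key setT measurableT; rewrite !preimage_setT setTI => ->.
    exact: probability_setT.
  move=> A mA; rewrite -key //.
  have mpA := measurable_preimage mproj mA.
  have -> : P ((fun w => proj (sg w i)) @^-1` A) =
     (P (((fun w => proj (sg w i)) @^-1` A) `&` Q) +
      P (((fun w => proj (sg w i)) @^-1` A) `&` ~` Q))%E.
    rewrite -measureU //; first by rewrite -setIUr setUCr setIT.
    - exact: measurableI.
    - by apply: measurableI => //; exact: measurableC.
    - by rewrite setIACA setICr setI0.
  have -> : P (((fun w => proj (sg w i)) @^-1` A) `&` ~` Q) = 0%E.
    apply/eqP; rewrite eq_le measure_ge0 andbT.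
    apply: (@le_trans _ _ (P (~` Q))).
      apply: le_measure; rewrite ?inE //; last exact: measurableC.
      by apply: measurableI => //; exact: measurableC.
    by rewrite probability_setC // PQ subee.
  by rewrite adde0.
have re : Ex P (fun w => complex.Re (sg w i)) = 0.
  apply: (@uniform_law_centered (@cos R) (@sin R)) => //.
  - by move=> w; exact: le_trans (normRe_le_normc _) (sg1 w).
  - by apply: continuous_measurable_fun; exact: continuous_cos.
  - exact: continuous_cos.
  - by move=> t; rewrite ler_norml cos_geN1 cos_le1.
  - by rewrite mulr_natl sin2pi sin0.
  - by apply: (arc (@cos R) (@complex.Re R)) => //; apply: continuous_measurable_fun; exact: continuous_cos.
have im : Ex P (fun w => complex.Im (sg w i)) = 0.
  apply: (@uniform_law_centered (@sin R) (fun t => - cos t)) => //.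
  - by move=> w; exact: le_trans (normIm_le_normc _) (sg1 w).
  - by apply: continuous_measurable_fun; exact: continuous_sin.
  - exact: continuous_sin.
  - by move=> t; rewrite ler_norml sin_geN1 sin_le1.
  - move=> t; have := is_deriveN (is_derive_cos t); rewrite opprK; exact.
  - by rewrite mulr_natl cos2pi cos0.
  - by apply: (arc (@sin R) (@complex.Im R)) => //; apply: continuous_measurable_fun; exact: continuous_sin.
by rewrite /Ec re im.
Qed.

End centered_signs.

(** * Tail bounds for sign forms, Markov's inequality and the union bound *)

Section tail_bounds.
Context {R : realType} {d : measure_display} {T : measurableType d}.
Variable P : probability T R.
Local Notation C := R[i].

Lemma signs_mgf n (S : {set 'I_n}) (sg : T -> 'I_n -> C) (a : 'I_n -> C) (t : R) :
  (forall w i, normc (sg w i) <= 1) ->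
  (forall i, i \in S -> cmeas (fun w => sg w i)) ->
  (forall i, i \in S -> Ec P (fun w => sg w i) = 0) ->
  mutually_independent P S (fun i => sigmaC (fun w => sg w i)) ->
  bmeas (fun w => expR (t * complex.Re (\sum_(i in S) conjc (a i) * sg w i))) /\
  Ex P (fun w => expR (t * complex.Re (\sum_(i in S) conjc (a i) * sg w i))) <=
    expR (2 * t ^+ 2 * \sum_(i in S) normc (a i) ^+ 2).
Proof.
move=> sg1 csg Esg ind.
pose F i := [set f | f = (fun w => complex.Re (sg w i)) \/ f = (fun w => complex.Im (sg w i))].
pose f i w := expR (t * complex.Re (conjc (a i) * sg w i)).
have E w : expR (t * complex.Re (\sum_(i in S) conjc (a i) * sg w i)) = \prod_(i in S) f i w.
  by rewrite Re_sum mulr_sumr expR_sum.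
under eq_fun do rewrite E.
rewrite mulr_sumr expR_sum.
have cb i : i \in S -> cbm (fun w => sg w i) by move=> iS; split; [exact: csg|exists 1].
have cb' i : i \in S -> cbm (fun w => conjc (a i) * sg w i).
  by move=> iS; apply: (rcc_mul (@cbm_class R d T)); [exact: (rcc_cst (@cbm_class R d T))|exact: cb].
have bd i w : `|complex.Re (conjc (a i) * sg w i)| <= normc (a i).
  apply: le_trans (normRe_le_normc _) _; rewrite normcM normc_conj.
  by rewrite ler_piMr // normc_ge0.
have mF i : i \in S -> sgen (F i) `<=` measurable.
  by move=> iS; apply: sgen_measurable => g [->|->]; have [] := csg i iS.
apply: (@Ex_prod_le R d T P _ S (fun i => sgen (F i))) => //.
- move=> i iS; have ms : cmeas (fun w : g_sigma_algebraType (sgen (F i)) => sg w i).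
    by split; apply: measurable_sgen; [left|right].
  apply: (measurableT_comp (@measurable_expR R)).
  apply: measurable_funM; first exact: measurable_cst.
  have [] // := rcc_mul (@cmeas_class R _ (g_sigma_algebraType (sgen (F i))))
    (rcc_cst (@cmeas_class R _ (g_sigma_algebraType (sgen (F i)))) (conjc (a i))) ms.
- by move=> i iS; apply: bmeas_expR; apply: bmeasZ; apply: bmeas_Re; exact: cb'.
- by move=> i iS w; exact: expR_ge0.
- move=> i iS; apply: Ex_expR_centered => //; first by have [[]] := cb' i iS.
  have : Ec P (fun w => conjc (a i) * sg w i) = 0 by rewrite EcZ ?Esg ?mulr0 //; exact: cb.
  by move/(congr1 (@complex.Re R)).
Qed.

(** The threshold [1/4] is half of the certificate bound [1/2], since a complex value is controlled
    through its real and imaginary parts. *)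
Lemma sign_tail n (S : {set 'I_n}) (sg : T -> 'I_n -> C) (G1 : set (set T))
    (good : set T) (a : T -> 'I_n -> C) (t A : R) :
  (forall w i, normc (sg w i) <= 1) ->
  (forall i, i \in S -> cmeas (fun w => sg w i)) ->
  (forall i, i \in S -> Ec P (fun w => sg w i) = 0) ->
  mutually_independent P S (fun i => sigmaC (fun w => sg w i)) ->
  G1 `<=` measurable -> independent2 P <<s G1>> (sigmaS S sg) ->
  <<s G1>> good ->
  (forall i, i \in S -> @cmeas R _ (g_sigma_algebraType G1) (fun w => a w i)) ->
  (forall w, good w -> \sum_(i in S) normc (a w i) ^+ 2 <= A) ->
  let Ev := good `&` [set w | 4^-1 < complex.Re (\sum_(i in S) conjc (a w i) * sg w i)] in
  0 <= t ->
  measurable Ev /\ (P Ev <= (expR (2 * t ^+ 2 * A - t / 4))%:E)%E.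
Proof.
move=> sg1 csg Esg ind G1m ind2 mgood ma hA Ev t0.
pose F := [set f | exists i, i \in S /\
    (f = (fun w => complex.Re (sg w i)) \/ f = (fun w => complex.Im (sg w i)))].
pose G2 := sgen F.
have G2m : G2 `<=` measurable.
  by apply: sgen_measurable => g [i [iS [->|->]]]; have [] := csg i iS.
pose T1 := g_sigma_algebraType G1; pose T2 := g_sigma_algebraType G2.
have csum : @cmeas R _ (T1 * T2)%type (fun z => \sum_(i in S) conjc (a z.1 i) * sg z.2 i).
  apply: (rcc_sum (@cmeas_class R _ (T1 * T2)%type)) => i iS.
  apply: (rcc_mul (@cmeas_class R _ (T1 * T2)%type)).
    apply: cmeas_conj; exact: (cmeas_comp (ma i iS) (@measurable_fst _ _ T1 T2)).
  have ms : @cmeas R _ T2 (fun w => sg w i).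
    by split; apply: measurable_sgen; exists i; split => //; [left|right].
  exact: (cmeas_comp ms (@measurable_snd _ _ T1 T2)).
pose g w w' := complex.Re (\sum_(i in S) conjc (a w i) * sg w' i).
have mg : measurable_fun [set: T1 * T2] (fun z => g z.1 z.2) by case: csum.
have mEv : measurable Ev.
  have G1sub : <<s G1>> `<=` measurable.
    by apply: (smallest_sub (@sigma_algebra_measurable _ T)).
  apply: measurableI; first exact: G1sub.
  have mgd : measurable_fun [set: T] (fun w => g w w) by exact: measurable_diag mg.
  rewrite (_ : [set w | _] = (fun w => g w w) @^-1` `]4^-1, +oo[%classic).
    by apply: measurable_preimage => //; exact: measurable_itv.
  by apply/seteqP; split=> w /=; rewrite in_itv /= andbT.
split=> //.
pose h w w' := expR (t * g w w') * expR (- (t / 4)).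
have mh : measurable_fun [set: T1 * T2] (fun z => h z.1 z.2).
  apply: measurable_funM; last exact: measurable_cst.
  apply: (measurableT_comp (@measurable_expR R)).
  by apply: measurable_funM => //; exact: measurable_cst.
apply: (conditional_chernoff G1m G2m ind2 mgood mEv mh).
- by move=> w w'; rewrite mulr_ge0 ?expR_ge0.
- exact: expR_ge0.
- move=> w gw; have [bm le] := signs_mgf (a w) t sg1 csg Esg ind.
  have hE : h w = fun w' => expR (- (t / 4)) * expR (t * g w w').
    by apply: funext => w'; rewrite /h mulrC.
  rewrite -EFin_Ex; last by rewrite hE; exact: bmeasZ.
  rewrite lee_fin hE ExZ // mulrC expRD; apply: ler_wpM2r; first exact: expR_ge0.
  apply: le_trans le _; rewrite ler_expR; apply: ler_wpM2l; last exact: hA.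
  by rewrite mulr_ge0 ?sqr_ge0.
- move=> w [gw /= gt]; split=> //; rewrite /h -expRD -[X in X <= _]expR0 ler_expR.
  have : t * 4^-1 <= t * g w w by apply: ler_wpM2l => //; exact: ltW.
  by rewrite -subr_ge0.
Qed.

Lemma Ex_markov (f : T -> R) (c : R) : bmeas f -> (forall w, 0 <= f w) -> 0 < c ->
  (P [set w | (c < f w)%R] <= (Ex P f / c)%:E)%E.
Proof.
move=> bf f0 c0; have [mf _] := bf.
have mE : measurable [set w | c < f w].
  rewrite (_ : [set w | _] = f @^-1` `]c, +oo[%classic).
    by apply: measurable_preimage => //; exact: measurable_itv.
  by apply/seteqP; split=> w /=; rewrite in_itv /= andbT.
have bi : bmeas (\1_[set w | c < f w] : T -> R).
  split; first exact: measurable_indic.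
  by exists 1 => w; rewrite indicE; case: (_ \in _); rewrite ?normr1 ?normr0.
have -> : P [set w | c < f w] = (Ex P (\1_[set w | c < f w] : T -> R))%:E.
  by rewrite EFin_Ex // integral_indic // setIT.
rewrite lee_fin mulrC -ExZ //; apply: Ex_le => //; first exact: bmeasZ.
move=> w; rewrite indicE; case: (boolP (w \in _)) => [|_]; last by rewrite mulr_ge0 // invr_ge0 ltW.
by rewrite inE /= => cf; rewrite mulrC ler_pdivlMr // mul1r ltW.
Qed.

Lemma probability_ae_le (E F : set T) : measurable E -> measurable F ->
  {ae P, forall w, E w -> F w} -> (P E <= P F)%E.
Proof.
move=> mE mF [N [mN PN sN]].
apply: (@le_trans _ _ (P (F `|` N))).
  apply: le_measure; rewrite ?inE //; first exact: measurableU.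
  move=> w Ew; case: (pselect (F w)) => Fw; [by left|right].
  by apply: sN => /= h; exact/Fw/h.
by apply: le_trans (measureU2 _ mF mN) _; rewrite [X in (_ + X)%E]PN adde0.
Qed.

Lemma union_bound (I : finType) (Q : pred I) (F : I -> set T) (b : R) : 0 <= b ->
  (forall i, Q i -> measurable (F i) /\ (P (F i) <= b%:E)%E) ->
  exists E, [/\ measurable E, forall i, Q i -> F i `<=` E & (P E <= (#|I|%:R * b)%:E)%E].
Proof.
move=> b0 hF.
suff H (r : seq I) : exists E, [/\ measurable E, forall i, i \in r -> Q i -> F i `<=` E &
    (P E <= ((size r)%:R * b)%:E)%E].
  have [E [mE sE pE]] := H (enum I); exists E; split=> //.
    by move=> i; apply: sE; rewrite mem_enum.
  by rewrite cardE.
elim: r => [|i r [E [mE sE pE]]].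
  by exists set0; split=> //; rewrite measure0 mul0r.
case: (boolP (Q i)) => Qi; last first.
  exists E; split=> //.
    by move=> j; rewrite in_cons => /orP[/eqP->|jr]; [rewrite (negPf Qi)|exact: sE].
  apply: le_trans pE _; rewrite lee_fin; apply: ler_wpM2r => //.
  by rewrite ler_nat.
have [mF pF] := hF i Qi.
exists (F i `|` E); split; first exact: measurableU.
  move=> j; rewrite in_cons => /orP[/eqP-> _ w Fw|jr Qj w Fw]; first by left.
  by right; exact: sE jr Qj w Fw.
apply: le_trans (measureU2 _ mF mE) _.
by rewrite /= -natr1 mulrDl mul1r addrC EFinD leeD.
Qed.

End tail_bounds.

(** * Choice of the moment order and of the constants *)

Section numerics.
Variable R : realType.

Lemma expR1_le3 : expR 1 <= 3 :> R.
Proof.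
(* [exp (1/6) <= 1 / (1 - 1/6) = 6/5], and [(6/5)^6 = 46656/15625 < 3]. *)
have h : expR (6^-1 : R) <= 6 / 5.
  have := expR_ge1Dx (- 6^-1 : R); rewrite expRN -(ler_pM2l (expR_gt0 6^-1)) mulfV ?gt_eqF ?expR_gt0 //.
  by lra.
have -> : expR 1 = expR 6^-1 ^+ 6 :> R by rewrite -expRM_natl mulfV.
apply: (@le_trans _ _ ((6 / 5) ^+ 6)).
  by apply: lerXn2r; rewrite ?nnegrE ?expR_ge0 // divr_ge0.
by rewrite !exprS expr0; lra.
Qed.

(** The factor 3 inside the logarithm gives [1 <= L], through [e <= 3]. *)
Lemma log_factor (n : nat) (eps : R) (L := ln (3 * n%:R / eps)) :
  (0 < n)%N -> 0 < eps < 1 ->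
  1 <= L /\ expR (- (2 * L)) = (eps / (3 * n%:R)) ^+ 2.
Proof.
move=> n0 /andP[e0 e1].
have np : 1 <= (n%:R : R) by rewrite ler1n.
have q0 : 0 < 3 * n%:R / eps by rewrite divr_gt0 // mulr_gt0 // ltr0n.
split.
  rewrite -ler_expR lnK ?posrE //; apply: le_trans expR1_le3 _.
  rewrite ler_pdivlMr //; apply: (@le_trans _ _ (3 * 1)); last by rewrite ler_pM2l.
  by rewrite ler_pM2l // ltW.
by rewrite expRN expRM_natl lnK ?posrE // -exprVn invf_div.
Qed.

(** The successor form keeps the order positive, as [trace_even_pow_opnorm] requires. *)
Lemma moment_order (L : R) : 1 <= L ->
  exists k : nat, 2 * L <= (k.+1)%:R /\ (k.+1)%:R <= 3 * L.
Proof.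
move=> L1; have L0 : 0 <= 2 * L by lra.
exists (Num.truncn (2 * L)).
have /andP[h1 h2] := truncn_itv L0.
split; first exact: ltW.
by rewrite -natr1; lra.
Qed.

(* [10 k r / delta^2 <= 1/3 <= 1/e], so the k-th moment wins a factor [e^-k]. *)
Lemma moment_tail (c L Lam Gam r delta : R) (m n k : nat) :
  1 <= c -> 1 <= L -> 0 < Lam -> 0 < Gam -> Gam <= Lam -> (0 < m)%N ->
  180 * c * Lam * L ^+ 2 <= m%:R -> r = (Lam + Gam) / m%:R ->
  0 < delta -> delta ^+ 2 = (c * L)^-1 ->
  2 * L <= k%:R -> k%:R <= 3 * L ->
  (k.*2)%:R * r <= 1 /\
  (10 * k%:R * r) ^+ k * n%:R / delta ^+ k.*2 <= n%:R * expR (- (2 * L)).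
Proof.
move=> c1 L1 Lam0 Gam0 GL m0 hm rE d0 dE k1 k2.
have mp : 0 < (m%:R : R) by rewrite ltr0n.
have r0 : 0 <= r by rewrite rE divr_ge0 ?addr_ge0 // ltW.
have L0 : 0 < L by lra.
have c0 : 0 < c by lra.
(* [Lam + Gam <= 2 Lam] turns 180 into 90; then [10 k r c L <= 30 c r L^2 <= 1/3]. *)
have rL : 90 * c * (r * L ^+ 2) <= 1.
  have -> : 90 * c * (r * L ^+ 2) = 90 * c * ((Lam + Gam) * L ^+ 2) / m%:R.
    by rewrite rE; ring.
  rewrite ler_pdivrMr // mul1r; apply: le_trans hm.
  rewrite (_ : 180 * c * Lam * L ^+ 2 = 90 * c * (2 * Lam * L ^+ 2)); last by ring.
  apply: ler_wpM2l; first by rewrite mulr_ge0 // ltW.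
  by apply: ler_wpM2r; [exact: sqr_ge0|lra].
have rL1 : 90 * (r * L) <= 1.
  apply: le_trans rL; rewrite -mulrA; apply: ler_wpM2l => //.
  rewrite mulrCA; apply: ler_wpM2l => //.
  rewrite expr2 mulrA; apply: ler_peMl; first exact: ltW.
  by rewrite -[X in X <= _]mul1r; apply: ler_pM => //; rewrite ltW.
have kr : k%:R * r <= 3 * (r * L).
  by rewrite [r * L]mulrC mulrA; apply: ler_wpM2r.
have kr0 : 0 <= k%:R * r by rewrite mulr_ge0.
split.
  rewrite -mul2n natrM -mulrA; move: (k%:R * r) (r * L) rL1 kr => x y h1 h2.
  by lra.
rewrite -mulrA mulrCA; apply: ler_wpM2l; first exact: ler0n.
rewrite -mul2n exprM dE -exprVn invrK -exprMn.
apply: (@le_trans _ _ (expR (- 1) ^+ k)).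
  apply: lerXn2r.
  - by rewrite nnegrE !mulr_ge0 // ltW.
  - by rewrite nnegrE expR_ge0.
  - apply: (@le_trans _ _ 3^-1); last first.
      by rewrite expRN lef_pV2 ?posrE ?expR_gt0 // expR1_le3.
    have h : c * (k%:R * r * L) <= c * (3 * (r * L ^+ 2)).
      by apply: ler_wpM2l; [exact: ltW|rewrite expr2 !mulrA; apply: ler_wpM2r; [exact: ltW|rewrite -mulrA]].
    rewrite (_ : 10 * _ * _ * _ = 10 * (c * (k%:R * r * L))); last by ring.
    move: rL; rewrite (_ : 90 * c * (r * L ^+ 2) = 30 * (c * (3 * (r * L ^+ 2)))); last by ring.
    by move: (c * (k%:R * r * L)) (c * (3 * (r * L ^+ 2))) h => x y h1 h2; lra.
rewrite -expRM_natr ler_expR mulN1r.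
by lra.
Qed.

End numerics.

(** * Concentration of the Gram matrix *)

Section gram_concentration.
Context {R : realType} {d : measure_display} {T : measurableType d}.
Variable P : probability T R.
Local Notation C := R[i].
Variables (n m : nat) (p : 'I_m -> nat).
Variable B : forall l : 'I_m, T -> 'M[C]_(p l, n).

Lemma gram_sensing (b : forall l : 'I_m, 'M[C]_(p l, n)) :
  (sensing b)^H *m sensing b = (m%:R^-1)%:C *: \sum_l (b l)^H *m b l.
Proof.
rewrite /sensing adjmxZ -scalemxAl -scalemxAr scalerA conjc_real -rmorphM /=.
rewrite -invfM -expr2 sqr_sqrtr ?ler0n //; congr (_ *: _).
have -> : (\mxcol_i b i)^H = \mxrow_i (b i)^H.
  by apply/matrixP => i j; rewrite !mxE.
by rewrite mul_mxrow_mxcol.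
Qed.

Lemma mxclass_cmeas_adj d' (U : measurableType d') k q (X : U -> 'M[C]_(k, q)) :
  mxclass (@cmeas R _ U) X -> mxclass (@cmeas R _ U) (fun u => (X u)^H).
Proof.
move=> hX i j; rewrite (_ : (fun u => _) = fun u => conjc (X u j i)).
  exact: cmeas_conj.
by apply: funext => u; rewrite adjmxE.
Qed.

(** Here [f] will be a truncated entry and [g] the original one, whose integral is given by
    isotropy. *)
Lemma Ex_ae_val (f g : T -> R) (c : R) : bmeas f -> measurable_fun setT g ->
  {ae P, forall w, f w = g w} -> (\int[P]_w (g w)%:E = c%:E)%E -> Ex P f = c.
Proof.
move=> [mf _] mg fg h; rewrite /Ex (_ : (\int[P]_w (f w)%:E)%E = c%:E) //.
rewrite -h; apply: ae_eq_integral => //; [exact/measurable_EFinP|exact/measurable_EFinP|].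
by apply: filterS fg => w -> _.
Qed.

Definition matrix_gen k q (X : T -> 'M[C]_(k, q)) : set (set T) :=
  sgen [set f | exists (i : 'I_k) (j : 'I_q),
    f = (fun w => complex.Re (X w i j)) \/ f = (fun w => complex.Im (X w i j))].

Lemma matrix_gen_class k q (X : T -> 'M[C]_(k, q)) :
  mxclass (@cmeas R _ (g_sigma_algebraType (matrix_gen X))) X.
Proof. by move=> i j; split; apply: measurable_sgen; exists i, j; [left|right]. Qed.

Lemma matrix_gen_measurable k q (X : T -> 'M[C]_(k, q)) :
  random_matrix X -> matrix_gen X `<=` measurable.
Proof.
by move=> rX; apply: sgen_measurable => f [i [j [->|->]]]; have [] := rX i j.
Qed.

Let A w := sensing (p := p) (fun l => B l w).
Let W w := (A w)^H *m A w.
Let G l w := (B l w)^H *m B l w.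

Variables (Lam Gam : R) (S : {set 'I_n}) (i0 : 'I_n).
Hypothesis rB : forall l, random_matrix (B l).
Hypothesis indB : mutually_independent P [set: 'I_m] (fun l => sigmaM (B l)).
Hypothesis iso : forall i j : 'I_n,
     ('E_P[fun w => complex.Re (W w i j)] = ((i == j)%:R)%:E)%E /\
     ('E_P[fun w => complex.Im (W w i j)] = 0%:E)%E.
Hypothesis Lam0 : 0 < Lam.
Hypothesis Gam0 : 0 < Gam.
Hypothesis aeL : {ae P, forall w, forall l : 'I_m,
     opnorm22 (adjmx (colS S (B l w)) *m colS S (B l w)) <= Lam}.
Hypothesis aeG : {ae P, forall w, forall (l : 'I_m) (i : 'I_n),
     l2norm (col i (B l w)) ^+ 2 <= Gam}.
Hypothesis i0S : i0 \notin S.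

Let D := maskmx R (i0 |: S).
Let r := (Lam + Gam) / m%:R.
Let X l w := (m%:R^-1)%:C *: (D *m G l w *m D).
(** The cutoff: [q] is the squared Frobenius norm of [G l w]. Almost surely its [n^2] entries are at
    most [Gam] in modulus, so [bdd l] has probability 1 and [Xt] is a version of [X] bounded
    everywhere. As [bdd l] depends on [B l] alone, independence survives. *)
Let q l w := \sum_i \sum_j normc (G l w i j) ^+ 2.
Let K := (n * n)%:R * Gam ^+ 2.
Let bdd l := [set w | q l w <= K].
Let Xt l w := ((\1_(bdd l) w : R)%:C) *: X l w.
Let g l := matrix_gen (B l).

Let hD : D^H = D. Proof. exact: adjmx_mask. Qed.

Let mG l : mxclass (@cmeas R _ (g_sigma_algebraType (g l))) (G l).
Proof.
apply: (mxclassM (@cmeas_class R _ _)); last exact: matrix_gen_class.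
by apply: mxclass_cmeas_adj; exact: matrix_gen_class.
Qed.

Let mX l : mxclass (@cmeas R _ (g_sigma_algebraType (g l))) (X l).
Proof.
have Q := @cmeas_class R _ (g_sigma_algebraType (g l)).
apply: (mxclassZ Q); first exact: (rcc_cst Q).
apply: (mxclassM Q); last exact: (mxclass_cst Q).
by apply: (mxclassM Q); [exact: (mxclass_cst Q)|exact: mG].
Qed.

Let mbdd l : (@measurable _ (g_sigma_algebraType (g l))) (bdd l).
Proof.
have mq : measurable_fun [set: g_sigma_algebraType (g l)] (q l).
  apply: measurable_sum => i; apply: measurable_sum => j.
  rewrite (_ : (fun w => _) = fun w => complex.Re (G l w i j) ^+ 2 + complex.Im (G l w i j) ^+ 2).
    by have [m1 m2] := mG l i j; apply: measurable_funD; exact: measurable_funX.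
  by apply: funext => w; rewrite normc_sqr.
rewrite (_ : bdd l = q l @^-1` `]-oo, K]%classic).
  by apply: measurable_preimage => //; exact: measurable_itv.
by apply/seteqP; split=> w /=; rewrite in_itv.
Qed.

Let mXt l : mxclass (@cmeas R _ (g_sigma_algebraType (g l))) (Xt l).
Proof.
apply: (mxclassZ (@cmeas_class R _ _)); last exact: mX.
by split; [exact: measurable_indic|exact: measurable_cst].
Qed.

Let XE l w i j : X l w i j =
  (m%:R^-1)%:C * (if j \in i0 |: S then if i \in i0 |: S then G l w i j else 0 else 0).
Proof. by rewrite mxE mulmx_maskE maskmxE. Qed.

Let bXt l : mxclass (@cbdd R T) (Xt l).
Proof.
move=> i j; exists (m%:R^-1 * (K + 1)) => w.
have K0 : 0 <= K by rewrite mulr_ge0 // sqr_ge0.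
have mi0 : 0 <= (m%:R^-1 : R) by rewrite invr_ge0.
rewrite mxE indicE; case: (boolP (w \in bdd l)) => [|_]; last first.
  by rewrite mul0r normc0 mulr_ge0 // addr_ge0.
rewrite inE /bdd /= => qK; rewrite mul1r XE normcM normc_real ger0_norm //.
apply: ler_wpM2l => //.
have hG : normc (G l w i j) <= K + 1.
  rewrite -(@ler_pXn2r _ 2) ?nnegrE ?normc_ge0 ?addr_ge0 //.
  apply: (@le_trans _ _ K); last by rewrite sqrrD1; have := sqr_ge0 K; rewrite -mulr_natl; lra.
  apply: le_trans qK; rewrite /q (bigD1 i) //= (bigD1 j) //= -addrA lerDl addr_ge0 //.
    by apply: sumr_ge0 => j' _; exact: sqr_ge0.
  by apply: sumr_ge0 => i' _; apply: sumr_ge0 => j' _; exact: sqr_ge0.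
by case: ifP => _; [case: ifP => _|] => //; rewrite normc0 addr_ge0.
Qed.

Let hX l w : (X l w)^H = X l w.
Proof. by rewrite /X adjmxZ conjc_real !adjmxM hD adjmxK !mulmxA. Qed.

Let hXt l w : (Xt l w)^H = Xt l w.
Proof. by rewrite /Xt adjmxZ conjc_real hX. Qed.

Let psdXt l : {ae P, forall w, psdmx (r%:C *: Xt l w - Xt l w *m Xt l w)}.
Proof.
have r0 : 0 <= r by rewrite divr_ge0 ?addr_ge0 // ltW.
apply: filterS2 aeL aeG => w hL hG.
rewrite /Xt indicE; case: (_ \in _); last first.
  by rewrite scale0r scaler0 mul0mx subrr => v; rewrite mul0mx /dotc mulmx0 mxE.
rewrite scale1r.
pose c : R := (Num.sqrt (m%:R : R))^-1.
have cc : c ^+ 2 = m%:R^-1 by rewrite exprVn sqr_sqrtr.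
have -> : X l w = (c%:C *: (B l w *m D))^H *m (c%:C *: (B l w *m D)).
  rewrite adjmxZ conjc_real -scalemxAl -scalemxAr scalerA -rmorphM /= -expr2 cc.
  by rewrite /X /G adjmxM hD !mulmxA.
apply: gram_sqr_le => // v.
rewrite -scalemxAl l2normZ normc_real exprMn real_normK ?num_real // cc.
rewrite /r [_ / _]mulrC -[X in _ <= X]mulrA; apply: ler_wpM2l; first by rewrite invr_ge0.
by rewrite -mulmxA; apply: masked_gram_bound => //; exact: ltW.
Qed.

Let aeXt : {ae P, forall w, forall l, Xt l w = X l w}.
Proof.
apply: filterS aeG => w hG l; rewrite /Xt indicE mem_set ?scale1r //.
rewrite /bdd /= /q /K natrM.
have hGij i j : normc (G l w i j) ^+ 2 <= Gam ^+ 2.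
  have -> : G l w i j = dotc (col i (B l w)) (col j (B l w)).
    rewrite /G mxE dotcE; apply: eq_bigr => k _.
    by rewrite adjmxE !mxE.
  apply: (@le_trans _ _ ((l2norm (col i (B l w)) * l2norm (col j (B l w))) ^+ 2)).
    apply: lerXn2r; rewrite ?nnegrE ?normc_ge0 ?mulr_ge0 ?l2norm_ge0 //.
    exact: normc_dotc.
  by rewrite exprMn [X in _ <= X]expr2; apply: ler_pM => //; exact: sqr_ge0.
apply: (@le_trans _ _ (\sum_(i < n) \sum_(j < n) Gam ^+ 2)).
  by apply: ler_sum => i _; apply: ler_sum => j _.
have sE (c : R) : \sum_(i < n) c = n%:R * c by rewrite sumr_const card_ord mulr_natl.
by rewrite !sE mulrA.
Qed.

Let sumX w : \sum_l X l w = D *m W w *m D.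
Proof.
by rewrite /X -scaler_sumr -mulmx_suml -mulmx_sumr /W gram_sensing -scalemxAr -scalemxAl.
Qed.

Let gm l : g l `<=` measurable. Proof. exact: matrix_gen_measurable. Qed.

Lemma measurable_gram : mxclass (@cmeas R _ T) W.
Proof.
have mGT l : mxclass (@cmeas R _ T) (G l).
  by move=> i j; exact: cmeas_sub (@gm l) (@mG l i j).
have -> : W = fun w => (m%:R^-1)%:C *: \sum_l G l w.
  by apply: funext => w; rewrite /W gram_sensing.
apply: (mxclassZ (@cmeas_class R _ T)); first exact: (rcc_cst (@cmeas_class R _ T)).
exact: (mxclass_sum (@cmeas_class R _ T)).
Qed.

(** Isotropy constrains only the sum over [l], which is what the moment recursion uses: the sum is
    almost surely [D W D], with mean [D D = D]. *)
Let EXt : \sum_l Emx P (Xt l) = D.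
Proof.
have cXt l : mxclass (@cbm R d T) (Xt l).
  by move=> i j; split; [exact: cmeas_sub (@gm l) (@mXt l i j)|exact: (bXt l)].
apply/matrixP => i j; rewrite summxE.
under eq_bigr do rewrite mxE.
rewrite -Ec_sum; last by move=> l _; exact: cXt.
have bs : cbm (fun w => \sum_l Xt l w i j).
  by apply: (rcc_sum (@cbm_class R d T)) => l _; exact: cXt.
have ae : {ae P, forall w, \sum_l Xt l w i j =
    if j \in i0 |: S then if i \in i0 |: S then W w i j else 0 else 0}.
  apply: filterS aeXt => w hw.
  rewrite -summxE (eq_bigr (fun l => X l w)) ?sumX => [|l _]; last exact: hw.
  by rewrite mulmx_maskE maskmxE.
have [mW1 mW2] := measurable_gram i j.
have [iso1 iso2] := iso i j; rewrite unlock in iso1; rewrite unlock in iso2.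
have DE : D i j = if j \in i0 |: S then if i \in i0 |: S then ((i == j)%:R : R)%:C else 0 else 0.
  rewrite /D /maskmx !mxE; case: (eqVneq i j) => [->|_] /=.
    by case: (j \in _).
  by rewrite mulr0n; case: ifP => // _; case: ifP.
rewrite DE; apply/eqP; rewrite eq_complex /=; apply/andP; split; apply/eqP.
  apply: (Ex_ae_val (g := fun w => complex.Re (if j \in i0 |: S then if i \in i0 |: S then W w i j else 0 else 0))).
  - exact: bmeas_Re.
  - case: (j \in i0 |: S); last exact: measurable_cst.
    by case: (i \in i0 |: S); [done|exact: measurable_cst].
  - by apply: filterS ae => w ->.
  - case: (j \in i0 |: S); [case: (i \in i0 |: S)|]; first exact: iso1.
      by rewrite integral_cst //= probability_setT mule1.
    by rewrite integral_cst //= probability_setT mule1.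
apply: (Ex_ae_val (g := fun w => complex.Im (if j \in i0 |: S then if i \in i0 |: S then W w i j else 0 else 0))).
- exact: bmeas_Im.
- case: (j \in i0 |: S); last exact: measurable_cst.
  by case: (i \in i0 |: S); [done|exact: measurable_cst].
- by apply: filterS ae => w ->.
- case: (j \in i0 |: S); [case: (i \in i0 |: S)|]; first exact: iso2.
    by rewrite integral_cst //= probability_setT mule1.
  by rewrite integral_cst //= probability_setT mule1.
Qed.

Let Y w := D *m W w *m D - D.

(** [bad] is stated with the untruncated [Y], so that it is an event of the sigma-algebra of [A];
    the moment bound concerns [Yt], which agrees with [Y] almost surely. *)
Lemma gram_trace_tail (k : nat) (delta : R) : 0 < delta -> (k.*2)%:R * r <= 1 ->
  let bad := [set w | delta ^+ k.*2 < complex.Re (\tr (Y w ^+ k.*2))] in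
  measurable bad /\
  (P bad <= ((10 * k%:R * r) ^+ k * n%:R / delta ^+ k.*2)%:E)%E.
Proof.
move=> d0 kr bad.
have r0 : 0 <= r by rewrite divr_ge0 ?addr_ge0 // ltW.
have psdD : psdmx (1%:M - D).
  have -> : 1%:M - D = (1%:M - D)^H *m (1%:M - D).
    rewrite adjmxB adjmx1 hD mulmxBl !mulmxBr !mul1mx mulmx1.
    by rewrite maskmx_sub // subrr subr0.
  exact: psdmx_gram.
pose Yt w := \sum_l Xt l w - D.
pose f w := complex.Re (\tr (Y w ^+ k.*2)).
pose ft w := complex.Re (\tr (Yt w ^+ k.*2)).
have ind' : mutually_independent P [set: 'I_m] (fun l => <<s g l>>) by exact: indB.
have Mb := @trace_moment_bound R d T P n 'I_m g gm ind' Xt mXt bXt hXt r psdXt D hD EXt psdD r0 k kr.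
have mf : measurable_fun setT f.
  have Q := @cmeas_class R _ T.
  have mY : mxclass (@cmeas R _ T) Y.
    apply: (mxclassB Q); last exact: (mxclass_cst Q).
    apply: (mxclassM Q); last exact: (mxclass_cst Q).
    by apply: (mxclassM Q); [exact: (mxclass_cst Q)|exact: measurable_gram].
  by have [] := mxclass_trace Q (mxclassX Q k.*2 mY).
have bft : bmeas ft.
  apply: bmeas_Re; have Q := @cbm_class R d T.
  apply: (mxclass_trace Q); apply: (mxclassX Q).
  apply: (mxclassB Q); last exact: (mxclass_cst Q).
  apply: (mxclass_sum Q) => l _ i j.
  by split; [exact: cmeas_sub (@gm l) (@mXt l i j)|exact: (bXt l)].
have msup (h : T -> R) : measurable_fun setT h -> measurable [set w | delta ^+ k.*2 < h w].
  move=> mh; rewrite (_ : [set w | _] = h @^-1` `]delta ^+ k.*2, +oo[%classic).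
    by apply: measurable_preimage => //; exact: measurable_itv.
  by apply/seteqP; split=> w /=; rewrite in_itv /= andbT.
split; first exact: msup.
have hYt w : (Yt w)^H = Yt w.
  by rewrite /Yt adjmxB hD adjmx_sum; congr (_ - _); apply: eq_bigr => l _; rewrite hXt.
apply: (@le_trans _ _ (P [set w | delta ^+ k.*2 < ft w])).
  apply: probability_ae_le; [exact: msup|by apply: msup; case: bft|].
  apply: filterS aeXt => w hw; rewrite /bad /= /ft.
  have -> // : Yt w = Y w.
  by rewrite /Yt /Y (eq_bigr (fun l => X l w)) ?sumX => [|l _].
apply: le_trans (Ex_markov P bft _ _) _; last 1 first.
- rewrite lee_fin ler_pM2r ?invr_gt0 ?exprn_gt0 //; exact: Mb.
- by move=> w; exact: trace_even_pow_ge0.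
- exact: exprn_gt0.
Qed.

End gram_concentration.

(** * The recovery event *)

Section dual_certificate.
Variable R : realType.
Local Notation C := R[i].
Variable n : nat.
Implicit Types (W : 'M[C]_n) (S : {set 'I_n}).

Definition masked_mx W S : 'M[C]_n := maskmx R S *m W *m maskmx R S - maskmx R S.

(* The column [K^-1 D W e_i] of the dual certificate, with the inverse spelled
   out by Cramer's rule so that it depends polynomially on [W] up to [1/det]. *)
Definition dual_column W S i : 'cV[C]_n :=
  (\det (1%:M + masked_mx W S))^-1 *:
    (\adj (1%:M + masked_mx W S) *m col i (maskmx R S *m W)).

(** The even trace bound controls the whole block on [S] and [i]; inverting the near-identity matrix
    costs a factor 2, so the dual column has norm at most [2 delta]. *)
Lemma dual_columnP W S i (k : nat) (delta : R) :
  W^H = W -> 0 <= delta -> delta <= 2^-1 -> i \notin S ->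
  complex.Re (\tr (masked_mx W (i |: S) ^+ k.*2.+2)) <= delta ^+ k.*2.+2 ->
  [/\ forall v : 'cV[C]_n, l2norm (masked_mx W S *m v) <= 2^-1 * l2norm v,
      l2norm (col i (maskmx R S *m W)) <= 2^-1,
      invmx (1%:M + masked_mx W S) *m col i (maskmx R S *m W) = dual_column W S i &
      \sum_(j in S) normc (dual_column W S i j 0) ^+ 2 <= 4 * delta ^+ 2].
Proof.
move=> hW d0 d1 iS htr.
have hY : (masked_mx W (i |: S))^H = masked_mx W (i |: S).
  by rewrite /masked_mx adjmxB !adjmxM !adjmx_mask hW mulmxA.
have [h1 h2] := mask_transfer iS (trace_even_pow_opnorm hY d0 htr).
have h1' (v : 'cV[C]_n) : l2norm (masked_mx W S *m v) <= 2^-1 * l2norm v.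
  by apply: le_trans (h1 v) _; apply: ler_wpM2r => //; exact: l2norm_ge0.
have hu : 1%:M + masked_mx W S \in unitmx.
  by apply: (@unitmx_near1 _ _ _ 2^-1) => //; lra.
have hv : invmx (1%:M + masked_mx W S) *m col i (maskmx R S *m W) = dual_column W S i.
  by rewrite /invmx hu -scalemxAl.
split=> //; first exact: le_trans h2 d1.
apply: (@le_trans _ _ (l2norm (dual_column W S i) ^+ 2)).
  rewrite sqr_l2norm [X in _ <= X](bigID (mem S)) /= lerDl.
  by apply: sumr_ge0 => j _; exact: sqr_ge0.
have -> : 4 * delta ^+ 2 = (2 * delta) ^+ 2 by ring.
apply: lerXn2r; rewrite ?nnegrE ?l2norm_ge0 ?mulr_ge0 //.
apply: le_trans (l2norm_near1 _ h1') _; apply: ler_wpM2l => //.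
by rewrite -hv mulmxA mulmxV // mul1mx.
Qed.

(** The four rotations [1, -1, i, -i], indexed by a finite type: one-sided bounds on the real part
    of each rotation control a complex modulus. *)
Definition quarter_turn (b : bool * bool) : C :=
  if b.1 then (if b.2 then 1 else -1)
  else (if b.2 then Complex 0 1 else - Complex 0 1).

Lemma normc_quarter_turn b : normc (quarter_turn b) = 1.
Proof.
by case: b => [[] []]; rewrite /quarter_turn /= ?oppr0 ?sqrrN !expr2 mulr0 mulr1 ?addr0 ?add0r sqrtr1.
Qed.

Lemma normc_le_quarter_turns (z : C) (c : R) :
  (forall b, complex.Re (quarter_turn b * z) <= c) -> normc z <= c + c.
Proof.
move=> h; apply: le_trans (normc_leD z) _.
have h1 := h (true, true); have h2 := h (true, false).
have h3 := h (false, true); have h4 := h (false, false).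
move: h1 h2 h3 h4; rewrite /quarter_turn /= mul1r mulN1r mulNr; case: z {h} => a b /=.
rewrite !mul0r !mul1r !sub0r opprK => h1 h2 h3 h4.
by apply: lerD; rewrite ler_norml; apply/andP; split; lra.
Qed.

Lemma dotc_csign (v x : 'cV[C]_n) S : (forall i, i \notin S -> x i 0 = 0) ->
  dotc v (\col_i csign (x i 0)) = \sum_(j in S) conjc (v j 0) * csign (x j 0).
Proof.
move=> xS; rewrite dotcE [LHS](bigID (mem S)) /= [X in _ + X]big1 ?addr0.
  by apply: eq_bigr => j _; rewrite mxE.
by move=> j jS; rewrite mxE xS // /csign mul0r mulr0.
Qed.

End dual_certificate.

(** * Probability of the recovery event *)

Section recovery_probability.
Context {R : realType} {d : measure_display} {T : measurableType d}.
Variable P : probability T R.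
Local Notation C := R[i].
Variables (n m : nat) (p : 'I_m -> nat).
Variable B : forall l : 'I_m, T -> 'M[C]_(p l, n).

Lemma sensing_measurable : (forall l, random_matrix (B l)) ->
  random_matrix (fun w => sensing (fun l => B l w)).
Proof.
move=> rB i j.
have Q := @cmeas_class R _ T.
suff [m1 m2] : cmeas (fun w => sensing (fun l => B l w) i j) by [].
rewrite (_ : (fun w => _) = fun w => ((Num.sqrt (m%:R : R))^-1)%:C * B (tagnat.sig1 i) w (tagnat.sig2 i) j).
  apply: (rcc_mul Q); first exact: (rcc_cst Q).
  exact: rB.
by apply: funext => w; rewrite /sensing !mxE.
Qed.

Let A w := sensing (p := p) (fun l => B l w).
Let W w := (A w)^H *m A w.
Let GA := matrix_gen A.
Local Notation TA := (g_sigma_algebraType GA).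

(** The signs are independent of [A], so whatever is frozen in the Chernoff bound has to be
    measurable for the sigma-algebra of [A]. *)
Lemma gram_class : mxclass (@cmeas R _ TA) W.
Proof.
apply: (mxclassM (@cmeas_class R _ TA)); last exact: matrix_gen_class.
by apply: mxclass_cmeas_adj; exact: matrix_gen_class.
Qed.

Lemma masked_class S : mxclass (@cmeas R _ TA) (fun w => masked_mx (W w) S).
Proof.
have Q := @cmeas_class R _ TA.
apply: (mxclassB Q); last exact: (mxclass_cst Q).
apply: (mxclassM Q); last exact: (mxclass_cst Q).
by apply: (mxclassM Q); [exact: (mxclass_cst Q)|exact: gram_class].
Qed.

Lemma dual_column_class S i : mxclass (@cmeas R _ TA) (fun w => dual_column (W w) S i).
Proof.
have Q := @cmeas_class R _ TA.
have mK : mxclass (@cmeas R _ TA) (fun w => 1%:M + masked_mx (W w) S).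
  by apply: (mxclassD Q); [exact: (mxclass_cst Q)|exact: masked_class].
apply: (mxclassZ Q); first by apply: cmeas_inv; exact: (mxclass_det Q).
apply: (mxclassM Q); first exact: (mxclass_adjugate Q).
rewrite (_ : (fun w => _) = fun w => maskmx R S *m W w *m delta_mx i 0).
  apply: (mxclassM Q); last exact: (mxclass_cst Q).
  by apply: (mxclassM Q); [exact: (mxclass_cst Q)|exact: gram_class].
by apply: funext => w; rewrite colE.
Qed.

Variables (Lam Gam : R) (S : {set 'I_n}) (sg : T -> 'I_n -> C).
Hypothesis m0 : (0 < m)%N.
Hypothesis rB : forall l, random_matrix (B l).
Hypothesis indB : mutually_independent P [set: 'I_m] (fun l => sigmaM (B l)).
Hypothesis iso : forall i j : 'I_n,
     ('E_P[fun w => complex.Re (W w i j)] = ((i == j)%:R)%:E)%E /\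
     ('E_P[fun w => complex.Im (W w i j)] = 0%:E)%E.
Hypothesis Lam0 : 0 < Lam.
Hypothesis Gam0 : 0 < Gam.
Hypothesis aeL : {ae P, forall w, forall l : 'I_m,
     opnorm22 (adjmx (colS S (B l w)) *m colS S (B l w)) <= Lam}.
Hypothesis aeG : {ae P, forall w, forall (l : 'I_m) (i : 'I_n),
     l2norm (col i (B l w)) ^+ 2 <= Gam}.
Hypothesis sg1 : forall w i, normc (sg w i) <= 1.
Hypothesis csg : forall i, i \in S -> cmeas (fun w => sg w i).
Hypothesis Esg : forall i, i \in S -> Ec P (fun w => sg w i) = 0.
Hypothesis indS : mutually_independent P S (fun i => sigmaC (fun w => sg w i)).
Hypothesis indSA : independent2 P (sigmaS S sg) <<s GA>>.
Variables L c : R.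
Hypothesis L1 : 1 <= L.
Hypothesis cE : c = 32 * 32.
Hypothesis GL : Gam <= Lam.
Hypothesis hm : 180 * c * Lam * L ^+ 2 <= m%:R.

Let certified i w :=
  [/\ forall v : 'cV[C]_n, l2norm (masked_mx (W w) S *m v) <= 2^-1 * l2norm v,
      l2norm (col i (maskmx R S *m W w)) <= 2^-1 &
      normc (\sum_(j in S) conjc ((invmx (1%:M + masked_mx (W w) S) *m
        col i (maskmx R S *m W w)) j 0) * sg w j) <= 2^-1].

(** In the bound, [n] is the trace of the identity from the moment method and 4 counts the quarter
    turns. The value [c = 32 * 32] makes both failure modes decay like [exp (- 2 L)]. *)
Lemma column_certificate i : i \notin S ->
  exists F : set T, [/\ measurable F, forall w, ~ F w -> certified i w &
    (P F <= ((n%:R + 4) * expR (- (2 * L)))%:E)%E].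
Proof.
move=> iS; have L0 : 0 < L by apply: lt_le_trans L1.
have c1 : 1 <= c by rewrite cE; lra.
have c0 : 0 < c by apply: lt_le_trans c1.
have cL0 : 0 < (c * L)^-1 by rewrite invr_gt0 mulr_gt0.
(* With [t = 16 L] the Chernoff exponent [2 t^2 (4 delta^2) - t / 4] is [- 2 L]. *)
pose delta : R := Num.sqrt (c * L)^-1.
have d0 : 0 < delta by rewrite sqrtr_gt0.
have d2 : delta ^+ 2 = (c * L)^-1 by rewrite sqr_sqrtr // ltW.
have dh : delta <= 2^-1.
  have d0' := ltW d0.
  rewrite -(@ler_pXn2r _ 2) ?nnegrE // d2 exprVn lef_pV2 ?posrE ?mulr_gt0 //.
  apply: (@le_trans _ _ (c * 1)); first by rewrite cE; lra.
  by rewrite ler_pM2l.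
have [k [k1 k2]] := moment_order L1.
have [kr bk] := @moment_tail R c L Lam Gam _ delta m n k.+1 c1
  L1 Lam0 Gam0 GL m0 hm erefl d0 d2 k1 k2.
have [mbad Pbad] := gram_trace_tail rB indB iso Lam0 Gam0 aeL aeG iS d0 kr.
set bad := [set w | _] in mbad Pbad.
have GAm : GA `<=` measurable.
  by apply: matrix_gen_measurable; exact: sensing_measurable.
have sbad : <<s GA>> (~` bad).
  have [mf _] := mxclass_trace (@cmeas_class R _ TA)
    (mxclassX (@cmeas_class R _ TA) (k.+1).*2 (masked_class (i |: S))).
  rewrite (_ : ~` bad = (fun w => complex.Re (\tr (masked_mx (W w) (i |: S) ^+ (k.+1).*2)))
    @^-1` `]-oo, delta ^+ (k.+1).*2]%classic).
    have := mf measurableT _ (measurable_itv `]-oo, delta ^+ (k.+1).*2]); rewrite setTI; exact.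
  by apply/seteqP; split=> w /=; rewrite in_itv /= leNgt => /negP.
have good w : (~` bad) w -> [/\ forall v : 'cV[C]_n, l2norm (masked_mx (W w) S *m v) <= 2^-1 * l2norm v,
      l2norm (col i (maskmx R S *m W w)) <= 2^-1,
      invmx (1%:M + masked_mx (W w) S) *m col i (maskmx R S *m W w) = dual_column (W w) S i &
      \sum_(j in S) normc (dual_column (W w) S i j 0) ^+ 2 <= 4 * delta ^+ 2].
  move=> nb; apply: (@dual_columnP _ _ _ _ _ k) => //; first by rewrite adjmxM adjmxK.
    exact: ltW.
  by rewrite leNgt; apply/negP.
have indAS : independent2 P <<s GA>> (sigmaS S sg).
  by move=> E1 E2 h1 h2; rewrite setIC muleC; exact: indSA.
(* The rotation is absorbed into the coefficients, whose moduli it preserves, so that [sign_tail]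
   applies to each real part. *)
pose a b w j := conjc (quarter_turn R b) * dual_column (W w) S i j 0.
have ma b j : j \in S -> @cmeas R _ TA (fun w => a b w j).
  move=> _; have Q := @cmeas_class R _ TA.
  by apply: (rcc_mul Q); [exact: (rcc_cst Q)|exact: dual_column_class].
have ha b w : (~` bad) w -> \sum_(j in S) normc (a b w j) ^+ 2 <= 4 * delta ^+ 2.
  move=> /good[_ _ _]; apply: le_trans; apply: ler_sum => j _.
  have -> // : normc (a b w j) = normc (dual_column (W w) S i j 0).
  rewrite /a normcM normc_conj normc_quarter_turn; exact: mul1r.
have t0 : 0 <= 16 * L by rewrite mulr_ge0 // ltW.
pose Ev b := (~` bad) `&` [set w | 4^-1 < complex.Re (\sum_(j in S) conjc (a b w j) * sg w j)].
have hEv b : xpredT b -> measurable (Ev b) /\ (P (Ev b) <= (expR (- (2 * L)))%:E)%E.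
  move=> _; have [mE PE] := sign_tail sg1 csg Esg indS GAm indAS sbad (ma b) (ha b) t0.
  split=> //; apply: le_trans PE _; rewrite lee_fin ler_expR d2.
  have -> : (16 * L) ^+ 2 = 256 * (L * L) by ring.
  have -> : 2 * (256 * (L * L)) * (4 * (c * L)^-1) = 2 * L.
    by rewrite cE; field; rewrite gt_eqF.
  by lra.
have [E [mE sE PE]] := union_bound (expR_ge0 _) hEv.
exists (bad `|` E); split; first exact: measurableU.
  move=> w nF; have nb : (~` bad) w by move=> h; apply: nF; left.
  have [g1 g2 g3 _] := good w nb.
  split=> //; rewrite g3 (_ : 2^-1 = 4^-1 + 4^-1); last by lra.
  apply: normc_le_quarter_turns => b.
  rewrite leNgt; apply/negP => hb; apply: nF; right; apply: (sE b) => //; split=> //=.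
  rewrite (eq_bigr (fun j => quarter_turn R b * (conjc (dual_column (W w) S i j 0) * sg w j))).
    by rewrite -mulr_sumr.
  by move=> j _; rewrite /a rmorphM /= conjcK mulrA.
apply: le_trans (measureU2 _ mbad mE) _.
rewrite mulrDl EFinD; apply: leeD.
  by apply: le_trans Pbad _; rewrite lee_fin.
by apply: le_trans PE _; rewrite card_prod card_bool.
Qed.

(** Summing over at most [n] columns gives [n (n + 4) (eps / 3n)^2 = (n + 4) / (9 n) * eps^2], at
    most [eps] since [n >= 1]: the exponent [2 L] is what pays for both factors of order [n]. *)
Lemma recovery_event eps : (0 < n)%N -> 0 < eps < 1 -> L = ln (3 * n%:R / eps) ->
  exists E : set T, [/\ measurable E, ((1 - eps)%:E <= P E)%E &
    forall w, E w -> forall i, i \notin S -> certified i w].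
Proof.
move=> n0 e01 LE; have /andP[e0 e1] := e01.
have [_ eL] := log_factor n0 e01; rewrite -LE in eL.
have np : 1 <= (n%:R : R) by rewrite ler1n.
pose b := (n%:R + 4) * expR (- (2 * L)).
have b0 : 0 <= b by rewrite mulr_ge0 ?expR_ge0 // addr_ge0.
have hex (i : 'I_n) : exists Fi : set T, i \notin S ->
    [/\ measurable Fi, forall w, ~ Fi w -> certified i w & (P Fi <= b%:E)%E].
  case: (boolP (i \in S)) => [_|iS]; first by exists set0.
  by have [Fi hFi] := column_certificate iS; exists Fi.
have [F hF] := choice hex.
have [E [mE sE PE]] := @union_bound _ _ _ P 'I_n (fun i => i \notin S) F b b0
  (fun i iS => let: And3 h _ h' := hF i iS in conj h h').
exists (~` E); split; first exact: measurableC.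
  rewrite probability_setC // EFinB; apply: leeB => //; apply: le_trans PE _.
  rewrite lee_fin card_ord /b eL.
  have -> : n%:R * ((n%:R + 4) * (eps / (3 * n%:R)) ^+ 2) = (n%:R + 4) / (9 * n%:R) * eps ^+ 2.
    by field; rewrite gt_eqF //; lra.
  apply: (@le_trans _ _ (1 * eps ^+ 2)); last first.
    by rewrite mul1r expr2 ler_piMr // ltW.
  apply: ler_wpM2r; first exact: sqr_ge0.
  by rewrite ler_pdivrMr ?mulr_gt0 //; lra.
move=> w nE i iS; have [_ + _] := hF i iS; apply => Fw.
by apply: nE; exact: sE Fw.
Qed.

End recovery_probability.

Theorem mainTheorem6 :
  exists c1 c2 C1 C2 : Rdefinitions.R,
  0 < c1 /\ 0 < c2 /\ 0 < C1 /\ 0 < C2 /\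
  forall (n m : nat) (p : 'I_m -> nat)
    (d : measure_display) (T : measurableType d)
    (P : probability T Rdefinitions.R)
    (B : forall l : 'I_m, T -> 'M[Rdefinitions.R[i]]_(p l, n))
    (Lam Gam : Rdefinitions.R)
    (S : {set 'I_n}) (real_case : bool)
    (x : T -> 'cV[Rdefinitions.R[i]]_n)
    (noise : T -> 'cV[Rdefinitions.R[i]]_(\sum_(l < m) p l))
    (eta eps : Rdefinitions.R),
  let A := fun w => sensing (p := p) (fun l => B l w) in
  let sg := fun w i => csign (x w i 0) in
  (* setting: n, m, p_l >= 1; B_l independent random matrices; isotropy *)
  (0 < n)%N -> (0 < m)%N -> (forall l, 0 < p l)%N ->
  (forall l, random_matrix (B l)) ->
  mutually_independent P [set: 'I_m] (fun l => sigmaM (B l)) ->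
  (forall i j : 'I_n,
     ('E_P[fun w => complex.Re ((adjmx (A w) *m A w) i j)] = ((i == j)%:R)%:E)%E /\
     ('E_P[fun w => complex.Im ((adjmx (A w) *m A w) i j)] = 0%:E)%E) ->
  (* Lambda(S,F) and Gamma(F) *)
  0 < Lam -> 0 < Gam ->
  {ae P, forall w, forall l : 'I_m,
     opnorm22 (adjmx (colS S (B l w)) *m colS S (B l w)) <= Lam} ->
  {ae P, forall w, forall (l : 'I_m) (i : 'I_n),
     l2norm (col i (B l w)) ^+ 2 <= Gam} ->
  (* |S| = s <= n/2, x supported on S *)
  (#|S| * 2 <= n)%N ->
  (forall w (i : 'I_n), i \notin S -> x w i 0 = 0) ->
  (* random sign assumption *)
  (if real_case
   then (forall w (i : 'I_n), complex.Im (x w i 0) = 0) /\ rademacher_seq P S sg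
   else steinhaus_seq P S sg) ->
  independent2 P (sigmaS S sg)
    (gen_sigma [set f | exists i j, f = (fun w => complex.Re (A w i j)) \/
                                    f = (fun w => complex.Im (A w i j))]) ->
  (* noise *)
  (forall w, l2norm (noise w) <= eta) ->
  (* hypotheses *)
  0 < eps < 1 ->
  c1 * Gam <= Lam ->
  c2 * Lam * (ln (3 * n%:R / eps)) ^+ 2 <= m%:R ->
  exists E : set T, measurable E /\ ((1 - eps)%:E <= P E)%E /\
    forall w, E w ->
    forall z : 'cV[Rdefinitions.R[i]]_n,
      qBP_minimizer (A w) (A w *m x w + noise w) eta z ->
      l2norm (x w - z) <= (C1 + C2 * Num.sqrt (#|S|%:R)) * eta.
Proof.
(* [c1 = 1] gives [Gam <= Lam]; [c2] is the constant of [moment_tail] at [c = 32 * 32]; 8 and 16 are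
   those of [recovery_from_certificate]. *)
exists 1, (180 * (32 * 32)), 8, 16.
split; first exact: ltr01.
split; first by rewrite !mulr_gt0.
do 2 (split; first by []).
move=> n m p d T P B Lam Gam S real_case x noise eta eps A sg n0 m0 _ rB indB iso
  Lam0 Gam0 aeL aeG S2 xS signs indA hnoise e01 GL hm.
have sg1 w i : normc (sg w i) <= 1 by exact: normc_csign.
have csg i : i \in S -> cmeas (fun w => sg w i) /\ Ec P (fun w => sg w i) = 0.
  by case: real_case signs => [[_ hs]|hs]; [exact: rademacher_centered|exact: steinhaus_centered].
have indS : mutually_independent P S (fun i => sigmaC (fun w => sg w i)).
  by case: real_case signs => [[_ [_ hs]]|[_ hs]].
have [L1 _] := log_factor n0 e01.
rewrite mul1r in GL.
have [E [mE PE hE]] := @recovery_event _ _ T P n m p B Lam Gam S sg m0 rB indB iso Lam0 Gam0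
  aeL aeG sg1 (fun i iS => (csg i iS).1) (fun i iS => (csg i iS).2) indS indA
  (ln (3 * n%:R / eps)) (32 * 32) L1 erefl GL hm eps n0 e01 erefl.
exists E; split=> //; split=> // w Ew z hz.
(* The conditioning of [W] on [S] is extracted from the block of some outside index, which exists
   because [2 |S| <= n] and [0 < n]. *)
have [i iS] : exists i : 'I_n, i \notin S.
  apply: contrapT => h; have SE : S = finset.setT.
    by apply/setP => i; rewrite inE; case: (boolP (i \in S)) => // iS; case: h; exists i.
  by move: S2; rewrite SE cardsT card_ord leqNgt ltn_Pmulr.
have [hY _ _] := hE w Ew i iS.
apply: (recovery_from_certificate (xS w) hY _ _ (hnoise w) hz).
  by move=> j jS; have [] := hE w Ew j jS.
move=> j jS; rewrite (dotc_csign _ (xS w)).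
by have [] := hE w Ew j jS.
Qed.
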